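(* Let $\rho\in\mathcal{S}_+^{\rm mon}$ and $\alpha\in\mathbb{N}$. There is a constant $C>0$, independent of $n$, such that for all integers $n\ge2$ the randomized Möbius-transformed trapezoidal rule $A_{n,\mathrm{RMT}}$ satisfies $$e^{\mathrm{rmse}}\big(A_{n,\mathrm{RMT}},W^{\alpha,2}_\rho(\mathbb{R})\big)\le C\,n^{-\alpha-1/2}.$$
   Context: $\mathbb{N}=\{1,2,\dots\}$, $\mathbb{N}_0=\mathbb{N}\cup\{0\}$. Monotonic Schwartz weights: $\mathcal{S}$ is the Schwartz space of $\omega\in C^\infty(\mathbb{R})$ with $\sup_{x\in\mathbb{R}}|x^a\omega^{(b)}(x)|<\infty$ for all $a,b\in\mathbb{N}_0$. $\mathcal{S}_+^{\rm mon}$ is the set of real-valued $\omega\in\mathcal{S}$ with $\omega(x)>0$ for all $x\in\mathbb{R}$ for which there exists $K>0$ such that $x\,\omega'(x)\le 0$ for all $x\in\mathbb{R}\setminus[-K,K]$. Weighted Sobolev space: for $1<q<\infty$, $\alpha\in\mathbb{N}$, $W^{\alpha,q}_\rho(\mathbb{R})$ is the space of functions $f:\mathbb{R}\to\mathbb{C}$ with weak derivatives $f^{(\tau)}$, $\tau=0,\dots,\alpha$, and $\|f\|_{W^{\alpha,q}_\rho(\mathbb{R})}=\big(\sum_{\tau=0}^\alpha\int_{\mathbb{R}}|f^{(\tau)}(x)|^q\rho(x)\,dx\big)^{1/q}<\infty$. The continuous representative of $f$ is always used. Möbius transformation: fix $c>0$ (constants may depend on $c$) and let $\phi:(0,2\pi)\to\mathbb{R}$,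 $\phi(\theta)=-c\cot(\theta/2)$, so $\phi'(\theta)=\frac{c}{2\sin^2(\theta/2)}$. $I_\rho(f)=\int_{\mathbb{R}}f(x)\rho(x)\,dx$. Randomized Möbius-transformed trapezoidal rule: let $M$ be uniformly distributed on the integers $\{\lfloor n/2\rfloor,\dots,n\}$ and let $\delta$ be uniformly distributed on $[0,1]$, with $M$ and $\delta$ independent. For continuous $f:\mathbb{R}\to\mathbb{C}$, $$A^{M,\delta}_{n,\mathrm{RMT}}(f)=\frac{2\pi}{M}\sum_{j=0}^{M-1}f(\phi(\theta_j))\,\rho(\phi(\theta_j))\,\phi'(\theta_j),\qquad\theta_j=\frac{2\pi(j+\delta)}{M},$$ with a summand understood as $0$ if $\theta_j\in\{0,2\pi\}$ (a probability-zero event). Worst-case root-mean-squared error: for a randomized algorithm $A=(A^\omega)_{\omega\in\Omega}$ on a probability space $(\Omega,\Sigma,\mu)$, $$e^{\mathrm{rmse}}\big(A,W^{\alpha,2}_\rho(\mathbb{R})\big)=\sup_{0\ne f\in W^{\alpha,2}_\rho(\mathbb{R})}\frac{\big(\int_\Omega|I_\rho(f)-A^\omega(f)|^2\,d\mu(\omega)\big)^{1/2}}{\|f\|_{W^{\alpha,2}_\rho(\mathbb{R})}};$$ here $\omega=(M,\delta)$. *)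

(* Defs.v *)
From HB Require Import structures.
From mathcomp Require Export all_boot all_order all_algebra.
From mathcomp Require Export complex.
From mathcomp Require Export all_classical all_reals all_analysis.
Export Order.TTheory GRing.Theory Num.Theory.
Export numFieldNormedType.Exports.

Set Implicit Arguments.
Unset Strict Implicit.
Unset Printing Implicit Defensive.

Local Open Scope classical_set_scope.
Local Open Scope ring_scope.
Local Open Scope complex_scope.

Section weights.
Context {R : realType}.
Implicit Types w : R -> R.

Definition smooth w := forall (n : nat) (x : R), derivable (derive1n n w) x 1.

(* Real-valued elements of the Schwartz space. *)
Definition schwartz w :=
  smooth w /\
  forall a b : nat, has_ubound (range (fun x => `|x ^+ a * derive1n b w x|)).

Definition schwartz_mon_pos w :=
  [/\ schwartz w, (forall x, 0 < w x) &
      exists2 K : R, 0 < K & forall x, x \notin `[- K, K] -> x * derive1 w x <= 0].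

End weights.

Section complex_functions.
Context {R : realType}.
Implicit Types f g : R -> R[i].

(* Topology, measurability and integration of R[i]-valued functions are taken
   componentwise. *)
Definition Ccontinuous f :=
  continuous (fun x => complex.Re (f x)) /\ continuous (fun x => complex.Im (f x)).

Definition Clocally_integrable f :=
  locally_integrable [set: R] (fun x => complex.Re (f x)) /\
  locally_integrable [set: R] (fun x => complex.Im (f x)).

Definition Cintegral f : R[i] :=
  (\int[lebesgue_measure]_x complex.Re (f x)) +i*
  (\int[lebesgue_measure]_x complex.Im (f x)).

(* Real-valued test functions suffice for complex-valued f, by linearity. *)
Definition test_function (psi : R -> R) :=
  smooth psi /\ compact (closure [set x | psi x != 0]).

Definition is_weak_derivative (tau : nat) f g :=
  Clocally_integrable g /\
  forall psi : R -> R, test_function psi ->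
    Cintegral (fun x => f x * (derive1n tau psi x)%:C) =
    (-1) ^+ tau * Cintegral (fun x => g x * (psi x)%:C).

(* Weak derivatives are unique up to null sets, so the norm below does not
   depend on which one is picked. *)
Definition weak_derivative (tau : nat) f : R -> R[i] :=
  if tau == 0%N then f
  else xget (fun=> 0) [set g | is_weak_derivative tau f g].

End complex_functions.

Section sobolev.
Context {R : realType}.
Implicit Types (rho : R -> R) (alpha : nat) (q : R) (f : R -> R[i]).

Definition sobolev_norm rho alpha q f : \bar R :=
  ((\sum_(tau < alpha.+1)
      (\int[lebesgue_measure]_x
        (ComplexField.Normc.normc (weak_derivative tau f x) `^ q * rho x)%:E))%E
    `^ q^-1)%E.

(* Equivalence classes are represented by their continuous representatives,
   hence by genuine functions. *)
Definition sobolev rho alpha q : set (R -> R[i]) :=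
  [set f | [/\ Ccontinuous f,
      (forall tau, (tau <= alpha)%N -> exists g, is_weak_derivative tau f g) &
      (sobolev_norm rho alpha q f < +oo)%E]].

Definition weighted_integral rho f : R[i] := Cintegral (fun x => f x * (rho x)%:C).

Definition rmse d (Omega : measurableType d) (P : probability Omega R)
    rho alpha (A : Omega -> (R -> R[i]) -> R[i]) : \bar R :=
  ereal_sup [set r | exists f,
    [/\ sobolev rho alpha 2 f, f <> (fun=> 0) &
      r = ((\int[P]_w
              (ComplexField.Normc.normc
                 (weighted_integral rho f - A w f) ^+ 2)%:E) `^ 2^-1
           / sobolev_norm rho alpha 2 f)%E]].

End sobolev.

Section moebius_trapezoidal.
Context {R : realType}.
Implicit Types (c theta : R) (rho : R -> R).

Definition cot theta : R := cos theta / sin theta.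

Definition moebius c theta : R := - c * cot (theta / 2).

Definition trapezoidal_node (m : nat) (delta : R) (j : nat) : R :=
  2 * pi * (j%:R + delta) / m%:R.

Definition moebius_trapezoidal c rho (m : nat) (delta : R) (f : R -> R[i]) : R[i] :=
  (2 * pi / m%:R)%:C *
  \sum_(j < m)
    let theta := trapezoidal_node m delta j in
    if (theta == 0) || (theta == 2 * pi) then 0
    else f (moebius c theta) *
         (rho (moebius c theta) * derive1 (moebius c) theta)%:C.

End moebius_trapezoidal.

Section randomness.
Context {R : realType} d (Omega : measurableType d) (P : probability Omega R).

Definition independent_RV d1 d2 (T1 : measurableType d1) (T2 : measurableType d2)
    (X : {RV P >-> T1}) (Y : {RV P >-> T2}) :=
  forall A B, measurable A -> measurable B ->
    P (X @^-1` A `&` Y @^-1` B) = (P (X @^-1` A) * P (Y @^-1` B))%E.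

Definition uniform_on_range (a b : nat) (M : {RV P >-> nat}) :=
  forall m : nat,
    P (M @^-1` [set m]) =
    (if (a <= m <= b)%N then (b - a).+1%:R^-1 else 0)%:E.

Definition uniform01 (delta : {RV P >-> R}) :=
  forall B, measurable B ->
    distribution P delta B = uniform_prob (@ltr01 R) B.

End randomness.

(* Main.v *)
Require Import Defs.
From mathcomp Require Import ring lra measurable_realfun.

(** Why the rate holds.

    The Moebius map carries the circle (0, 2 pi) to the line; its inverse is
    the angle [phase c], whose derivative is [density c].  With g := f rho, the
    rule is the equispaced trapezoidal rule, shifted by 2 pi delta / m, for the
    transplanted integrand (g o phi) phi'.  Writing A_k, B_k for the integrals
    over the line of g cos (k phase) and g sin (k phase), the error of the rule
    with m nodes is, by aliasing, the series
        2 sum_(l >= 1) (A_(lm) cos (2 pi l delta) + B_(lm) sin (2 pi l delta))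
    ([trapezoidal_error_series]).  Its mean square over delta is
    2 sum_l (A_(lm)^2 + B_(lm)^2).

    The coefficients obey sum_k k^(2 alpha) (A_k^2 + B_k^2) <= D |f|^2, where |f|
    is the weighted Sobolev norm ([coefficient_decay]).  For a fixed m all of
    this energy may sit at the multiples of m; averaging over the at least n/2
    values of M gains an additional factor 1/n.  Indeed for each
    fixed l the products lm are distinct, and
    (lm)^(-2 alpha) <= l^(-2) (n/3)^(-2 alpha), hence the sum over m and l of the
    aliased energies is O(n^(-2 alpha)) |f|^2 ([aliased_energy_le]), the mean
    square error is O(n^(-2 alpha - 1)) |f|^2 ([mean_square_bound]), and a square
    root gives the claim.

    Decay of the coefficients.  Multiplying A_k by k and integrating by parts
    on the line replaces g by the derivative of g / density, up to exchanging
    cosine and sine.  Doing so alpha times produces a sum of products u_t g_t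
    of the weak derivatives of f with smooth functions g_t built from rho.
    Bessel's inequality then requires g_t^2 / density <= C rho.  Here the
    monotonicity of the tails of rho is decisive: on the half-line [x, oo) the
    weight is at most rho(x), so the Landau-Kolmogorov inequality bounds the
    square of a derivative of rho at x by rho(x) times the supremum of a higher
    derivative, which decays faster than any power ([tail_weight_bound]).

    Pointwise convergence.  The error series needs the Fourier series of the
    transplanted integrand to converge at each node ([fourier_inversion]).  All
    integrals stay on the line: Bessel's inequality is an equality for the
    indicators of the rays ]-oo, y], because sum_k (1 - cos k t) / k^2 equals
    pi t / 2 - t^2 / 4; hence the primitive of g is the limit of its integrated
    Fourier series, and since sum_k k^2 (A_k^2 + B_k^2) is finite this limit can
    be differentiated term by term.

    Probability.  The squared error is a limit of measurable functions of
    (M, delta) almost surely, and Fatou's lemma transfers the bound on the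
    partial sums of the error series ([expectation_bound]). *)

Set Implicit Arguments.
Unset Strict Implicit.
Unset Printing Implicit Defensive.

Local Open Scope classical_set_scope.
Local Open Scope ring_scope.

(** * Derivation rules for pointwise expressions *)

Section derivation_rules.
Context {R : realType}.
Implicit Types (f g : R -> R) (x a b : R).

(** The rules are stated for pointwise expressions rather than for sums and
    products of functions, so that the derivative of a concrete formula is
    assembled by application. *)
Lemma is_derive_add f g x a b : is_derive x 1 f a -> is_derive x 1 g b ->
  is_derive x 1 (fun y => f y + g y) (a + b).
Proof. exact: is_deriveD. Qed.

Lemma is_derive_mul f g x a b : is_derive x 1 f a -> is_derive x 1 g b ->
  is_derive x 1 (fun y => f y * g y) (f x * b + g x * a).
Proof. exact: is_deriveM. Qed.

Lemma is_derive_const (k x : R) : is_derive x 1 (fun _ : R => k) 0.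
Proof. exact: is_derive_cst. Qed.

Lemma is_derive_idr x : is_derive x 1 (fun y : R => y) 1.
Proof. exact: is_derive_id. Qed.

Lemma is_derive_scale k f x a : is_derive x 1 f a -> is_derive x 1 (fun y => k * f y) (k * a).
Proof.
by move=> H; have := is_derive_mul (is_derive_const k x) H; rewrite mulr0 addr0.
Qed.

Lemma is_derive_neg f x a : is_derive x 1 f a -> is_derive x 1 (fun y => - f y) (- a).
Proof. exact: is_deriveN. Qed.

Lemma is_derive_sub f g x a b : is_derive x 1 f a -> is_derive x 1 g b ->
  is_derive x 1 (fun y => f y - g y) (a - b).
Proof. exact: is_deriveB. Qed.

Lemma is_derive_compr f g x a b : is_derive (g x) 1 f a -> is_derive x 1 g b ->
  is_derive x 1 (fun y => f (g y)) (a * b).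
Proof. exact: is_derive1_comp. Qed.

Lemma is_derive_invr f x a : f x != 0 -> is_derive x 1 f a ->
  is_derive x 1 (fun y => (f y)^-1) (- (f x) ^- 2 * a).
Proof.
move=> fx0 H.
by have := @is_deriveV R f x a (1:R) fx0 H.
Qed.

Lemma is_derive_sumr (N : nat) (F : nat -> R -> R) (dF : nat -> R) x :
  (forall i, is_derive x 1 (F i) (dF i)) ->
  is_derive x 1 (fun y => \sum_(i < N) F i y) (\sum_(i < N) dF i).
Proof.
move=> H; elim: N => [|N IH].
  rewrite big_ord0 (_ : (fun y => _) = fun=> 0); first exact: is_derive_const.
  by apply/funext => y; rewrite big_ord0.
rewrite big_ord_recr /= (_ : (fun y => _) = fun y => \sum_(i < N) F i y + F N y).
  exact: is_derive_add.
by apply/funext => y; rewrite big_ord_recr.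
Qed.

Lemma is_derive_affine a b x : is_derive x 1 (fun y => a * y + b) a.
Proof.
by have := is_derive_add (is_derive_scale a (is_derive_idr x)) (is_derive_const b x); rewrite mulr1 addr0.
Qed.

Lemma is_derive_derivable f x a : is_derive x 1 f a -> derivable f x 1.
Proof. by case. Qed.

Lemma is_derive_continuous f x a : is_derive x 1 f a -> {for x, continuous f}.
Proof. by case=> H _; exact/differentiable_continuous/derivable1_diffP. Qed.

Lemma is_derive_derive1 f x a : is_derive x 1 f a -> derive1 f x = a.
Proof. by move=> H; rewrite derive1E; apply/derive_val. Qed.

Lemma derivable_is_derive f x : derivable f x 1 -> is_derive x 1 f (derive1 f x).
Proof. by rewrite derive1E => /derivableP. Qed.

End derivation_rules.

(** * Smooth functions *)

Section smooth_functions.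
Context {R : realType}.
Implicit Types (f g : R -> R) (n : nat).

(** Smoothness refers to the iterated derivatives of the function itself; this
    form, which recurses through [derive1 f], is the one that can be proved for
    sums and products by induction on the order. *)
Fixpoint ndiff n f : Prop :=
  (forall x : R, derivable f x 1) /\
  (if n is m.+1 then ndiff m (derive1 f) else True).

Lemma smoothP f : smooth f <-> forall n, ndiff n f.
Proof.
split=> [sf n|nf n x].
  elim: n f sf => [|n IH] f sf /=; split=> //; try exact: (sf 0%N).
  by apply: IH => m x; have := sf m.+1 x; rewrite derive1Sn.
elim: n f nf => [|n IH] f nf; first by have [] := nf 0%N.
by rewrite derive1Sn; apply: IH => m; have [] := nf m.+1.
Qed.

Lemma ndiffW n f : ndiff n.+1 f -> ndiff n f.
Proof.
elim: n f => [|n IH] f [df nf]; first by split.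
by split=> //; apply: IH.
Qed.

Lemma smooth_derivable f : smooth f -> forall x : R, derivable f x 1.
Proof. by move=> sf x; exact: (sf 0%N x). Qed.

Lemma smooth_is_derive f : smooth f -> forall x : R, is_derive x 1 f (derive1 f x).
Proof.
by move=> sf x; exact/derivable_is_derive/smooth_derivable.
Qed.

Lemma smooth_continuous f : smooth f -> continuous f.
Proof.
by move=> sf x; apply/differentiable_continuous/derivable1_diffP/smooth_derivable.
Qed.

Lemma smooth_derive1 f : smooth f -> smooth (derive1 f).
Proof. by move=> sf n x; rewrite -derive1Sn; exact: sf. Qed.

Lemma smooth_derive1n n f : smooth f -> smooth (derive1n n f).
Proof.
by move=> sf; elim: n => [//|n IH]; rewrite derive1nS; exact: smooth_derive1.
Qed.

Lemma derive1_is_derive f df :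
  (forall x : R, is_derive x 1 f (df x)) -> derive1 f = df.
Proof. by move=> H; apply/funext => x; exact: is_derive_derive1. Qed.

Lemma ndiff_ext n f df : (forall x : R, is_derive x 1 f (df x)) ->
  ndiff n df -> ndiff n.+1 f.
Proof.
move=> H nd; split=> [x|]; first exact: is_derive_derivable (H x).
by rewrite (derive1_is_derive H).
Qed.

Lemma ndiffD n f g : ndiff n f -> ndiff n g -> ndiff n (fun x => f x + g x).
Proof.
elim: n f g => [|n IH] f g [df nf] [dg ng].
  by split=> [x|//]; exact: is_derive_derivable (is_derive_add (derivable_is_derive (df x)) (derivable_is_derive (dg x))).
apply: (@ndiff_ext _ _ (fun x => derive1 f x + derive1 g x)); last exact: IH.
by move=> x; exact: (is_derive_add (derivable_is_derive (df x)) (derivable_is_derive (dg x))).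
Qed.

(** Leibniz: the derivative of a product is a sum of two products of functions
    that are one order less differentiable. *)
Lemma ndiffM n f g : ndiff n f -> ndiff n g -> ndiff n (fun x => f x * g x).
Proof.
elim: n f g => [|n IH] f g nf ng.
  have [df _] := nf; have [dg _] := ng; split=> [x|//].
  exact: is_derive_derivable (is_derive_mul (derivable_is_derive (df x)) (derivable_is_derive (dg x))).
have [df nf'] := nf; have [dg ng'] := ng.
apply: (@ndiff_ext _ _ (fun x => f x * derive1 g x + g x * derive1 f x)).
  by move=> x; exact: (is_derive_mul (derivable_is_derive (df x)) (derivable_is_derive (dg x))).
by apply: ndiffD; apply: IH => //; exact: ndiffW.
Qed.

Lemma ndiff_cst n (c : R) : ndiff n (fun=> c).
Proof.
elim: n c => [|n IH] c; first by split=> [x|//]; exact: is_derive_derivable (is_derive_const c x).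
by apply: (@ndiff_ext _ _ (fun=> 0)).
Qed.

Lemma ndiff_id n : ndiff n (fun x => x).
Proof.
case: n => [|n]; first by split=> [x|//]; exact: is_derive_derivable (is_derive_idr x).
by apply: (@ndiff_ext _ _ (fun=> 1)); exact: ndiff_cst.
Qed.

Lemma ndiff_affine n f (a b : R) : ndiff n f -> ndiff n (fun x => f (a * x + b)).
Proof.
have H f' (df : forall x : R, derivable f' x 1) (x : R) :
    is_derive x 1 (fun y => f' (a * y + b)) (derive1 f' (a * x + b) * a).
  exact: (is_derive_compr (derivable_is_derive (df _)) (is_derive_affine a b x)).
elim: n f => [|n IH] f nf.
  by have [df _] := nf; split=> [x|//]; exact: is_derive_derivable (H _ df x).
have [df nf'] := nf; apply: ndiff_ext (H _ df) _.
by apply: ndiffM; [exact: IH|exact: ndiff_cst].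
Qed.

Lemma smoothD f g : smooth f -> smooth g -> smooth (fun x => f x + g x).
Proof. by move=> /smoothP sf /smoothP sg; apply/smoothP => n; exact: ndiffD. Qed.

Lemma smoothM f g : smooth f -> smooth g -> smooth (fun x => f x * g x).
Proof. by move=> /smoothP sf /smoothP sg; apply/smoothP => n; exact: ndiffM. Qed.

Lemma smooth_cst (c : R) : smooth (fun=> c).
Proof. by apply/smoothP => n; exact: ndiff_cst. Qed.

Lemma smooth_id : smooth (fun x : R => x).
Proof. by apply/smoothP => n; exact: ndiff_id. Qed.

Lemma smooth_affine f (a b : R) : smooth f -> smooth (fun x => f (a * x + b)).
Proof. by move=> /smoothP sf; apply/smoothP => n; exact: ndiff_affine. Qed.

Lemma derive1_mul f g : smooth f -> smooth g ->
  derive1 (fun x => f x * g x) = (fun x => f x * derive1 g x + g x * derive1 f x).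
Proof.
move=> sf sg; apply: derive1_is_derive => x.
exact: (is_derive_mul (smooth_is_derive sf x) (smooth_is_derive sg x)).
Qed.

End smooth_functions.

(** * Smooth cutoffs with compact support *)

Section bump_function.
Context {R : realType}.

Lemma is_derive_of_remainder (f : R -> R) (x d : R) :
  (forall e, 0 < e -> exists2 r, 0 < r &
     forall h, `|h| < r -> `|f (x + h) - f x - d * h| <= e * `|h|) ->
  is_derive x 1 f d.
Proof.
move=> H.
have cv : h^-1 *: ((f \o shift x) h%:A - f x) @[h --> 0^'] --> d.
  apply/cvgrPdist_le => e e0; have [r r0 Hr] := H e e0.
  near=> h.
  have h0 : h != 0 by near: h; exact: nbhs_dnbhs_neq.
  have hr : `|h| < r by near: h; exact: dnbhs0_lt.
  have := Hr h hr.
  rewrite /= [_%:A]mulr1 (addrC h) => Hh.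
  have -> : d - h^-1 *: (f (x + h) - f x) = - (h^-1 * (f (x + h) - f x - d * h)).
    by rewrite /GRing.scale /=; field.
  by rewrite normrN normrM normfV mulrC ler_pdivrMr ?normr_gt0.
split; first by apply/cvg_ex; exists d.
by rewrite /derive; apply/cvg_lim.
Unshelve. all: by end_near. Qed.

(** The class of functions p(1/x) exp(-1/x) extended by 0 to the left; it is
    closed under derivation, which makes the smoothness of exp(-1/x) a single
    induction. *)
Definition flat (p : {poly R}) (x : R) : R :=
  if 0 < x then p.[x^-1] * expR (- x^-1) else 0.

Lemma poly_growth (p : {poly R}) :
  exists2 C : R, 0 <= C & forall y, 1 <= y -> `|p.[y]| <= C * y ^+ size p.
Proof.
exists (\sum_(i < size p) `|p`_i|); first exact: sumr_ge0.
move=> y y1; rewrite horner_coef mulr_suml.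
apply: (le_trans (ler_norm_sum _ _ _)); apply: ler_sum => i _.
rewrite normrM normrX (ger0_norm (le_trans ler01 y1)).
by rewrite ler_wpM2l// ler_weXn2l// ltnW.
Qed.

(** At 0 both the value and the derivative vanish because exp(-y) y^k is bounded
    by a factorial for y >= 1. *)
Lemma flat_quadratic (p : {poly R}) :
  exists2 C : R, 0 <= C & forall h, `|h| <= 1 -> `|flat p h| <= C * h ^+ 2.
Proof.
have [C C0 HC] := poly_growth p.
(* Two powers more than the degree of p bounds: these become the factor h^2. *)
set n := (size p).+2.
exists (C * n`!%:R); first by rewrite mulr_ge0.
move=> h h1; rewrite /flat; case: ifPn => [h0|_]; last first.
  by rewrite normr0; apply: mulr_ge0; [exact: mulr_ge0|exact: sqr_ge0].
rewrite ger0_norm ?(ltW h0)// in h1.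
set y := h^-1; have y1 : 1 <= y by rewrite invf_ge1.
have y0 : 0 < y by rewrite invr_gt0.
have E := expR_ge1Dxn (size p).+1 (ltW y0).
have f0 : 0 < n`!%:R :> R by rewrite ltr0n fact_gt0.
have {}E : y ^+ n * expR (- y) <= n`!%:R.
  rewrite expRN ler_pdivrMr ?expR_gt0// mulrC -ler_pdivrMr//.
  by apply: le_trans E; rewrite lerDr.
have -> : h = y^-1 by rewrite invrK.
rewrite normrM (ger0_norm (expR_ge0 _)) exprVn ler_pdivlMr ?exprn_gt0//.
apply: (@le_trans _ _ (C * y ^+ size p * expR (- y) * y ^+ 2)).
  by rewrite ler_wpM2r ?ler_wpM2r ?expR_ge0 ?HC// exprn_ge0 ?ltW.
have -> : C * y ^+ size p * expR (- y) * y ^+ 2 = C * (y ^+ n * expR (- y)).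
  by rewrite /n !exprS; ring.
exact: ler_wpM2l.
Qed.

(** Differentiating p(1/x) exp(-1/x) gives the polynomial y^2 (p(y) - p'(y)) at
    y = 1/x; at the origin the quadratic bound forces the derivative to vanish. *)
Lemma is_derive_flat (p : {poly R}) (x : R) :
  is_derive x 1 (flat p) (flat ('X^2 * (p - p^`())) x).
Proof.
have [x0|x0|->] := ltgtP x 0.
- have -> : flat ('X^2 * (p - p^`())) x = 0 by rewrite /flat ltNge ltW.
  apply: (@near_eq_is_derive _ _ _ (fun=> 0)).
  near=> y; rewrite /flat ltNge ltW//.
  by near: y; exact: lt_nbhsl.
- rewrite {2}/flat x0.
  apply: (@near_eq_is_derive _ _ _ (fun y : R => p.[y^-1] * expR (- y^-1))).
    near=> y; rewrite /flat (_ : 0 < y)//.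
    by near: y; exact: lt_nbhsr.
  have iV : is_derive x 1 (fun y : R => y^-1) (- x ^- 2 * 1).
    by apply: (@is_derive_invr _ (fun y => y)); exact: lt0r_neq0.
  have iP : is_derive x 1 (fun y : R => p.[y^-1]) (p^`().[x^-1] * (- x ^- 2 * 1)).
    exact: (is_derive_compr (is_derive_poly p x^-1) iV).
  have iE := @is_derive_compr _ expR (fun y => - y^-1) _ _ _ (is_derive_expR _) (is_derive_neg iV).
  apply: is_derive_eq (is_derive_mul iP iE) _.
  by rewrite hornerM hornerXn hornerD hornerN exprVn; ring.
- have -> : flat ('X^2 * (p - p^`())) 0 = 0 by rewrite /flat ltxx.
  have [C C0 HC] := flat_quadratic p.
  apply: is_derive_of_remainder => e e0; exists (Num.min 1 (e / (C + 1))).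
    by rewrite lt_min ltr01 divr_gt0// ltr_wpDl.
  move=> h; rewrite lt_min => /andP[h1 h2].
  rewrite add0r {2}/flat ltxx mul0r !subr0.
  apply: le_trans (HC h (ltW h1)) _.
  rewrite -real_normK ?num_real// expr2 mulrA.
  apply: ler_wpM2r => //.
  move: h2; rewrite ltr_pdivlMr ?ltr_wpDl// => /ltW; apply: le_trans.
  by rewrite mulrC ler_wpM2l// lerDl.
Unshelve. all: by end_near. Qed.

Lemma smooth_flat (p : {poly R}) : smooth (flat p).
Proof.
apply/smoothP => n; elim: n p => [|n IH] p.
  by split=> [x|//]; exact: is_derive_derivable (is_derive_flat p x).
exact: ndiff_ext (is_derive_flat p) (IH _).
Qed.

Definition mollifier (x : R) : R := flat 1 (1 * x + 1) * flat 1 (-1 * x + 1).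

Lemma smooth_mollifier : smooth mollifier.
Proof. by apply: smoothM; apply: smooth_affine; exact: smooth_flat. Qed.

Lemma mollifier0_gt0 : 0 < mollifier 0.
Proof.
rewrite /mollifier !mulr0 !add0r /flat ltr01 !hornerE.
by rewrite /= mulr1 mulr_gt0// expR_gt0.
Qed.

Lemma mollifier_support x : 1 <= `|x| -> mollifier x = 0.
Proof.
rewrite ler_normr /mollifier /flat => /orP[x1|x1].
  by rewrite [X in _ * X]ifF ?mulr0//; apply/negbTE; rewrite -leNgt; lra.
by rewrite [X in X * _]ifF ?mul0r//; apply/negbTE; rewrite -leNgt; lra.
Qed.

Definition cutoff (n : nat) (x : R) : R := mollifier (n.+1%:R^-1 * x + 0) / mollifier 0.

Lemma smooth_cutoff n : smooth (cutoff n).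
Proof. by apply: smoothM; [exact/smooth_affine/smooth_mollifier|exact: smooth_cst]. Qed.

Lemma cutoff_support n x : n.+1%:R <= `|x| -> cutoff n x = 0.
Proof.
move=> nx; rewrite /cutoff mollifier_support ?mul0r// addr0 normrM.
by rewrite ger0_norm ?invr_ge0// mulrC ler_pdivlMr// mul1r.
Qed.

Lemma derive1_cutoff n x :
  derive1 (cutoff n) x = derive1 mollifier (n.+1%:R^-1 * x + 0) / n.+1%:R / mollifier 0.
Proof.
have H := @is_derive_compr _ mollifier (fun x => n.+1%:R^-1 * x + 0) _ _ _
  (smooth_is_derive smooth_mollifier _) (is_derive_affine n.+1%:R^-1 0 x).
rewrite (is_derive_derive1 (is_derive_mul H (is_derive_const (mollifier 0)^-1 x))) mulr0 add0r.
by rewrite [LHS]mulrC.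
Qed.

Lemma continuous_compact_support_bounded (f : R -> R) : continuous f ->
  (forall x, 1 < `|x| -> f x = 0) -> exists2 C, 0 <= C & forall x, `|f x| <= C.
Proof.
move=> cf f0.
have /compact_bounded [M [_ HM]] : compact (f @` `[-1, 1]).
  apply: continuous_compact; last exact: segment_compact.
  exact: continuous_subspaceT.
exists (`|M| + 1); first by rewrite addr_ge0.
move=> x; have [x1|x1] := ltP 1 `|x|; first by rewrite f0// normr0 addr_ge0.
apply: (HM (`|M| + 1)); first by rewrite (le_lt_trans (ler_norm _))// ltrDl.
by exists x => //=; rewrite in_itv/= -ler_norml.
Qed.

Lemma cutoff_bounded : exists2 C, 0 <= C & forall n x, `|cutoff n x| <= C.
Proof.
have [C C0 HC] := continuous_compact_support_bounded
  (smooth_continuous smooth_mollifier) (fun x x1 => mollifier_support (ltW x1)).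
exists (C / mollifier 0); first by rewrite divr_ge0// ltW// mollifier0_gt0.
move=> n x; rewrite normrM (@ger0_norm _ (mollifier 0)^-1) ?invr_ge0 ?(ltW mollifier0_gt0)//.
by rewrite ler_wpM2r// invr_ge0 ltW// mollifier0_gt0.
Qed.

(** Rescaling by n + 1 makes the derivatives of the cutoffs tend to zero
    uniformly, which is what removes the cutoff in the integration by parts. *)
Lemma derive1_cutoff_bounded :
  exists2 C, 0 <= C & forall n x, `|derive1 (cutoff n) x| <= C / n.+1%:R.
Proof.
have b0 : 0 <= (mollifier 0)^-1 by rewrite invr_ge0 ltW// mollifier0_gt0.
have [C C0 HC] : exists2 C, 0 <= C & forall x, `|derive1 mollifier x| <= C.
  apply: continuous_compact_support_bounded.
    exact/smooth_continuous/smooth_derive1/smooth_mollifier.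
  move=> x x1; apply: is_derive_derive1; apply: (@near_eq_is_derive _ _ _ (fun=> 0)).
  near=> y; apply/esym/mollifier_support/ltW.
  by near: y; exact: (cvgr_gt _ (@norm_continuous _ _ x) _ x1).
exists (C / mollifier 0); first by rewrite mulr_ge0.
move=> n x; rewrite derive1_cutoff 2!normrM (ger0_norm b0).
rewrite (@ger0_norm _ n.+1%:R^-1) ?invr_ge0// [X in _ <= X]mulrAC.
by apply: ler_wpM2r => //; apply: ler_wpM2r => //; rewrite invr_ge0.
Unshelve. all: by end_near. Qed.

Lemma cutoff_cvg x : cutoff n x @[n --> \oo] --> (1 : R).
Proof.
have -> : 1 = mollifier 0 / mollifier 0 by rewrite divff// lt0r_neq0// mollifier0_gt0.
apply: cvgMl.
have H : n.+1%:R^-1 * x + 0 @[n --> \oo] --> (0 : R).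
  rewrite -[X in _ --> X](_ : 0 * x + 0 = 0); last by rewrite mul0r addr0.
  by apply: cvgD; [apply: cvgMl; exact: cvg_harmonic|exact: cvg_cst].
have cb : mollifier y @[y --> (0 : R)] --> mollifier 0 := @smooth_continuous R mollifier smooth_mollifier 0.
exact: (cvg_comp (fun n : nat => n.+1%:R^-1 * x + 0) mollifier H cb).
Qed.

Lemma test_function_cutoff n (f : R -> R) : smooth f ->
  test_function (fun x => cutoff n x * f x).
Proof.
move=> sf; split; first by apply: smoothM => //; exact: smooth_cutoff.
apply: (@subclosed_compact _ _ `[- n.+1%:R, (n.+1%:R:R)]).
- exact: closed_closure.
- exact: segment_compact.
- have /closure_id -> := @interval_closed R (BLeft (- n.+1%:R)) (BRight n.+1%:R) isT isT.
  apply: closure_subset => x /=; apply: contraNP.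
  rewrite in_itv/= => /negP; rewrite -ler_norml -ltNge => /ltW nx.
  by rewrite cutoff_support// mul0r eqxx.
Qed.

End bump_function.

(** * Integrals over the line *)

Section integrals_over_the_line.
Context {R : realType}.
Local Notation mu := (@lebesgue_measure R).
Implicit Types f g : R -> R.

(** Restrictions to an interval are expressed by multiplying with its indicator,
    so that all integrals have the whole line as their domain. *)
Definition integrableR f := mu.-integrable [set: R] (EFin \o f).
Definition measurable_real f := measurable_fun [set: R] f.
Definition intR f : R := \int[mu]_x f x.

Lemma integrableR_measurable f : integrableR f -> measurable_real f.
Proof. by move=> /measurable_int/measurable_EFinP. Qed.

Lemma continuous_measurable_real f : continuous f -> measurable_real f.
Proof. exact: continuous_measurable_fun. Qed.

Lemma integrableR_le f g : measurable_real f -> integrableR g -> (forall x, `|f x| <= g x) -> integrableR f.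
Proof.
move=> mf ig fg; apply: (le_integrable measurableT _ _ ig).
  exact/measurable_EFinP.
by move=> x _; rewrite /= lee_fin (le_trans (fg x))// ler_norm.
Qed.

Lemma integrableRD f g : integrableR f -> integrableR g -> integrableR (fun x => f x + g x).
Proof. by move=> /(integrableD measurableT) H /H. Qed.

Lemma integrableRZ k f : integrableR f -> integrableR (fun x => k * f x).
Proof. by move=> /(integrableZl measurableT k). Qed.

Lemma intRD f g : integrableR f -> integrableR g -> intR (fun x => f x + g x) = intR f + intR g.
Proof. exact: RintegralD. Qed.

Lemma intRB f g : integrableR f -> integrableR g -> intR (fun x => f x - g x) = intR f - intR g.
Proof. exact: RintegralB. Qed.

Lemma intRZ k f : integrableR f -> intR (fun x => k * f x) = k * intR f.
Proof. exact: RintegralZl. Qed.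

Lemma integrableR0 : integrableR (fun=> 0).
Proof. exact: integrable0. Qed.

Lemma intR0 : intR (fun=> 0) = 0.
Proof. by rewrite /intR /Rintegral integral0. Qed.

Lemma intR_ge0 f : (forall x, 0 <= f x) -> 0 <= intR f.
Proof. by move=> f0; apply: Rintegral_ge0. Qed.

Lemma intR_le f g : integrableR f -> integrableR g -> (forall x, f x <= g x) -> intR f <= intR g.
Proof. by move=> *; apply: le_Rintegral. Qed.

Lemma intR_normr f : integrableR f -> `|intR f| <= intR (fun x => `|f x|).
Proof. exact: le_normr_Rintegral. Qed.

Lemma integrableR_norm f : integrableR f -> integrableR (fun x => `|f x|).
Proof.
move=> H; apply: (le_integrable measurableT _ _ H).
  apply/measurable_EFinP; apply: measurableT_comp => //; exact: integrableR_measurable.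
by move=> x _; rewrite /= normr_id.
Qed.

Lemma integrableR_sum N (F : nat -> R -> R) : (forall i, integrableR (F i)) ->
  integrableR (fun x => \sum_(i < N) F i x).
Proof.
move=> H; elim: N => [|N IH].
  under eq_fun do rewrite big_ord0. exact: integrableR0.
under eq_fun do rewrite big_ord_recr. exact: integrableRD.
Qed.

Lemma intR_sum N (F : nat -> R -> R) : (forall i, integrableR (F i)) ->
  intR (fun x => \sum_(i < N) F i x) = \sum_(i < N) intR (F i).
Proof.
move=> H; elim: N => [|N IH].
  rewrite big_ord0; under eq_fun do rewrite big_ord0. exact: intR0.
rewrite big_ord_recr -IH; under eq_fun do rewrite big_ord_recr.
by apply: intRD => //; exact: integrableR_sum.
Qed.

Lemma intR_dominated (F : nat -> R -> R) f g :
  (forall n, measurable_real (F n)) -> integrableR g -> (forall n x, `|F n x| <= g x) ->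
  (forall x, F n x @[n --> \oo] --> f x) ->
  integrableR f /\ (intR (F n) @[n --> \oo] --> intR f).
Proof.
move=> mF ig Fg Ff.
have mf : measurable_real f by apply: (measurable_fun_cvg mF) => x _; exact: Ff.
have [||||If _ H] := @dominated_convergence _ _ R mu setT measurableT
  (fun n => EFin \o F n) (EFin \o f) (EFin \o g) _ _ _ ig.
- by move=> n; apply/measurable_EFinP; exact: mF.
- exact/measurable_EFinP.
- by apply: aeW => x _; apply: cvg_EFin; [exact: nearW|exact: Ff].
- by apply: aeW => x n _; rewrite /= lee_fin.
split=> //; apply: fine_cvg; rewrite /intR /Rintegral fineK//.
exact: integrable_fin_num.
Qed.

Definition bounded f := exists C : R, forall x, `|f x| <= C.

Lemma integrableR_bounded f g : measurable_real f -> bounded f -> integrableR g ->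
  integrableR (fun x => f x * g x).
Proof.
move=> mf [C HC] ig.
apply: (@integrableR_le _ (fun x => C * `|g x|)).
- by apply: measurable_funM => //; exact: integrableR_measurable.
- exact/integrableRZ/integrableR_norm.
- by move=> x; rewrite normrM ler_wpM2r.
Qed.

Lemma intR_FTC (f F : R -> R) (a b : R) : a < b -> continuous f ->
  (forall x : R, is_derive x 1 F (f x)) ->
  intR (fun x => \1_`[a, b] x * f x) = F b - F a.
Proof.
move=> ab cf dF.
have cF : continuous F by move=> x; exact: is_derive_continuous (dF x).
rewrite /intR (_ : (fun x => _) = f \_ `[a, b]).
  rewrite -Rintegral_mkcond /Rintegral (@continuous_FTC2 _ f F)//.
  - exact: continuous_subspaceT.
  - split.
    + by move=> x _; exact: is_derive_derivable (dF x).
    + exact: (cvg_at_right_filter (cF a)).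
    + exact: (cvg_at_left_filter (cF b)).
  - by move=> x _; exact: is_derive_derive1.
by apply/funext => x; rewrite patchE indicE; case: ifP; rewrite ?mul1r ?mul0r.
Qed.

Lemma measurable_real_indic (A : set R) : measurable A -> measurable_real \1_A.
Proof. by move=> mA; exact: measurable_indic. Qed.

Lemma indic_le1 (A : set R) x : `|\1_A x : R| <= 1.
Proof. by rewrite indicE; case: (_ \in _); rewrite ?normr1 ?normr0. Qed.

Lemma cvg_near_eq (u v : nat -> R) (l : R) : (\forall n \near \oo, u n = v n) ->
  v n @[n --> \oo] --> l -> u n @[n --> \oo] --> l.
Proof. by move=> H; apply: cvg_trans; apply: near_eq_cvg; near=> n; apply/esym; near: n. Unshelve. all: by end_near. Qed.

(** The primitive is only evaluated along the integers, which suffices once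
    integrability is known. *)
Lemma intR_FTC_ray (f F : R -> R) (y l : R) : continuous f -> integrableR f ->
  (forall x : R, is_derive x 1 F (f x)) ->
  F (- n%:R) @[n --> \oo] --> l ->
  intR (fun x => \1_`]-oo, y] x * f x) = F y - l.
Proof.
move=> cf If dF Fl.
have H : intR (fun x => \1_`[- n%:R, y] x * f x) @[n --> \oo] --> F y - l.
  apply: (@cvg_near_eq _ (fun n => F y - F (- n%:R))); last first.
    by apply: cvgB => //; exact: cvg_cst.
  near=> n; apply: intR_FTC => //; rewrite ltrNl.
  by near: n; exact: nbhs_infty_gtr.
apply: cvg_unique H; first exact: norm_hausdorff.
apply: (intR_dominated _ (integrableR_norm If) _ _).2.
- move=> n; apply: measurable_funM; last exact: continuous_measurable_real.
  exact: measurable_real_indic.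
- by move=> n x; rewrite normrM ler_piMl// indic_le1.
- move=> x; apply: cvgM; last exact: cvg_cst.
  apply: (@cvg_near_eq _ (fun=> \1_`]-oo, y] x)); last exact: cvg_cst.
  near=> n; rewrite !indicE !mem_setE /= !in_itv/= (_ : - n%:R <= x)//.
  by rewrite lerNl; near: n; exact: nbhs_infty_ger.
Unshelve. all: by end_near. Qed.

Lemma intR_FTC_line (f F : R -> R) (l l' : R) : continuous f -> integrableR f ->
  (forall x : R, is_derive x 1 F (f x)) ->
  F (- n%:R) @[n --> \oo] --> l -> F n%:R @[n --> \oo] --> l' ->
  intR f = l' - l.
Proof.
move=> cf If dF Fl Fl'.
have H : intR (fun x => \1_`]-oo, n%:R] x * f x) @[n --> \oo] --> l' - l.
  apply: (@cvg_near_eq _ (fun n => F n%:R - l)); last first.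
    by apply: cvgB => //; exact: cvg_cst.
  by near=> n; exact: intR_FTC_ray.
apply: cvg_unique H; first exact: norm_hausdorff.
apply: (intR_dominated _ (integrableR_norm If) _ _).2.
- move=> n; apply: measurable_funM; last exact: continuous_measurable_real.
  exact: measurable_real_indic.
- by move=> n x; rewrite normrM ler_piMl// indic_le1.
- move=> x; apply: (@cvg_near_eq _ (fun=> f x)); last exact: cvg_cst.
  near=> n; rewrite indicE mem_setE /= in_itv/= (_ : x <= n%:R) ?mul1r//.
  by near: n; exact: nbhs_infty_ger.
Unshelve. all: by end_near. Qed.

End integrals_over_the_line.

(** * Trigonometric polynomials and orthogonality *)

Section trigonometric_polynomials.
Context {R : realType}.
Implicit Types (a b : nat -> R) (N j k m : nat).

Definition harmonic_term a b k (t : R) := a k * cos (k%:R * t) + b k * sin (k%:R * t).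

Definition trigsum a b N (t : R) := \sum_(k < N) harmonic_term a b k.+1 t.

Lemma continuous_harmonic_term a b k : continuous (harmonic_term a b k).
Proof.
move=> t.
have h : is_derive t 1 (fun y : R => k%:R * y) k%:R.
  by have := is_derive_scale k%:R (is_derive_idr t); rewrite mulr1.
have hc := @is_derive_compr _ cos (fun y => k%:R * y) _ _ _ (is_derive_cos _) h.
have hs := @is_derive_compr _ sin (fun y => k%:R * y) _ _ _ (is_derive_sin _) h.
exact: is_derive_continuous (is_derive_add (is_derive_scale (a k) hc) (is_derive_scale (b k) hs)).
Qed.

Lemma harmonic_term_bound a b k t : `|harmonic_term a b k t| <= `|a k| + `|b k|.
Proof.
rewrite /harmonic_term (le_trans (ler_normD _ _))// lerD// normrM ler_piMr//.
  by rewrite ler_norml cos_geN1 cos_le1.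
by rewrite ler_norml sin_geN1 sin_le1.
Qed.

Lemma harmonic_cos k t : harmonic_term (fun=> 1) (fun=> 0) k t = cos (k%:R * t).
Proof. by rewrite /harmonic_term mul0r addr0 mul1r. Qed.

Lemma harmonic_sin k t : harmonic_term (fun=> 0) (fun=> 1) k t = sin (k%:R * t).
Proof. by rewrite /harmonic_term mul0r add0r mul1r. Qed.

(** Product-to-sum formula; the two frequencies are written j and j + k so that
    their difference is a natural number. *)
Lemma harmonic_termM a b a' b' j k t :
  harmonic_term a b j t * harmonic_term a' b' (j + k) t =
  harmonic_term (fun=> (a j * a' (j + k)%N + b j * b' (j + k)%N) / 2)
    (fun=> (a j * b' (j + k)%N - b j * a' (j + k)%N) / 2) k t +
  harmonic_term (fun=> (a j * a' (j + k)%N - b j * b' (j + k)%N) / 2)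
    (fun=> (a j * b' (j + k)%N + b j * a' (j + k)%N) / 2) (j + (j + k)) t.
Proof.
rewrite /harmonic_term !natrD.
have -> : (j%:R + (j%:R + k%:R)) * t = j%:R * t + (j%:R * t + k%:R * t) by ring.
rewrite (mulrDl j%:R) !cosD !sinD !cosD.
have := cos2Dsin2 (j%:R * t).
move: (cos (j%:R * t)) (sin (j%:R * t)) (cos (k%:R * t)) (sin (k%:R * t)).
move: (a j) (b j) (a' _) (b' _) => A B A' B' c s C S cs.
apply/eqP; rewrite -subr_eq0; apply/eqP.
transitivity (((A * A' + B * B') / 2 * C + (A * B' - B * A') / 2 * S) *
  (c ^+ 2 + s ^+ 2 - 1)); first by field.
by rewrite cs subrr mulr0.
Qed.

End trigonometric_polynomials.

Section orthogonality.
Context {R : realType}.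
Variables (th v : R -> R) (V : R).
Hypothesis mth : measurable_real th.
Hypothesis iv : integrableR v.
Hypothesis hV : intR v = V.
Hypothesis hc : forall k, intR (fun x => cos (k.+1%:R * th x) * v x) = 0.
Hypothesis hs : forall k, intR (fun x => sin (k.+1%:R * th x) * v x) = 0.
Implicit Types (a b : nat -> R) (N j k m : nat).

Let h a b k x := harmonic_term a b k (th x).

Let measurable_real_h a b k : measurable_real (h a b k).
Proof.
exact: (measurableT_comp (continuous_measurable_real (@continuous_harmonic_term _ a b k)) mth).
Qed.

Let integrableR_hv a b k : integrableR (fun x => h a b k x * v x).
Proof.
apply: integrableR_bounded => //; exists (`|a k| + `|b k|) => x.
exact: harmonic_term_bound.
Qed.

Lemma intR_harmonic a b k :
  intR (fun x => h a b k x * v x) = if k == 0%N then a 0%N * V else 0.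
Proof.
have -> : (fun x => h a b k x * v x) = fun x =>
    a k * (h (fun=> 1) (fun=> 0) k x * v x) + b k * (h (fun=> 0) (fun=> 1) k x * v x).
  by apply/funext => x; rewrite /h harmonic_cos harmonic_sin /harmonic_term; ring.
rewrite intRD ?intRZ; try exact/integrableRZ/integrableR_hv; try exact: integrableR_hv.
rewrite /h; under eq_fun do rewrite harmonic_cos.
under [X in _ + _ * intR X]eq_fun do rewrite harmonic_sin.
case: k => [|k] /=; last by rewrite hc hs !mulr0 addr0.
under eq_fun do rewrite mul0r cos0 mul1r.
under [X in _ + _ * intR X]eq_fun do rewrite mul0r sin0 mul0r.
by rewrite intR0 mulr0 addr0 hV.
Qed.

Let integrableR_hhv a b a' b' j m : integrableR (fun x => h a b j x * h a' b' m x * v x).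
Proof.
apply: integrableR_bounded => //; first by apply: measurable_funM; exact: measurable_real_h.
exists ((`|a j| + `|b j|) * (`|a' m| + `|b' m|)) => x.
by rewrite normrM ler_pM// harmonic_term_bound.
Qed.

Lemma intR_harmonicM a b a' b' j m : (0 < j)%N -> (j <= m)%N ->
  intR (fun x => h a b j x * h a' b' m x * v x) =
  if j == m then (a j * a' m + b j * b' m) / 2 * V else 0.
Proof.
move=> j0 jm; rewrite -(subnKC jm); move: (m - j)%N => k.
rewrite /h; under eq_fun do rewrite harmonic_termM mulrDl.
rewrite intRD; try exact: integrableR_hv.
rewrite !intR_harmonic [X in _ + X]ifF ?addr0; last by rewrite addn_eq0 gtn_eqF.
case: k => [|k]; first by rewrite !addn0 !eqxx.
by rewrite ifF//; apply/negbTE; rewrite neq_ltn addnS ltnS leq_addr.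
Qed.

Lemma integrableR_trigsumM a b a' b' N m :
  integrableR (fun x => trigsum a b N (th x) * h a' b' m x * v x).
Proof.
under eq_fun do rewrite /trigsum !mulr_suml.
exact: (@integrableR_sum _ N (fun i x => h a b i.+1 x * h a' b' m x * v x)).
Qed.

Lemma intR_trigsumM a b a' b' N m : (N < m)%N ->
  intR (fun x => trigsum a b N (th x) * h a' b' m x * v x) = 0.
Proof.
move=> Nm; under eq_fun do rewrite /trigsum !mulr_suml.
rewrite (@intR_sum _ N (fun i x => h a b i.+1 x * h a' b' m x * v x))//.
rewrite big1// => i _.
rewrite intR_harmonicM ?(leq_trans (ltn_ord i) (ltnW Nm))//.
by rewrite ifF// ltn_eqF// (leq_ltn_trans (ltn_ord i) Nm).
Qed.

(** The density v and the phase th are abstract: the lemma is used on the line,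
    with the Moebius density, and on the unit interval, with the uniform
    density. Adding the harmonics one at a time, the cross terms vanish by
    orthogonality. *)
Lemma trigsum_parseval a b N :
  integrableR (fun x => trigsum a b N (th x) ^+ 2 * v x) /\
  intR (fun x => trigsum a b N (th x) ^+ 2 * v x) =
  V / 2 * \sum_(k < N) (a k.+1 ^+ 2 + b k.+1 ^+ 2).
Proof.
elim: N => [|N [IHi IH]].
  rewrite /trigsum; under eq_fun do rewrite big_ord0 expr0n mul0r.
  split; first exact: integrableR0.
  by rewrite intR0 big_ord0 mulr0.
have E : (fun x => trigsum a b N.+1 (th x) ^+ 2 * v x) = fun x =>
    trigsum a b N (th x) ^+ 2 * v x + (2 * (trigsum a b N (th x) * h a b N.+1 x * v x)
    + h a b N.+1 x * h a b N.+1 x * v x).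
  by apply/funext => x; rewrite /trigsum big_ord_recr /= /h; ring.
rewrite E; split.
  apply: integrableRD => //; apply: integrableRD; last exact: integrableR_hhv.
  exact/integrableRZ/integrableR_trigsumM.
rewrite intRD//; last first.
  by apply: integrableRD => //; exact/integrableRZ/integrableR_trigsumM.
rewrite intRD//; last by exact/integrableRZ/integrableR_trigsumM.
rewrite intRZ; last exact: integrableR_trigsumM.
rewrite intR_trigsumM// mulr0 add0r intR_harmonicM// eqxx IH big_ord_recr /=.
by rewrite -!expr2; field.
Qed.

End orthogonality.

(** * The series of (1 - cos kt) / k^2 *)

Section quadratic_series.
Context {R : realType}.
Implicit Types (x y t a b : R) (N : nat).

Lemma mean_value_inequality (f df : R -> R) (a b M : R) :
  (forall z, a <= z <= b -> is_derive z 1 f (df z)) ->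
  (forall z, a <= z <= b -> `|df z| <= M) ->
  forall x y, a <= x <= b -> a <= y <= b -> `|f y - f x| <= M * `|y - x|.
Proof.
move=> H HM x y.
wlog xy : x y / x < y.
  move=> W ax ay; have [xy|yx|->] := ltgtP x y; first exact: W.
    by rewrite distrC (distrC y); exact: W.
  by rewrite !subrr normr0 mulr0.
move=> /andP[ax xb] /andP[ay yb].
have K z : z \in `[x, y] -> a <= z <= b.
  by rewrite in_itv/= => /andP[xz zy]; rewrite (le_trans ax xz) (le_trans zy yb).
have [||c cxy ->] := @MVT _ f df x y xy.
- by move=> z zxy; apply: H; apply: K; exact: subset_itv_oo_cc.
- apply: derivable_within_continuous => z zxy.
  exact: is_derive_derivable (H z (K z zxy)).
- by rewrite normrM ler_wpM2r// HM// K//; exact: subset_itv_oo_cc.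
Qed.

Lemma normr_sin_le x : `|sin x| <= `|x|.
Proof.
have := @mean_value_inequality sin cos (- `|x|) `|x| 1.
move=> /(_ (fun z _ => is_derive_sin z)) /(_ _ 0 x).
rewrite sin0 !subr0 mul1r; apply.
- by move=> z _; rewrite ler_norml cos_geN1 cos_le1.
- by rewrite oppr_le0 normr_ge0.
- by rewrite -ler_norml.
Qed.

Lemma one_minus_cos x : 1 - cos x = 2 * sin (x / 2) ^+ 2.
Proof.
rewrite [in LHS](_ : x = (x / 2) + (x / 2)); last by field.
rewrite cosD; have := cos2Dsin2 (x / 2); nra.
Qed.

Lemma one_minus_cos_ge0 x : 0 <= 1 - cos x.
Proof. by rewrite subr_ge0 cos_le1. Qed.

Lemma one_minus_cos_le x : 1 - cos x <= x ^+ 2 / 2.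
Proof.
rewrite one_minus_cos.
have : sin (x / 2) ^+ 2 <= (x / 2) ^+ 2.
  by rewrite -[leLHS]real_normK ?num_real// -[leRHS]real_normK ?num_real// ler_sqr ?nnegrE// normr_sin_le.
move=> H; have -> : x ^+ 2 / 2 = 2 * (x / 2) ^+ 2 by field.
by rewrite ler_pM2l.
Qed.

Definition sawtooth N t : R := \sum_(k < N) sin (k.+1%:R * t) / k.+1%:R.
Definition cosine_series N t : R :=
  \sum_(k < N) (1 - cos (k.+1%:R * t)) / k.+1%:R ^+ 2.

Lemma is_derive_cosine_series N t :
  is_derive t 1 (cosine_series N) (sawtooth N t).
Proof.
apply: (@is_derive_sumr _ N (fun k y => (1 - cos (k.+1%:R * y)) / k.+1%:R ^+ 2)
  (fun k => sin (k.+1%:R * t) / k.+1%:R)) => i.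
have H : is_derive t 1 (fun y => cos (i.+1%:R * y)) (- sin (i.+1%:R * t) * i.+1%:R).
  apply: (@is_derive_compr _ cos (fun y => i.+1%:R * y)).
  by have := is_derive_scale i.+1%:R (is_derive_idr t); rewrite mulr1.
apply: is_derive_eq (is_derive_mul (is_derive_sub (is_derive_const 1 t) H) (is_derive_const (i.+1%:R ^+ 2)^-1 t)) _.
have : i.+1%:R != 0 :> R by rewrite pnatr_eq0.
by move=> i0; field.
Qed.

Lemma is_derive_sawtooth N t :
  is_derive t 1 (sawtooth N) (\sum_(k < N) cos (k.+1%:R * t)).
Proof.
apply: (@is_derive_sumr _ N (fun k y => sin (k.+1%:R * y) / k.+1%:R)
  (fun k => cos (k.+1%:R * t))) => i.
have H : is_derive t 1 (fun y => sin (i.+1%:R * y)) (cos (i.+1%:R * t) * i.+1%:R).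
  apply: (@is_derive_compr _ sin (fun y => i.+1%:R * y)).
  by have := is_derive_scale i.+1%:R (is_derive_idr t); rewrite mulr1.
apply: is_derive_eq (is_derive_mul H (is_derive_const (i.+1%:R)^-1 t)) _.
have : i.+1%:R != 0 :> R by rewrite pnatr_eq0.
by move=> i0; field.
Qed.

Lemma dirichlet_kernel N t :
  2 * sin (t / 2) * (\sum_(k < N) cos (k.+1%:R * t)) =
  sin ((N%:R + 2^-1) * t) - sin (t / 2).
Proof.
elim: N => [|N IH]; first by rewrite big_ord0 add0r mulr0 (mulrC 2^-1) subrr.
rewrite big_ord_recr /= mulrDr IH.
have -> : (N.+1%:R + 2^-1) * t = N.+1%:R * t + t / 2 by ring.
have -> : (N%:R + 2^-1) * t = N.+1%:R * t - t / 2 by rewrite -natr1; field.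
by rewrite !sinD sinN cosN; ring.
Qed.

Lemma cos_half_odd N : cos ((N%:R + 2^-1) * pi) = 0 :> R.
Proof.
elim: N => [|N IH]; first by rewrite add0r mulrC cos_pihalf.
have -> : (N.+1%:R + 2^-1) * pi = (N%:R + 2^-1) * pi + pi :> R.
  by rewrite -natr1; ring.
by rewrite cosDpi IH oppr0.
Qed.

Lemma sin_natpi N : sin (N%:R * pi) = 0 :> R.
Proof.
elim: N => [|N IH]; first by rewrite mul0r sin0.
by rewrite -natr1 mulrDl mul1r sinDpi IH oppr0.
Qed.

Lemma sawtooth_pi N : sawtooth N pi = 0.
Proof. by rewrite /sawtooth big1// => i _; rewrite sin_natpi mul0r. Qed.

Lemma cos_add_2npi (x : R) l : cos (x + l%:R * (2 * pi)) = cos x.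
Proof.
elim: l => [|l IH]; first by rewrite mul0r addr0.
have -> : x + l.+1%:R * (2 * pi) = x + l%:R * (2 * pi) + pi + pi by rewrite -natr1; ring.
by rewrite !cosDpi opprK.
Qed.

Lemma sin_add_2npi (x : R) l : sin (x + l%:R * (2 * pi)) = sin x.
Proof.
elim: l => [|l IH]; first by rewrite mul0r addr0.
have -> : x + l.+1%:R * (2 * pi) = x + l%:R * (2 * pi) + pi + pi by rewrite -natr1; ring.
by rewrite !sinDpi opprK.
Qed.

Lemma sin_half_gt0 t : 0 < t -> t < 2 * pi -> 0 < sin (t / 2).
Proof.
move=> t0 t2; apply: sin_gt0_pi; rewrite divr_gt0//=.
by rewrite ltr_pdivrMr// mulrC.
Qed.

(** Adding the term cos ((N + 1/2) t) / ((2N + 1) sin (t / 2)) to the error of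
    the sawtooth series cancels the Dirichlet kernel in its derivative: the
    corrected error vanishes at pi and has a derivative O(1/N), uniformly away
    from the multiples of 2 pi. *)
Lemma sawtooth_cvg a b : 0 < a -> a <= pi -> pi <= b -> b < 2 * pi ->
  exists C : R, forall N t, a <= t <= b ->
    `|sawtooth N t - (pi - t) / 2| <= C / N.+1%:R.
Proof.
move=> a0 api pib b2.
have ab : a <= b by exact: le_trans pib.
have sgt t : a <= t <= b -> 0 < sin (t / 2).
  by move=> /andP[at_ tb]; apply: sin_half_gt0; [exact: lt_le_trans at_|exact: le_lt_trans b2].
have dhalf t : is_derive t 1 (fun y : R => y / 2) 2^-1.
  by apply: is_derive_eq (is_derive_mul (is_derive_idr t) (is_derive_const 2^-1 t)) _; rewrite mulr0 add0r mulr1.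
have dsin t : is_derive t 1 (fun y => sin (y / 2)) (cos (t / 2) * 2^-1).
  exact: (@is_derive_compr _ sin (fun y => y / 2)).
have [c cab Hc] : exists2 c, c \in `[a, b] & forall t, t \in `[a, b] -> sin (c / 2) <= sin (t / 2).
  apply: EVT_min => //; apply: continuous_subspaceT => t.
  exact: is_derive_continuous (dsin t).
set s := sin (c / 2) in Hc.
have s0 : 0 < s by apply: sgt; move: cab; rewrite in_itv.
pose w N : R := (2 * N + 1)%:R.
have w0 N : 0 < w N by rewrite ltr0n addn1.
have wN N : w N = 2 * N%:R + 1 by rewrite /w natrD natrM.
pose g N t := sawtooth N t - (pi - t) / 2 + cos ((N%:R + 2^-1) * t) / (w N * sin (t / 2)).
pose dg N t := - cos ((N%:R + 2^-1) * t) * cos (t / 2) / (2 * w N * sin (t / 2) ^+ 2).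
have gder N t : a <= t <= b -> is_derive t 1 (g N) (dg N t).
  move=> /sgt st; have st0 : sin (t / 2) != 0 by rewrite gt_eqF.
  have w00 : w N != 0 by rewrite gt_eqF.
  have h1 : is_derive t 1 (fun y => cos ((N%:R + 2^-1) * y)) (- sin ((N%:R + 2^-1) * t) * (N%:R + 2^-1)).
    apply: (@is_derive_compr _ cos (fun y => (N%:R + 2^-1) * y)).
    by have := is_derive_scale (N%:R + 2^-1) (is_derive_idr t); rewrite mulr1.
  have h2 := @is_derive_invr _ (fun y => w N * sin (y / 2)) t _ (mulf_neq0 w00 st0) (is_derive_scale (w N) (dsin t)).
  have h3 := is_derive_mul (is_derive_sub (is_derive_const pi t) (is_derive_idr t)) (is_derive_const (2^-1) t).
  apply: is_derive_eq (is_derive_add (is_derive_sub (is_derive_sawtooth N t) h3) (is_derive_mul h1 h2)) _.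
  have D := dirichlet_kernel N t.
  have -> : \sum_(k < N) cos (k.+1%:R * t) = (sin ((N%:R + 2^-1) * t) - sin (t / 2)) / (2 * sin (t / 2)).
    by rewrite -D; field; rewrite st0.
  move: w00; rewrite /dg wN => w00; field.
  by rewrite st0.
exists (2 * pi / (2 * s ^+ 2) + 1 / s) => N t tab.
have st := sgt t tab.
have sst : s <= sin (t / 2) by apply: Hc; rewrite in_itv.
have gpi : g N pi = 0.
  by rewrite /g sawtooth_pi cos_half_odd subrr !mul0r subr0 addr0.
have iw : (w N)^-1 <= N.+1%:R^-1.
  rewrite lef_pV2 ?posrE; [|exact: w0|by rewrite ltr0n].
  by rewrite wN -natr1; have := ler0n R N; lra.
have gb : `|g N t| <= (2 * pi / (2 * s ^+ 2)) / N.+1%:R.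
  have := @mean_value_inequality (g N) (dg N) a b ((2 * s ^+ 2)^-1 / N.+1%:R) (gder N).
  move=> /(_ _ pi t); rewrite gpi subr0 => H.
  apply: le_trans (H _ _ _) _ => //; last 2 first.
  - by rewrite api.
  - rewrite (mulrC (2 * pi)) [leRHS]mulrAC ler_wpM2l//.
      by rewrite divr_ge0// invr_ge0 mulr_ge0 ?exprn_ge0// ltW.
    move: tab => /andP[? ?]; rewrite ler_norml; apply/andP; split; lra.
  move=> z zab; have sz := sgt z zab.
  have ssz : s <= sin (z / 2) by apply: Hc; rewrite in_itv.
  have d0 : 0 <= 2 * w N * sin (z / 2) ^+ 2.
    by rewrite !mulr_ge0 ?exprn_ge0 ?(ltW sz) ?(ltW (w0 N)).
  rewrite /dg normrM normfV (ger0_norm d0).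
  apply: (@le_trans _ _ (1 * (2 * w N * sin (z / 2) ^+ 2)^-1)).
    rewrite ler_wpM2r ?invr_ge0// normrM normrN.
    by rewrite mulr_ile1// ler_norml cos_geN1 cos_le1.
  rewrite mul1r -invfM lef_pV2 ?posrE ?mulr_gt0 ?exprn_gt0 ?ltr0n ?addn1//.
  rewrite [leRHS]mulrAC; apply: ler_pM => //.
  - by rewrite mulr_ge0// exprn_ge0// ltW.
  - by rewrite ler_pM2l// ler_sqr ?nnegrE ?(ltW s0) ?(ltW sz).
  - by rewrite wN -natr1; have := ler0n R N; lra.
have -> : sawtooth N t - (pi - t) / 2 = g N t - cos ((N%:R + 2^-1) * t) / (w N * sin (t / 2)).
  by rewrite /g addrK.
apply: le_trans (ler_normB _ _) _; rewrite [leRHS]mulrDl lerD//.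
have d0 : 0 <= w N * sin (t / 2) by rewrite mulr_ge0// ltW.
rewrite normrM normfV (ger0_norm d0) -[leRHS]mulrA.
apply: ler_pM; rewrite ?invr_ge0//; first by rewrite ler_norml cos_geN1 cos_le1.
rewrite invfM mulrC; apply: ler_pM; rewrite ?invr_ge0 ?(ltW st) ?(ltW (w0 N))//.
by rewrite lef_pV2 ?posrE.
Qed.

Lemma inv_sqr_le n : (0 < n)%N -> (n.+1%:R ^+ 2)^-1 <= n%:R^-1 - n.+1%:R^-1 :> R.
Proof.
move=> n0; have n0' : 0 < n%:R :> R by rewrite ltr0n.
have n1 : 0 < n.+1%:R :> R by rewrite ltr0n.
have -> : n%:R^-1 - n.+1%:R^-1 = (n%:R * n.+1%:R)^-1 :> R.
  by rewrite -natr1 in n1 *; field; rewrite !gt_eqF.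
by rewrite lef_pV2 ?posrE ?mulr_gt0 ?exprn_gt0// expr2 ler_pM2r// ler_nat.
Qed.

Lemma sum_inv_sqr_le N : \sum_(k < N) (k.+1%:R ^+ 2)^-1 <= 2 :> R.
Proof.
suff H : \sum_(k < N.+1) (k.+1%:R ^+ 2)^-1 <= 2 - N.+1%:R^-1 :> R.
  apply: (@le_trans _ _ (\sum_(k < N.+1) (k.+1%:R ^+ 2)^-1)).
    by rewrite big_ord_recr lerDl invr_ge0 exprn_ge0.
  by apply: le_trans H _; rewrite gerBl invr_ge0.
elim: N => [|N IH]; first by rewrite big_ord1 expr1n invr1; lra.
rewrite big_ord_recr /=; apply: le_trans (lerD IH (@inv_sqr_le N.+1 isT)) _.
by rewrite addrA subrK.
Qed.

(** Near t = 0 the terms up to K are bounded by t^2 / 2 and the later ones by 2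
    / k^2; this controls the partial sums at a left endpoint where no closed
    form is known yet. *)
Lemma cosine_series_small N K t : (0 < K)%N ->
  cosine_series N t <= K%:R * (t ^+ 2 / 2) + 2 / K%:R.
Proof.
move=> K0; have t20 : 0 <= t ^+ 2 / 2 by rewrite divr_ge0 ?sqr_ge0.
have K0' : 0 < K%:R :> R by rewrite ltr0n.
have small n : (n <= K)%N -> cosine_series n t <= n%:R * (t ^+ 2 / 2).
  elim: n => [|n IH] nK; first by rewrite /cosine_series big_ord0 mul0r.
  have -> : n.+1%:R * (t ^+ 2 / 2) = n%:R * (t ^+ 2 / 2) + t ^+ 2 / 2.
    by rewrite -natr1 mulrDl mul1r.
  rewrite /cosine_series big_ord_recr; apply: lerD; first exact: IH (ltnW nK).
  rewrite /=.
  rewrite ler_pdivrMr ?exprn_gt0 ?ltr0n//.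
  by apply: le_trans (one_minus_cos_le _) _; rewrite exprMn; lra.
have [NK|KN] := leqP N K.
  apply: le_trans (small _ NK) _; rewrite ler_wpDr ?divr_ge0//.
  by rewrite ler_wpM2r// ler_nat.
suff H m : cosine_series (K + m) t <=
    K%:R * (t ^+ 2 / 2) + 2 / K%:R - 2 / (K + m)%:R.
  have := H (N - K)%N; rewrite subnKC ?(ltnW KN)// => {}H.
  by apply: le_trans H _; rewrite gerBl divr_ge0.
elim: m => [|m IH]; first by rewrite addn0 addrK small.
rewrite /cosine_series addnS big_ord_recr /=.
apply: (le_trans (lerD IH (_ : _ <= 2 / (K + m).+1%:R ^+ 2))); last first.
  have := @inv_sqr_le (K + m)%N; rewrite addn_gt0 K0 => /(_ isT) H.
  apply: (@le_trans _ _ (K%:R * (t ^+ 2 / 2) + 2 / K%:R - 2 / (K + m)%:R +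
    2 * ((K + m)%:R^-1 - (K + m).+1%:R^-1))); last first.
    by move: (K + m)%:R^-1 (K + m).+1%:R^-1 => u v; lra.
  by rewrite lerD2l ler_pM2l.
rewrite ler_wpM2r ?invr_ge0 ?exprn_ge0//.
by have := cos_geN1 ((K + m).+1%:R * t); lra.
Qed.

Lemma cosine_series_ge0 N t : 0 <= cosine_series N t.
Proof.
by apply: sumr_ge0 => i _; rewrite divr_ge0 ?one_minus_cos_ge0 ?exprn_ge0.
Qed.

(** The difference between the partial sum and the limit has derivative O(1/N)
    on [a, t], and at the point a it is small uniformly in N once a is small;
    hence no value of the series, such as pi^2 / 6, has to be known beforehand. *)
Theorem cosine_series_cvg t : 0 < t -> t < 2 * pi ->
  cosine_series N t @[N --> \oo] --> pi * t / 2 - t ^+ 2 / 4.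
Proof.
move=> t0 t2; apply/cvgrPdist_le => e e0.
have pi0 : 0 < pi :> R := pi_gt0 R.
set q := fun t : R => pi * t / 2 - t ^+ 2 / 4.
(* K makes the tail 2 / K small; then a makes both the first K terms and the
   limit itself small at a. *)
pose K := (Num.truncn (8 / e)).+1.
have K0 : 0 < K%:R :> R by rewrite ltr0n.
have Ke : 2 / K%:R <= e / 4.
  rewrite ler_pdivrMr//.
  have : 8 / e < K%:R by exact: truncnS_gt.
  by rewrite ltr_pdivrMr// => ?; lra.
pose c : R := K%:R / 2 + pi / 2 + 1.
have c0 : 0 < c by rewrite /c; have := pi0; lra.
pose a := Num.min (Num.min 1 t) (Num.min pi (e / (4 * c))).
have a0 : 0 < a by rewrite !lt_min ltr01 t0 pi0 divr_gt0// mulr_gt0.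
have [a1 at_ api ae] : [/\ a <= 1, a <= t, a <= pi & a <= e / (4 * c)].
  by rewrite /a !ge_min !lexx !orbT.
pose b := Num.max pi t.
have [bpi bt] : pi <= b /\ t <= b by rewrite /b !le_max !lexx orbT.
have b2 : b < 2 * pi by rewrite /b gt_max t2 andbT; lra.
have [C HC] := sawtooth_cvg a0 api bpi b2.
have dq (z : R) : is_derive z 1 q ((pi - z) / 2).
  have h1 := is_derive_mul (is_derive_scale pi (is_derive_idr z)) (is_derive_const 2^-1 z).
  have h2 := is_derive_mul (is_derive_mul (is_derive_idr z) (is_derive_idr z)) (is_derive_const 4^-1 z).
  by apply: is_derive_eq (is_derive_sub h1 h2) _; field.
have ac : K%:R * (a ^+ 2 / 2) + `|q a| <= e / 4.
  have aa : a ^+ 2 <= a by rewrite expr2 ler_piMl// ltW.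
  have qa : `|q a| <= a * (pi / 2 + 1 / 4).
    rewrite /q; apply: le_trans (ler_normB _ _) _.
    rewrite !ger0_norm ?divr_ge0 ?mulr_ge0 ?sqr_ge0 ?(ltW a0) ?(ltW pi0)//.
    by lra.
  have : a * c <= e / 4.
    by move: ae; rewrite ler_pdivlMr ?mulr_gt0// => ?; lra.
  apply: le_trans; rewrite /c.
  have : K%:R * a ^+ 2 <= K%:R * a by rewrite ler_pM2l.
  by lra.
have fa N : `|cosine_series N a - q a| <= e / 2.
  apply: le_trans (ler_normB _ _) _; rewrite ger0_norm ?cosine_series_ge0//.
  by have := cosine_series_small N a (ltn0Sn (Num.truncn (8 / e))); rewrite -/K; lra.
near=> N.
rewrite distrC.
have -> : cosine_series N t - q t = (cosine_series N a - q a) +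
  ((cosine_series N t - q t) - (cosine_series N a - q a)) by ring.
apply: le_trans (ler_normD _ _) _.
have -> : e = e / 2 + e / 2 by field.
apply: lerD => //.
have := @mean_value_inequality (fun t => cosine_series N t - q t)
  (fun t => sawtooth N t - (pi - t) / 2) a b (C / N.+1%:R)
  (fun z _ => is_derive_sub (is_derive_cosine_series N z) (dq z)) (HC N) a t.
rewrite lexx (le_trans at_ bt) at_ bt => /(_ isT isT) H.
apply: le_trans H _.
rewrite mulrAC ler_pdivrMr ?ltr0n//.
apply: (@le_trans _ _ (`|C| * (2 * pi))).
  apply: (@le_trans _ _ (`|C| * `|t - a|)); first by rewrite ler_wpM2r// ler_norm.
  rewrite ler_wpM2l// ger0_norm ?subr_ge0//; lra.
rewrite -ler_pdivrMl ?divr_gt0//.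
apply: (@le_trans _ _ N%:R); last by rewrite ler_nat.
by near: N; exact: nbhs_infty_ger.
Unshelve. all: by end_near. Qed.

End quadratic_series.

(** * The Landau-Kolmogorov inequality on a half-line *)

Section landau_kolmogorov.
Context {R : realType}.
Variable u : R -> R.
Hypothesis su : smooth u.
Hypothesis bu : forall b, exists C, forall x, `|derive1n b u x| <= C.
Implicit Types (b : nat) (x y h : R).

Let D b := derive1n b u.

Let dD b (y : R) : is_derive y 1 (D b) (D b.+1 y).
Proof. by rewrite /D derive1nS; exact/smooth_is_derive/smooth_derive1n. Qed.

Let M b x := sup [set `|D b y| | y in [set y | x <= y]].

Let M_has_sup b x : has_sup [set `|D b y| | y in [set y | x <= y]].
Proof.
split; first by exists `|D b x|, x => //=.
by have [C HC] := bu b; exists C => _ [y _ <-]; exact: HC.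
Qed.

Let le_M b x y : x <= y -> `|D b y| <= M b x.
Proof. by move=> xy; apply: ub_le_sup; [exact: (M_has_sup b x).2|exists y]. Qed.

Let M_le b x C : (forall y, x <= y -> `|D b y| <= C) -> M b x <= C.
Proof. by move=> H; apply: ge_sup; [exact: (M_has_sup b x).1|move=> _ [y xy <-]; exact: H]. Qed.

Let M_ge0 b x : 0 <= M b x.
Proof. by apply: le_trans (le_M b (lexx x)). Qed.

Let M_step b x t : 0 < t -> M b.+1 x * t <= 2 * M b x + t ^+ 2 * M b.+2 x.
Proof.
move=> t0; rewrite -ler_pdivlMr//; apply: M_le => y xy; rewrite ler_pdivlMr//.
have ty : y < y + t by rewrite ltrDl.
have [||z zy] := @MVT _ (D b) (D b.+1) y (y + t) ty.
- by move=> z _; exact: dD.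
- by apply: continuous_subspaceT => z; exact: is_derive_continuous (dD b z).
rewrite addrAC subrr add0r => E.
have /andP[yz zt] : y < z < y + t by move: zy; rewrite in_itv.
have H := @mean_value_inequality _ (D b.+1) (D b.+2) y (y + t) (M b.+2 x).
have {H} H : `|D b.+1 y - D b.+1 z| <= M b.+2 x * `|y - z|.
  apply: H => [v _|v /andP[yv _]||].
  - exact: dD.
  - by apply: le_M; exact: le_trans yv.
  - by rewrite (ltW yz) (ltW zt).
  - by rewrite lexx (ltW ty).
have yzt : `|y - z| <= t by rewrite ler_norml; apply/andP; split; lra.
have E2 : `|D b.+1 z| * t <= 2 * M b x.
  rewrite -{1}(gtr0_norm t0) -normrM -E (le_trans (ler_normB _ _))//.
  have -> : 2 * M b x = M b x + M b x by ring.
  by rewrite lerD// le_M// (le_trans xy)// ltW.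
have -> : D b.+1 y = D b.+1 z + (D b.+1 y - D b.+1 z) by ring.
apply: (@le_trans _ _ ((`|D b.+1 z| + `|D b.+1 y - D b.+1 z|) * t)).
  by rewrite ler_wpM2r ?ler_normD// ltW.
rewrite [leLHS]mulrDl lerD//.
have -> : t ^+ 2 * M b.+2 x = M b.+2 x * t * t by ring.
rewrite ler_wpM2r//; first exact: ltW.
by apply: le_trans H _; exact: ler_wpM2l.
Qed.

Let M_absorb b e : 0 < e -> exists2 A, 0 <= A & forall x h, 0 < h ->
  M b x * h ^+ b <= A * M 0 x + e * (M b.+1 x * h ^+ b.+1).
Proof.
elim: b e => [|b IH] e e0.
  exists 1 => // x h h0; rewrite expr0 mulr1 mul1r lerDl.
  by rewrite !mulr_ge0// ?M_ge0// ?exprn_ge0// ltW.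
(* The step is taken of length s h, and the induction hypothesis with e
   replaced by s / 4 lets half of the left-hand side be absorbed. *)
pose s := e / 2; have s0 : 0 < s by rewrite divr_gt0.
have [|A A0 HA] := IH (s / 4); first by rewrite divr_gt0.
exists (4 * A / s); first by rewrite divr_ge0 ?mulr_ge0// ltW.
move=> x h h0.
have hb : 0 < h ^+ b by rewrite exprn_gt0.
have := M_step b x (mulr_gt0 s0 h0).
rewrite -(ler_pM2r hb) => K.
have := HA x h h0.
move: K; rewrite (exprS h b.+1) (exprS h b).
set m := h ^+ b; set M0 := M 0 x; set M1 := M b x; set M2 := M b.+1 x; set M3 := M b.+2 x.
move=> K L.
rewrite -(ler_pM2l s0) -subr_ge0.
have -> : s * (4 * A / (e / 2) * M0 + e * (M3 * (h * (h * m)))) - s * (M2 * (h * m))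
  = 4 * A * M0 + 2 * s ^+ 2 * (M3 * (h * (h * m))) - s * (M2 * (h * m)).
  have -> : e = 2 * s by rewrite /s; field.
  by field; rewrite gt_eqF.
have K' : s * (M2 * (h * m)) <= 2 * (M1 * m) + s ^+ 2 * (M3 * (h * (h * m))).
  by apply: le_trans (le_trans _ K) _; rewrite le_eqVlt; apply/orP; left; apply/eqP; ring.
lra.
Qed.

Let M_interp b j : exists2 A, 0 <= A & forall x h, 0 < h ->
  M b x * h ^+ b <= A * (M 0 x + M (b + j) x * h ^+ (b + j)).
Proof.
elim: j b => [|j IH] b.
  exists 1 => // x h h0; rewrite mul1r addn0 lerDr; exact: M_ge0.
have [A A0 HA] := M_absorb b ltr01.
have [B B0 HB] := IH b.+1.
exists (A + B); first exact: addr_ge0.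
move=> x h h0; apply: le_trans (HA x h h0) _; rewrite mul1r.
have := HB x h h0; rewrite addSnnS => H.
apply: (le_trans (lerD (lexx _) H)).
rewrite [leRHS]mulrDl lerD// ler_wpM2l// lerDl.
by rewrite mulr_ge0 ?M_ge0// exprn_ge0// ltW.
Qed.

(** With M_b the supremum of |u^(b)| over [x, oo), a Taylor step of length t
    gives t M_(b+1) <= 2 M_b + t^2 M_(b+2); iterating, M_b h^b <= A (M_0 +
    M_(2b) h^(2b)) for every h, and h is chosen to balance both terms. Only
    values to the right of x enter, which is why the weight need only be
    monotone there. *)
Theorem landau_kolmogorov b : (0 < b)%N -> exists2 A, 0 <= A &
  forall x m0 m2, 0 < m0 -> 0 < m2 ->
    (forall y, x <= y -> `|u y| <= m0) ->
    (forall y, x <= y -> `|derive1n (b + b) u y| <= m2) ->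
    derive1n b u x ^+ 2 <= A * (m0 * m2).
Proof.
move=> b0; have [A A0 HA] := M_interp b b.
exists (4 * A ^+ 2); first by rewrite mulr_ge0// sqr_ge0.
move=> x m0 m2 m00 m20 H0 H2.
(* The choice h^(2b) = m0 / m2 balances the two terms. *)
pose H := Num.sqrt (m0 / m2).
have Hp : 0 < H by rewrite sqrtr_gt0 divr_gt0.
have HE : H ^+ 2 = m0 / m2 by rewrite sqr_sqrtr// divr_ge0// ltW.
pose h := H `^ (b%:R^-1).
have h0 : 0 < h by exact: powR_gt0.
have hb : h ^+ b = H.
  rewrite -powR_mulrn ?ltW// -powRrM mulVf ?powRr1 ?ltW//.
  by rewrite pnatr_eq0 -lt0n.
have := HA x h h0; rewrite exprD hb.
have M0 : M 0 x <= m0 by exact: M_le.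
have M2 : M (b + b) x <= m2 by exact: M_le.
have Db : `|D b x| <= M b x by exact: le_M.
move=> K.
have K2 : `|D b x| * H <= 2 * A * m0.
  apply: (@le_trans _ _ (M b x * H)); first by rewrite ler_wpM2r// ltW.
  apply: le_trans K _; have -> : 2 * A * m0 = A * (2 * m0) by ring.
  rewrite ler_wpM2l//.
  have -> : 2 * m0 = m0 + m2 * (H * H).
    by rewrite -expr2 HE mulrCA divff ?gt_eqF//; ring.
  by rewrite lerD// ler_wpM2r// mulr_ge0// ltW.
have : (`|D b x| * H) ^+ 2 <= (2 * A * m0) ^+ 2.
  by rewrite ler_sqr ?nnegrE ?mulr_ge0 ?(ltW Hp) ?(ltW m00).
have -> : (`|D b x| * H) ^+ 2 = D b x ^+ 2 * (m0 / m2).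
  by rewrite exprMn HE real_normK ?num_real.
move=> /(ler_wpM2r (ltW m20)) L.
rewrite -(ler_pM2r m00) -/(D b).
have -> : D b x ^+ 2 * m0 = D b x ^+ 2 * (m0 / m2) * m2.
  by field; rewrite gt_eqF.
apply: le_trans L _.
by rewrite le_eqVlt; apply/orP; left; apply/eqP; ring.
Qed.

End landau_kolmogorov.

(** * Weights with monotone tails *)

Section schwartz_weights.
Context {R : realType}.
Implicit Types (rho f g : R -> R) (b p : nat) (x : R).

Lemma smoothX f p : smooth f -> smooth (fun x => f x ^+ p).
Proof.
move=> sf; elim: p => [|p IH]; first by under eq_fun do rewrite expr0; exact: smooth_cst.
by under eq_fun do rewrite exprS; exact: smoothM.
Qed.

Lemma derive1nD b f g : smooth f -> smooth g ->
  derive1n b (fun x => f x + g x) = fun x => derive1n b f x + derive1n b g x.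
Proof.
elim: b f g => [//|b IH] f g sf sg; rewrite !derive1Sn.
rewrite (derive1_is_derive
  (fun x => is_derive_add (smooth_is_derive sf x) (smooth_is_derive sg x))).
by apply: IH; exact: smooth_derive1.
Qed.

Lemma derive1nZ b (k : R) f : smooth f ->
  derive1n b (fun x => k * f x) = fun x => k * derive1n b f x.
Proof.
elim: b f => [//|b IH] f sf; rewrite !derive1Sn.
rewrite (derive1_is_derive (fun x => is_derive_scale k (smooth_is_derive sf x))).
by apply: IH; exact: smooth_derive1.
Qed.

Lemma derive1n_opp b f : smooth f ->
  derive1n b (fun x => f (- x)) = fun x => (-1) ^+ b * derive1n b f (- x).
Proof.
elim: b f => [|b IH] f sf; first by apply/funext => x; rewrite mul1r.
have H x : is_derive x 1 (fun x => f (- x)) (-1 * derive1 f (- x)).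
  apply: is_derive_eq (@is_derive_compr _ f (fun x => - x) _ _ _ (smooth_is_derive sf _) (is_derive_neg (is_derive_idr x))) _.
  by ring.
rewrite !derive1Sn (derive1_is_derive H).
have so : smooth (fun x => derive1 f (- x)).
  have := @smooth_affine _ (derive1 f) (-1) 0 (smooth_derive1 sf).
  by under eq_fun do rewrite addr0 mulN1r.
rewrite (derive1nZ b (-1) so) IH; last exact: smooth_derive1.
by apply/funext => x; rewrite exprS mulrA.
Qed.

Lemma schwartz_bound rho b p : schwartz rho ->
  exists2 C, 0 < C & forall x, `|x| ^+ p * `|derive1n b rho x| <= C.
Proof.
move=> [_ /(_ p b) [C HC]]; exists (`|C| + 1); first by rewrite ltr_wpDl.
move=> x; apply: le_trans (_ : C <= _); last first.
  by rewrite (le_trans (ler_norm C))// lerDl.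
by apply: HC; exists x => //; rewrite normrM normrX.
Qed.

(** To the right of K the weight is decreasing, so it is at most rho(x) on [x,
    oo), while its derivative of order 2b is O(x^(-p)) there because rho is a
    Schwartz function; Landau-Kolmogorov multiplies the two bounds. *)
Lemma tail_weight_bound rho K b p : schwartz rho -> (forall x, 0 < rho x) ->
  0 < K -> (forall x, K < x -> derive1 rho x <= 0) ->
  exists2 C, 0 <= C & forall x, K + 1 <= x ->
    derive1n b rho x ^+ 2 * x ^+ p <= C * rho x.
Proof.
move=> Srho rho0 K0 Kdec; have sr := Srho.1.
have decr x y : K + 1 <= x -> x <= y -> rho y <= rho x.
  move=> Kx; rewrite le_eqVlt => /orP[/eqP ->//|xy].
  have [||z zxy] := @MVT _ rho (derive1 rho) x y xy.
  - by move=> z _; exact: smooth_is_derive.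
  - by apply: continuous_subspaceT; exact: smooth_continuous.
  move=> E; rewrite -subr_le0 E mulr_le0_ge0 ?subr_ge0 ?(ltW xy)//.
  apply: Kdec; move: zxy; rewrite in_itv/= => /andP[xz _].
  by apply: lt_trans xz; apply: lt_le_trans Kx; rewrite ltrDl.
have Kx0 x : K + 1 <= x -> 0 < x.
  by apply: lt_le_trans; rewrite addr_gt0.
case: b => [|b].
  have [C C0 HC] := schwartz_bound 0 p Srho.
  exists C; first exact: ltW.
  move=> x /Kx0 x0; rewrite expr2 -mulrA mulrC ler_wpM2r//; first exact: ltW.
  have := HC x; rewrite !gtr0_norm// ?rho0//.
  by rewrite mulrC.
have [C C0 HC] := schwartz_bound (b.+1 + b.+1) p Srho.
have bdd b' : exists C, forall x, `|derive1n b' rho x| <= C.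
  have [C' _ HC'] := schwartz_bound b' 0 Srho.
  by exists C' => x; have := HC' x; rewrite expr0 mul1r.
have [A A0 HA] := landau_kolmogorov sr bdd (ltn0Sn b).
exists (A * C); first by rewrite mulr_ge0// ltW.
move=> x Kx; have x0 := Kx0 x Kx.
have xp : 0 < x ^+ p by rewrite exprn_gt0.
have := HA x (rho x) (C / x ^+ p) (rho0 x) (divr_gt0 C0 xp).
move=> /(_ _ _) H; rewrite -ler_pdivlMr//.
apply: le_trans (H _ _) _.
- by move=> y xy; rewrite gtr0_norm// decr.
- move=> y xy; rewrite ler_pdivlMr// mulrC; apply: le_trans (HC y).
  rewrite ler_wpM2r// lerXn2r ?nnegrE ?(ltW x0)//.
  by apply: le_trans xy _; exact: ler_norm.
- by rewrite le_eqVlt; apply/orP; left; apply/eqP; field; rewrite gt_eqF.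
Qed.

Lemma schwartz_opp rho : schwartz rho -> schwartz (fun x => rho (- x)).
Proof.
move=> [sr br]; split.
  have := @smooth_affine _ rho (-1) 0 sr.
  by under eq_fun do rewrite addr0 mulN1r.
move=> a b; have [C HC] := br a b; exists C => _ [x _ <-].
rewrite (derive1n_opp b sr) !normrM !normrX normrN1 expr1n mul1r -normrN -normrX -normrM.
by apply: HC; exists (- x).
Qed.

(** The two tails are handled by the monotone bound, applied to rho and to its
    reflection, and the remaining compact interval by the positivity of rho. *)
Lemma weight_derivative_bound rho : schwartz_mon_pos rho -> forall b p,
  exists2 C, 0 <= C & forall x,
    derive1n b rho x ^+ 2 * (1 + x ^+ 2) ^+ p <= C * rho x.
Proof.
move=> [Srho rho0 [K K0 HK]] b p.
have sr := Srho.1.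
have [x Kx|C1 C10 HC1] := @tail_weight_bound rho K b (p + p) Srho rho0 K0.
  have := HK x; rewrite pmulr_rle0; last exact: lt_trans Kx.
  by apply; rewrite in_itv/= negb_and -!ltNge Kx orbT.
have dopp x : derive1 (fun x => rho (- x)) x = - derive1 rho (- x).
  by have := derive1n_opp 1 sr => /(congr1 (fun f => f x)) /= ->; rewrite expr1 mulN1r.
have [x Kx|C2 C20 HC2] := @tail_weight_bound (fun x => rho (- x)) K b (p + p)
    (schwartz_opp Srho) (fun x => rho0 (- x)) K0.
  rewrite dopp oppr_le0.
  have := HK (- x); rewrite mulNr oppr_le0 pmulr_rge0; last exact: lt_trans Kx.
  by apply; rewrite in_itv/= negb_and -!ltNge ltrN2 Kx.
(* On the compact interval [-(K + 1), K + 1] the quotient by rho is continuous. *)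
pose g x := derive1n b rho x ^+ 2 * (1 + x ^+ 2) ^+ p / rho x.
have sg : smooth (fun x => derive1n b rho x ^+ 2 * (1 + x ^+ 2) ^+ p).
  apply: smoothM; first exact/smoothX/smooth_derive1n.
  by apply/smoothX/smoothD; [exact: smooth_cst|exact/smoothX/smooth_id].
have cg : {within `[- (K + 1), K + 1], continuous g}.
  apply: continuous_subspaceT => x.
  have cr : {for x, continuous rho} by exact: smooth_continuous.
  apply: cvgM; last by apply: cvgV => //; rewrite gt_eqF.
  exact: (@smooth_continuous _ _ sg x).
have K1 : - (K + 1) <= K + 1 by rewrite ge0_cp ?addr_ge0// ltW.
have [c _ Hc] := EVT_max K1 cg.
have big x : K + 1 <= `|x| -> (1 + x ^+ 2) ^+ p <= 2 ^+ p * `|x| ^+ (p + p).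
  move=> Kx; rewrite addnn -mul2n exprM -exprMn.
  have a1 : 0 <= 1 + x ^+ 2 by rewrite addr_ge0// sqr_ge0.
  have a2 : 0 <= 2 * `|x| ^+ 2 by rewrite mulr_ge0// exprn_ge0.
  rewrite lerXn2r ?nnegrE//.
  rewrite real_normK ?num_real// mulrDl mul1r lerD2r.
  have : 1 <= `|x| by apply: le_trans Kx; rewrite lerDr ltW.
  by rewrite -[x ^+ 2]real_normK ?num_real// => ?; rewrite exprn_ege1.
exists (2 ^+ p * C1 + 2 ^+ p * C2 + `|g c|); first by rewrite !addr_ge0 ?mulr_ge0 ?exprn_ge0.
move=> x; have r0 := rho0 x.
have [xK|Kx] := leP `|x| (K + 1).
  rewrite -ler_pdivrMr//; apply: (@le_trans _ _ (g c)).
    by apply: Hc; rewrite in_itv/= -ler_norml.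
  by rewrite (le_trans (ler_norm _))// lerDr !addr_ge0 ?mulr_ge0 ?exprn_ge0.
apply: (@le_trans _ _ (2 ^+ p * (derive1n b rho x ^+ 2 * `|x| ^+ (p + p)))).
  by rewrite [leRHS]mulrCA ler_wpM2l ?sqr_ge0// big// ltW.
have P0 : 0 <= 2 ^+ p :> R by rewrite exprn_ge0.
case: (lerP 0 x) => x0; last first.
  apply: (@le_trans _ _ (2 ^+ p * (C2 * rho x))); last first.
    by rewrite mulrA ler_wpM2r ?(ltW r0)// (addrC (_ * C1)) -addrA lerDl addr_ge0 ?mulr_ge0.
  have nx : - x = `|x| by rewrite ltr0_norm.
  rewrite ler_wpM2l//; have := HC2 (- x).
  rewrite nx => /(_ (ltW Kx)); rewrite (derive1n_opp b sr) -nx opprK.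
  by rewrite exprMn -exprM mulnC exprM sqrrN expr1n expr1n mul1r.
apply: (@le_trans _ _ (2 ^+ p * (C1 * rho x))); last first.
  by rewrite mulrA ler_wpM2r ?(ltW r0)// -addrA lerDl addr_ge0 ?mulr_ge0.
rewrite ger0_norm// in Kx *.
by rewrite ler_wpM2l// HC1// ltW.
Qed.

(** This class contains rho, and it is closed under derivation and under
    multiplication by polynomials; these are all the operations that occur when
    the coefficients are integrated by parts. *)
Definition weighted_smooth rho g := smooth g /\ forall b p,
  exists2 C, 0 <= C & forall x, derive1n b g x ^+ 2 * (1 + x ^+ 2) ^+ p <= C * rho x.

Lemma weighted_smooth_weight rho : schwartz_mon_pos rho -> weighted_smooth rho rho.
Proof. by move=> H; split; [case: H => -[]|exact: weight_derivative_bound]. Qed.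

Lemma weighted_smooth0 rho : (forall x, 0 < rho x) -> weighted_smooth rho (fun=> 0).
Proof.
move=> r0; split; first exact: smooth_cst.
move=> b p; exists 0 => // x; rewrite mul0r.
have -> : derive1n b (fun=> 0) x = 0 :> R; last by rewrite expr0n mul0r.
elim: b x => [//|b IH] x; rewrite derive1Sn (_ : derive1 _ = fun=> 0) ?IH//.
by apply/derive1_is_derive => y; exact: is_derive_const.
Qed.

Lemma weighted_smoothD rho f g : weighted_smooth rho f -> weighted_smooth rho g ->
  weighted_smooth rho (fun x => f x + g x).
Proof.
move=> [sf bf] [sg bg]; split; first exact: smoothD.
move=> b p; have [C C0 HC] := bf b p; have [C' C'0 HC'] := bg b p.
exists (2 * C + 2 * C'); first by rewrite addr_ge0 ?mulr_ge0.
move=> x; rewrite derive1nD//; have := HC x; have := HC' x.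
have : 0 <= (1 + x ^+ 2) ^+ p by rewrite exprn_ge0// addr_ge0// sqr_ge0.
move: ((1 + x ^+ 2) ^+ p) (derive1n b f x) (derive1n b g x) => P F G P0 H1 H2.
have : 0 <= (F - G) ^+ 2 * P by rewrite mulr_ge0// sqr_ge0.
rewrite !mulrDl; nra.
Qed.

Lemma weighted_smoothZ rho (k : R) f : weighted_smooth rho f ->
  weighted_smooth rho (fun x => k * f x).
Proof.
move=> [sf bf]; split; first by apply: smoothM; [exact: smooth_cst|exact: sf].
move=> b p; have [C C0 HC] := bf b p.
exists (k ^+ 2 * C); first by rewrite mulr_ge0// sqr_ge0.
by move=> x; rewrite derive1nZ// exprMn -(mulrA (k ^+ 2)) -(mulrA (k ^+ 2)) ler_wpM2l ?sqr_ge0.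
Qed.

Lemma weighted_smooth_derive1 rho f : weighted_smooth rho f ->
  weighted_smooth rho (derive1 f).
Proof.
move=> [sf bf]; split; first exact: smooth_derive1.
by move=> b p; rewrite -derive1Sn; exact: bf.
Qed.

(** Since (x f)' = x f' + f, an induction on the order of derivation reduces to
    the function x f itself, where a factor x^2 is absorbed by one more power of
    1 + x^2. *)
Lemma weighted_smoothX rho f : (forall x, 0 < rho x) -> weighted_smooth rho f ->
  weighted_smooth rho (fun x => x * f x).
Proof.
move=> r0 wf; split; first by apply: smoothM; [exact: smooth_id|case: wf].
move=> b; elim: b f wf => [|b IH] f wf p.
  have [C C0 HC] := wf.2 0%N p.+1; exists C => // x.
  apply: le_trans (HC x); rewrite /= exprMn (exprS (1 + x ^+ 2) p) mulrA ler_wpM2r//.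
    by rewrite exprn_ge0// addr_ge0// sqr_ge0.
  by rewrite mulrC ler_wpM2l ?sqr_ge0// lerDr.
have sf := wf.1; have sid : smooth (fun x : R => x) by exact: smooth_id.
have E : derive1n b.+1 (fun x => x * f x) =
    fun x => derive1n b (fun x => x * derive1 f x) x + derive1n b f x.
  rewrite derive1Sn (derive1_mul sid sf).
  rewrite (_ : derive1 (fun x => x) = fun=> 1); last first.
    by apply: derive1_is_derive => x; exact: is_derive_idr.
  under eq_fun do rewrite mulr1.
  apply: derive1nD; last exact: sf.
  by apply: smoothM; [exact: sid|exact: smooth_derive1].
have [C C0 HC] := IH _ (weighted_smooth_derive1 wf) p.
have [C' C'0 HC'] := wf.2 b p.
exists (2 * C + 2 * C'); first by rewrite addr_ge0 ?mulr_ge0.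
move=> x; rewrite E; have := HC x; have := HC' x.
have : 0 <= (1 + x ^+ 2) ^+ p by rewrite exprn_ge0// addr_ge0// sqr_ge0.
move: ((1 + x ^+ 2) ^+ p) (derive1n b (fun x => x * _) x) (derive1n b f x) => P F G P0 H1 H2.
have : 0 <= (F - G) ^+ 2 * P by rewrite mulr_ge0// sqr_ge0.
rewrite !mulrDl; nra.
Qed.

End schwartz_weights.

(** * The angular variable on the line *)

Section phase.
Context {R : realType}.
Local Notation mu := (@lebesgue_measure R).

(** Monotone convergence along the intervals [-n, n + 1], whose integrals are
    differences of values of the bounded primitive. *)
Lemma integrableR_bounded_primitive (f F : R -> R) (B : R) : continuous f ->
  (forall x, 0 <= f x) -> (forall x : R, is_derive x 1 F (f x)) ->
  (forall x, `|F x| <= B) -> integrableR f.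
Proof.
move=> cf f0 dF HB.
have mf : measurable_real f by exact: continuous_measurable_real.
pose E (n : nat) : set R := `[- n%:R, n.+1%:R]%classic.
have cov : \bigcup_n E n = setT.
  apply/seteqP; split=> // x _.
  pose n := (Num.truncn `|x|).+1.
  have xn : `|x| < n%:R by exact: truncnS_gt.
  exists n => //; rewrite /E /= in_itv/=; move: xn; rewrite ltr_norml => /andP[/ltW -> /ltW xn].
  by rewrite (le_trans xn)// ler_nat.
have Eint n : (\int[mu]_(x in E n) (f x)%:E = (F n.+1%:R - F (- n%:R))%:E)%E.
  have nn : - n%:R < n.+1%:R :> R by rewrite (le_lt_trans (y := 0)) ?oppr_le0.
  have cF : continuous F by move=> x; exact: is_derive_continuous (dF x).
  rewrite (@continuous_FTC2 _ f F _ _ nn)//.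
  - exact: continuous_subspaceT.
  - split.
    + by move=> x _; exact: is_derive_derivable (dF x).
    + exact: (cvg_at_right_filter (cF _)).
    + exact: (cvg_at_left_filter (cF _)).
  - by move=> x _; exact: is_derive_derive1.
have := @ge0_nondecreasing_set_cvg_integral _ (measurableTypeR R) R E (EFin \o f) mu.
move=> /(_ _ _ _ _) H.
have {}H : (\int[mu]_(x in E n) (f x)%:E)%E @[n --> \oo] --> (\int[mu]_x (f x)%:E)%E.
  rewrite -cov; apply: H => //.
  - move=> m n mn; apply/subsetPset => x; rewrite /E /= !in_itv/= => /andP[mx xm].
    rewrite (le_trans _ mx) ?lerN2 ?ler_nat//=.
    by rewrite (le_trans xm)// ler_nat.
  - by move=> n; exact: measurable_itv.
  - by move=> n; apply/measurable_EFinP; exact: measurable_funTS.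
  - by move=> n x _; rewrite /= lee_fin.
apply/integrableP; split; first exact/measurable_EFinP.
under eq_integral => x _ do rewrite /= ger0_norm//.
apply: (@le_lt_trans _ _ (B + B)%:E); last exact: ltry.
apply: (cvge_le _ H); apply: nearW => n; rewrite Eint lee_fin.
by rewrite (le_trans (ler_norm _))// (le_trans (ler_normB _ _))// lerD.
Qed.

Variable c : R.
Hypothesis c0 : 0 < c.

(** The derivative of the inverse Moebius map, hence the density on the line of
    the angle on (0, 2 pi). *)
Definition density (x : R) : R := 2 * c / (x ^+ 2 + c ^+ 2).
(** The inverse of the Moebius map, since - cot (t / 2) = tan ((t - pi) / 2). *)
Definition phase (x : R) : R := pi + 2 * atan (x / c).

Lemma density_den_gt0 x : 0 < x ^+ 2 + c ^+ 2.
Proof. by rewrite ltr_wpDl ?sqr_ge0// exprn_gt0. Qed.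

Lemma density_gt0 x : 0 < density x.
Proof. by rewrite divr_gt0 ?density_den_gt0// mulr_gt0. Qed.

Lemma is_derive_phase (x : R) : is_derive x 1 phase (density x).
Proof.
have h : is_derive x 1 (fun y => y / c) (c^-1).
  by have := is_derive_mul (is_derive_idr x) (is_derive_const c^-1 x); rewrite mulr0 add0r mulr1.
have h1 := @is_derive_compr _ atan (fun y => y / c) _ _ _ (is_derive1_atan _) h.
apply: is_derive_eq (is_derive_add (is_derive_const pi x) (is_derive_scale 2 h1)) _.
rewrite /density; field.
rewrite !gt_eqF//= ?density_den_gt0//.
Qed.

Lemma continuous_phase : continuous phase.
Proof. by move=> x; exact: is_derive_continuous (is_derive_phase x). Qed.

Lemma smooth_density : smooth density.
Proof.
have d (x : R) : is_derive x 1 density ((- c^-1) * (x * (density x * density x))).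
  have h : is_derive x 1 (fun y => y ^+ 2 + c ^+ 2) (x + x).
    have := is_derive_add (is_derive_mul (is_derive_idr x) (is_derive_idr x)) (is_derive_const (c ^+ 2) x).
    by rewrite mulr1 addr0.
  have n0 : x ^+ 2 + c ^+ 2 != 0 by rewrite gt_eqF// density_den_gt0.
  apply: is_derive_eq (is_derive_scale (2 * c) (@is_derive_invr _ (fun y => y ^+ 2 + c ^+ 2) x _ n0 h)) _.
  by rewrite /density; field; rewrite n0 gt_eqF.
apply/smoothP => n; elim: n => [|n IH].
  by split=> [x|//]; exact: is_derive_derivable (d x).
apply: ndiff_ext d _; apply: ndiffM; first exact: ndiff_cst.
apply: ndiffM; first exact: ndiff_id.
exact: ndiffM.
Qed.

Lemma continuous_density : continuous density.
Proof. exact/smooth_continuous/smooth_density. Qed.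

Lemma phase_gt0 x : 0 < phase x.
Proof. by rewrite /phase; have := atan_gtNpi2 (x / c); lra. Qed.

Lemma phase_lt2pi x : phase x < 2 * pi.
Proof. by rewrite /phase; have := atan_ltpi2 (x / c); lra. Qed.

Lemma phase_cvgy : phase n%:R @[n --> \oo] --> 2 * pi.
Proof.
have -> : 2 * pi = pi + 2 * (pi / 2) :> R by field.
apply: cvgD; first exact: cvg_cst.
apply: cvgM; first exact: cvg_cst.
have H : n%:R / c @[n --> \oo] --> +oo; last first.
  exact: (cvg_comp _ _ H (@cvgy_atan R)).
apply/cvgryPge => A; near=> n; rewrite ler_pdivlMr//.
by near: n; exact: nbhs_infty_ger.
Unshelve. all: by end_near. Qed.

Lemma phaseN x : phase (- x) = 2 * pi - phase x.
Proof. by rewrite /phase mulNr atanN; ring. Qed.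

Lemma phase_cvgNy : phase (- n%:R) @[n --> \oo] --> 0.
Proof.
under eq_fun do rewrite phaseN.
rewrite -(subrr (2 * pi)); apply: cvgB; first exact: cvg_cst.
exact: phase_cvgy.
Qed.

Lemma integrableR_density : integrableR density.
Proof.
apply: (@integrableR_bounded_primitive density phase (2 * pi)).
- exact: continuous_density.
- by move=> x; rewrite ltW// density_gt0.
- exact: is_derive_phase.
- move=> x; rewrite ger0_norm ?(ltW (phase_gt0 x))//.
  by rewrite ltW// phase_lt2pi.
Qed.

Lemma intR_density : intR density = 2 * pi.
Proof.
have := intR_FTC_line continuous_density integrableR_density is_derive_phase
  phase_cvgNy phase_cvgy.
by rewrite subr0.
Qed.

Lemma intR_density_ray y : intR (fun x => \1_`]-oo, y] x * density x) = phase y.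
Proof.
have := intR_FTC_ray y continuous_density integrableR_density is_derive_phase phase_cvgNy.
by rewrite subr0.
Qed.

Let kphase k (x : R) : is_derive x 1 (fun y => k.+1%:R * phase y) (k.+1%:R * density x).
Proof. exact: (is_derive_scale _ (is_derive_phase x)). Qed.

Let dcos k (x : R) : is_derive x 1 (fun y => - cos (k.+1%:R * phase y) / k.+1%:R)
  (sin (k.+1%:R * phase x) * density x).
Proof.
have h := @is_derive_compr _ cos (fun y => k.+1%:R * phase y) _ _ _ (is_derive_cos _) (kphase k x).
apply: is_derive_eq (is_derive_mul (is_derive_neg h) (is_derive_const k.+1%:R^-1 x)) _.
have : k.+1%:R != 0 :> R by rewrite pnatr_eq0.
by move=> k0; field.
Qed.

Let dsin k (x : R) : is_derive x 1 (fun y => sin (k.+1%:R * phase y) / k.+1%:R)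
  (cos (k.+1%:R * phase x) * density x).
Proof.
have h := @is_derive_compr _ sin (fun y => k.+1%:R * phase y) _ _ _ (is_derive_sin _) (kphase k x).
apply: is_derive_eq (is_derive_mul h (is_derive_const k.+1%:R^-1 x)) _.
have : k.+1%:R != 0 :> R by rewrite pnatr_eq0.
by move=> k0; field.
Qed.

Let cont_cos k : continuous (fun x => cos (k.+1%:R * phase x)).
Proof.
move=> x; exact: is_derive_continuous
  (@is_derive_compr _ cos (fun y => k.+1%:R * phase y) _ _ _ (is_derive_cos _) (kphase k x)).
Qed.

Let cont_sin k : continuous (fun x => sin (k.+1%:R * phase x)).
Proof.
move=> x; exact: is_derive_continuous
  (@is_derive_compr _ sin (fun y => k.+1%:R * phase y) _ _ _ (is_derive_sin _) (kphase k x)).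
Qed.

Let ccos k : continuous (fun x => cos (k.+1%:R * phase x) * density x).
Proof. by move=> x; apply: cvgM; [exact: cont_cos|exact: continuous_density]. Qed.

Let csin k : continuous (fun x => sin (k.+1%:R * phase x) * density x).
Proof. by move=> x; apply: cvgM; [exact: cont_sin|exact: continuous_density]. Qed.

Let icos k : integrableR (fun x => cos (k.+1%:R * phase x) * density x).
Proof.
apply: integrableR_bounded integrableR_density; first exact: continuous_measurable_real.
by exists 1 => x; rewrite ler_norml cos_geN1 cos_le1.
Qed.

Let isin k : integrableR (fun x => sin (k.+1%:R * phase x) * density x).
Proof.
apply: integrableR_bounded integrableR_density; first exact: continuous_measurable_real.
by exists 1 => x; rewrite ler_norml sin_geN1 sin_le1.
Qed.

Let lim_cos k (u : nat -> R) (l : R) : phase (u n) @[n --> \oo] --> l ->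
  - cos (k.+1%:R * phase (u n)) / k.+1%:R @[n --> \oo] --> - cos (k.+1%:R * l) / k.+1%:R.
Proof.
move=> H; apply: cvgM; last exact: cvg_cst.
apply: cvgN; apply: (cvg_comp (fun n => k.+1%:R * phase (u n)) cos); last exact: continuous_cos.
by apply: cvgM => //; exact: cvg_cst.
Qed.

Let lim_sin k (u : nat -> R) (l : R) : phase (u n) @[n --> \oo] --> l ->
  sin (k.+1%:R * phase (u n)) / k.+1%:R @[n --> \oo] --> sin (k.+1%:R * l) / k.+1%:R.
Proof.
move=> H; apply: cvgM; last exact: cvg_cst.
apply: (cvg_comp (fun n => k.+1%:R * phase (u n)) sin); last exact: continuous_sin.
by apply: cvgM => //; exact: cvg_cst.
Qed.

(** The integrand is an exact derivative, and the phase runs through a full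
    period of the circle. *)
Lemma intR_cos_phase k : intR (fun x => cos (k.+1%:R * phase x) * density x) = 0.
Proof.
rewrite (intR_FTC_line (@ccos k) (@icos k) (@dsin k)
  (@lim_sin k (fun n => - n%:R) 0 phase_cvgNy) (@lim_sin k (fun n => n%:R) (2 * pi) phase_cvgy)).
by rewrite mulr0 sin0 -(add0r (k.+1%:R * _)) sin_add_2npi sin0 mul0r subrr.
Qed.

Lemma intR_sin_phase k : intR (fun x => sin (k.+1%:R * phase x) * density x) = 0.
Proof.
rewrite (intR_FTC_line (@csin k) (@isin k) (@dcos k)
  (@lim_cos k (fun n => - n%:R) 0 phase_cvgNy) (@lim_cos k (fun n => n%:R) (2 * pi) phase_cvgy)).
by rewrite mulr0 cos0 -(add0r (k.+1%:R * _)) cos_add_2npi cos0 subrr.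
Qed.

Lemma intR_cos_phase_ray k y :
  intR (fun x => \1_`]-oo, y] x * (cos (k.+1%:R * phase x) * density x)) =
  sin (k.+1%:R * phase y) / k.+1%:R.
Proof.
rewrite (intR_FTC_ray y (@ccos k) (@icos k) (@dsin k) (@lim_sin k (fun n => - n%:R) 0 phase_cvgNy)).
by rewrite mulr0 sin0 mul0r subr0.
Qed.

Lemma intR_sin_phase_ray k y :
  intR (fun x => \1_`]-oo, y] x * (sin (k.+1%:R * phase x) * density x)) =
  (1 - cos (k.+1%:R * phase y)) / k.+1%:R.
Proof.
rewrite (intR_FTC_ray y (@csin k) (@isin k) (@dcos k) (@lim_cos k (fun n => - n%:R) 0 phase_cvgNy)).
by rewrite mulr0 cos0 mulN1r opprK mulNr addrC -[X in X - _]mul1r -mulrBl.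
Qed.

End phase.

(** * Weak derivatives in weighted spaces *)

Section weak_derivatives.
Context {R : realType}.
Implicit Types (u v g psi : R -> R).

(** Weak differentiability of order one; a chain of such pairs describes the
    successive weak derivatives of one function. *)
Definition weak_derivative_pair u v := forall psi, test_function psi ->
  intR (fun x => u x * derive1 psi x) = - intR (fun x => v x * psi x).

Lemma test_function_derive1 psi : test_function psi -> test_function (derive1 psi).
Proof.
move=> [spsi cpsi]; split; first exact: smooth_derive1.
apply: (subclosed_compact _ cpsi); first exact: closed_closure.
have /closure_id -> := @closed_closure _ [set x | psi x != 0].
apply: closure_subset => x /=; apply: contraNP => Hx.
have oC : open (~` closure [set x | psi x != 0]) by rewrite openC; exact: closed_closure.
apply/eqP; apply: is_derive_derive1; apply: (@near_eq_is_derive _ _ _ (fun=> 0)).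
have : nbhs x (~` closure [set x | psi x != 0]) by apply: open_nbhs_nbhs; split.
apply: filterS => y Hy; apply/esym/eqP; apply: contra_notT Hy => py.
exact: subset_closure.
Qed.

Variable rho : R -> R.
Hypothesis srho : smooth rho.
Hypothesis rho0 : forall x, 0 < rho x.

Definition weighted_L2 u := measurable_real u /\ integrableR (fun x => u x ^+ 2 * rho x).

Lemma integrableR_cauchy : integrableR (fun x : R => (1 + x ^+ 2)^-1).
Proof.
have := integrableRZ 2^-1 (integrableR_density (@ltr01 R)).
by under eq_fun => x do rewrite /density mulr1 expr1n mulrA mulVf// mul1r addrC.
Qed.

(** Young's inequality, splitting y z = (y s^(1/2)) (z s^(-1/2)). *)
Lemma weighted_product_bound (C y s x z : R) : 0 < s ->
  z ^+ 2 * (1 + x ^+ 2) <= C * s ->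
  `|y * z| <= 2^-1 * (y ^+ 2 * s) + 2^-1 * (C * (1 + x ^+ 2)^-1).
Proof.
move=> s0 H.
have p0 : 0 < 1 + x ^+ 2 by rewrite ltr_wpDr// sqr_ge0.
have {}H : z ^+ 2 / s <= C * (1 + x ^+ 2)^-1.
  by rewrite ler_pdivrMr// mulrAC ler_pdivlMr.
apply: (@le_trans _ _ (2^-1 * (y ^+ 2 * s) + 2^-1 * (z ^+ 2 / s))); last first.
  by rewrite lerD2l ler_pM2l.
rewrite -mulrDr ler_pdivlMl// normrM -(ler_pM2r s0) -subr_ge0.
have -> : (y ^+ 2 * s + z ^+ 2 / s) * s - 2 * (`|y| * `|z|) * s =
    (`|y| * s - `|z|) ^+ 2.
  rewrite -[y ^+ 2]real_normK ?num_real// -[z ^+ 2]real_normK ?num_real//.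
  by field; rewrite gt_eqF.
exact: sqr_ge0.
Qed.

Lemma integrableR_weighted_product u g (C : R) : weighted_L2 u -> measurable_real g ->
  (forall x, g x ^+ 2 * (1 + x ^+ 2) <= C * rho x) -> integrableR (fun x => u x * g x).
Proof.
move=> [mu iu] mg Hg.
apply: (@integrableR_le _ _ (fun x => 2^-1 * (u x ^+ 2 * rho x) + 2^-1 * (C * (1 + x ^+ 2)^-1))).
- exact: measurable_funM.
- by apply: integrableRD; apply: integrableRZ => //; apply: integrableRZ; exact: integrableR_cauchy.
- by move=> x; exact: weighted_product_bound.
Qed.

(** Weak derivatives are tested against compactly supported functions only;
    multiplying g by the cutoffs and letting them grow removes the restriction,
    because u g, u g' and v g are integrable and the derivatives of the cutoffs
    vanish uniformly. *)
Lemma weak_integration_by_parts u v g (C : R) : weak_derivative_pair u v ->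
  weighted_L2 u -> weighted_L2 v -> smooth g ->
  (forall x, g x ^+ 2 * (1 + x ^+ 2) <= C * rho x) ->
  (forall x, derive1 g x ^+ 2 * (1 + x ^+ 2) <= C * rho x) ->
  intR (fun x => u x * derive1 g x) = - intR (fun x => v x * g x).
Proof.
move=> wuv Lu Lv sg Hg Hg'.
have mg : measurable_real g by apply: continuous_measurable_real; exact: smooth_continuous.
have mg' : measurable_real (derive1 g).
  by apply: continuous_measurable_real; apply: smooth_continuous; exact: smooth_derive1.
have iug : integrableR (fun x => u x * g x) by exact: integrableR_weighted_product Hg.
have iug' : integrableR (fun x => u x * derive1 g x) by exact: integrableR_weighted_product Hg'.
have ivg : integrableR (fun x => v x * g x) by exact: integrableR_weighted_product Hg.
have mc n : measurable_real (@cutoff R n).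
  by apply: continuous_measurable_real; apply: smooth_continuous; exact: smooth_cutoff.
have mc' n : measurable_real (derive1 (@cutoff R n)).
  by apply: continuous_measurable_real; apply: smooth_continuous; apply: smooth_derive1; exact: smooth_cutoff.
have [B B0 HB] := @cutoff_bounded R.
have [B' B'0 HB'] := @derive1_cutoff_bounded R.
(* The weak derivative identity for the test function cutoff n times g. *)
have E n : intR (fun x => cutoff n x * (u x * derive1 g x) + derive1 (cutoff n) x * (u x * g x)) =
    - intR (fun x => cutoff n x * (v x * g x)).
  have := wuv _ (test_function_cutoff n sg).
  rewrite (derive1_mul (@smooth_cutoff R n) sg) => H.
  transitivity (intR (fun x => u x * (cutoff n x * derive1 g x + g x * derive1 (cutoff n) x))).
    by congr intR; apply/funext => x; ring.
  by rewrite H; congr (- intR _); apply/funext => x; ring.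
have L1 : intR (fun x => cutoff n x * (u x * derive1 g x) + derive1 (cutoff n) x * (u x * g x))
    @[n --> \oo] --> intR (fun x => u x * derive1 g x).
  apply: (intR_dominated (g := fun x => B * `|u x * derive1 g x| + B' * `|u x * g x|) _ _ _ _).2.
  - move=> n; apply: measurable_funD; apply: measurable_funM.
    + exact: mc.
    + exact: integrableR_measurable iug'.
    + exact: mc'.
    + exact: integrableR_measurable iug.
  - by apply: integrableRD; apply: integrableRZ; exact: integrableR_norm.
  - move=> n x; apply: le_trans (ler_normD _ _) _; apply: lerD.
      by rewrite normrM ler_wpM2r.
    rewrite normrM ler_wpM2r//; apply: (le_trans (HB' n x)).
    by rewrite ler_pdivrMr// ler_peMr// ler1n.
  - move=> x; rewrite -[X in _ --> X]addr0; apply: cvgD.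
      rewrite -[X in _ --> X]mul1r; apply: cvgM; last exact: cvg_cst.
      exact: cutoff_cvg.
    rewrite -(mul0r (u x * g x)); apply: cvgM; last exact: cvg_cst.
    apply/norm_cvg0P; apply: (@squeeze_cvgr _ _ _ _ (fun=> 0) (fun n => B' / n.+1%:R)).
    + by apply: nearW => n; rewrite normr_ge0 HB'.
    + exact: cvg_cst.
    + rewrite -(mulr0 B'); apply: cvgM; first exact: cvg_cst.
      exact: cvg_harmonic.
have L2 : - intR (fun x => cutoff n x * (v x * g x)) @[n --> \oo] --> - intR (fun x => v x * g x).
  apply: cvgN; apply: (intR_dominated (g := fun x => B * `|v x * g x|) _ _ _ _).2.
  - by move=> n; apply: measurable_funM; [exact: mc|exact: integrableR_measurable ivg].
  - by apply: integrableRZ; exact: integrableR_norm.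
  - by move=> n x; rewrite normrM ler_wpM2r.
  - move=> x; rewrite -[X in _ --> X]mul1r; apply: cvgM; last exact: cvg_cst.
    exact: cutoff_cvg.
have L3 : intR (fun x => cutoff n x * (u x * derive1 g x) + derive1 (cutoff n) x * (u x * g x))
    @[n --> \oo] --> - intR (fun x => v x * g x).
  by apply: cvg_near_eq L2; exact: nearW.
by apply: (cvg_unique _ L1 L3); exact: norm_hausdorff.
Qed.

End weak_derivatives.

(** * Decay of the Fourier coefficients *)

Section coefficients.
Context {R : realType}.
Variables (c : R) (rho : R -> R).
Hypothesis c0 : 0 < c.
Hypothesis hrho : schwartz_mon_pos rho.
Implicit Types (H u : R -> R) (g : nat -> R -> R) (U : nat -> R -> R) (k N : nat).

Let rho0 : forall x, 0 < rho x. Proof. by case: hrho. Qed.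
Let srho : smooth rho. Proof. by case: hrho => -[]. Qed.

Let th := phase c.
Let w := density c.

(** Up to the factor pi these are the Fourier coefficients of H / density, as a
    function of the angle. *)
Definition cos_coef H k := intR (fun x => H x * cos (k%:R * th x)).
Definition sin_coef H k := intR (fun x => H x * sin (k%:R * th x)).

Let mth : measurable_real th. Proof. by apply: continuous_measurable_real; exact: continuous_phase. Qed.

Let dcos (k : nat) (x : R) : is_derive x 1 (fun y => cos (k%:R * th y))
  (- (k%:R * (w x * sin (k%:R * th x)))).
Proof.
have h := @is_derive_compr _ cos (fun y => k%:R * th y) _ _ _ (is_derive_cos _)
  (is_derive_scale k%:R (is_derive_phase c0 x)).
by apply: is_derive_eq h _; rewrite /w; ring.
Qed.

Let dsin (k : nat) (x : R) : is_derive x 1 (fun y => sin (k%:R * th y))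
  (k%:R * (w x * cos (k%:R * th x))).
Proof.
have h := @is_derive_compr _ sin (fun y => k%:R * th y) _ _ _ (is_derive_sin _)
  (is_derive_scale k%:R (is_derive_phase c0 x)).
by apply: is_derive_eq h _; rewrite /w; ring.
Qed.

Let smooth_cos_sin k : smooth (fun y => cos (k%:R * th y)) /\
  smooth (fun y => sin (k%:R * th y)).
Proof.
have sw : smooth w by exact: smooth_density.
suff H n : ndiff n (fun y => cos (k%:R * th y)) /\ ndiff n (fun y => sin (k%:R * th y)).
  by split; apply/smoothP => n; case: (H n).
elim: n => [|n [IHc IHs]].
  by split; split=> [x|//]; [exact: is_derive_derivable (dcos k x)|exact: is_derive_derivable (dsin k x)].
have nw : ndiff n w by move/smoothP : sw; exact.
split.
- apply: (@ndiff_ext _ _ _ (fun x => (- k%:R) * (w x * sin (k%:R * th x)))).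
    by move=> x; apply: is_derive_eq (dcos k x) _; rewrite mulNr.
  by apply: ndiffM; [exact: ndiff_cst|exact: ndiffM].
- apply: (@ndiff_ext _ _ _ (fun x => k%:R * (w x * cos (k%:R * th x)))).
    exact: dsin.
  by apply: ndiffM; [exact: ndiff_cst|exact: ndiffM].
Qed.

Lemma cos_sqr_le1 (t : R) : cos t ^+ 2 <= 1.
Proof. by have := cos2Dsin2 t; have := sqr_ge0 (sin t); lra. Qed.

Lemma sin_sqr_le1 (t : R) : sin t ^+ 2 <= 1.
Proof. by have := cos2Dsin2 t; have := sqr_ge0 (cos t); lra. Qed.

Let sqr_sum_le (a b : R) : (a + b) ^+ 2 <= 2 * a ^+ 2 + 2 * b ^+ 2.
Proof. by have := sqr_ge0 (a - b); rewrite sqrrB sqrrD; lra. Qed.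

Lemma density_le x : w x <= 2 / c.
Proof.
rewrite /w /density ler_pdivrMr ?density_den_gt0// mulrAC ler_pdivlMr//.
by have := sqr_ge0 x; nra.
Qed.

(** The pair (e, e') stands for (sin, cos) or (cos, - sin) of k times the phase,
    so that one proof serves both kinds of coefficients. *)
Lemma phase_integration_by_parts u v f e (k : nat) (e' : R -> R) :
  weak_derivative_pair u v -> weighted_L2 rho u -> weighted_L2 rho v ->
  weighted_smooth rho f -> smooth e ->
  (forall x : R, is_derive x 1 e (k%:R * (w x * e' x))) ->
  (forall x, e x ^+ 2 <= 1) -> (forall x, e' x ^+ 2 <= 1) -> measurable_real e' ->
  k%:R * intR (fun x => u x * (f x * w x) * e' x) =
  - (intR (fun x => v x * f x * e x) + intR (fun x => u x * derive1 f x * e x)).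
Proof.
move=> wuv Lu Lv wf se de e1 e'1 me'.
have [sf bf] := wf.
have [C1 C10 HC1] := bf 0%N 1%N.
have [C2 C20 HC2] := bf 1%N 1%N.
have mf : measurable_real f by apply: continuous_measurable_real; exact: smooth_continuous.
have me : measurable_real e by apply: continuous_measurable_real; exact: smooth_continuous.
have mf' : measurable_real (derive1 f).
  by apply: continuous_measurable_real; apply: smooth_continuous; exact: smooth_derive1.
have mw : measurable_real w by apply: continuous_measurable_real; exact: continuous_density.
have q0 x : 0 <= 1 + x ^+ 2 :> R by rewrite addr_ge0// sqr_ge0.
have be h (C : R) (b : R -> R) : (forall x, b x ^+ 2 <= 1) ->
    (forall x, h x ^+ 2 * (1 + x ^+ 2) <= C * rho x) ->
    forall x, (h x * b x) ^+ 2 * (1 + x ^+ 2) <= C * rho x.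
  move=> b1 Hh x; apply: le_trans (Hh x); rewrite ler_wpM2r//.
  by rewrite exprMn ler_piMr// sqr_ge0.
have B1 x : f x ^+ 2 * (1 + x ^+ 2) <= C1 * rho x by have := HC1 x; rewrite expr1.
have B2 x : derive1 f x ^+ 2 * (1 + x ^+ 2) <= C2 * rho x by have := HC2 x; rewrite expr1.
pose D := (2 / c) ^+ 2 * C1.
have B3 x : (f x * w x) ^+ 2 * (1 + x ^+ 2) <= D * rho x.
  have w2 : w x ^+ 2 <= (2 / c) ^+ 2.
    by rewrite ler_sqr ?nnegrE ?density_le ?(ltW (density_gt0 c0 x)) ?(ltW (divr_gt0 _ c0)).
  rewrite exprMn mulrAC mulrC /D -mulrA; apply: ler_pM => //; first exact: sqr_ge0.
  by rewrite mulr_ge0// sqr_ge0.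
have I1 : integrableR (fun x => v x * f x * e x).
  under eq_fun do rewrite -mulrA.
  by apply: (integrableR_weighted_product rho0 Lv _ (be _ _ _ e1 B1)); exact: measurable_funM.
have I2 : integrableR (fun x => u x * derive1 f x * e x).
  under eq_fun do rewrite -mulrA.
  by apply: (integrableR_weighted_product rho0 Lu _ (be _ _ _ e1 B2)); exact: measurable_funM.
have I3 : integrableR (fun x => u x * (f x * w x) * e' x).
  under eq_fun do rewrite -mulrA.
  apply: (integrableR_weighted_product rho0 Lu _ (be _ _ _ e'1 B3)).
  by apply: measurable_funM => //; exact: measurable_funM.
have dfe (x : R) : is_derive x 1 (fun y => f y * e y)
    (k%:R * (f x * w x * e' x) + derive1 f x * e x).
  by apply: is_derive_eq (is_derive_mul (smooth_is_derive sf x) (de x)) _; ring.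
(* One constant must serve both f e and its derivative. *)
pose K := C1 + (2 * k%:R ^+ 2 * D + 2 * C2).
have D0 : 0 <= D by rewrite mulr_ge0// sqr_ge0.
have k0 : 0 <= 2 * k%:R ^+ 2 * D by have kk : 0 <= k%:R ^+ 2 :> R := sqr_ge0 _; rewrite mulr_ge0// mulr_ge0.
have P1 x : (f x * e x) ^+ 2 * (1 + x ^+ 2) <= K * rho x.
  apply: le_trans (be _ _ _ e1 B1 x) _; rewrite ler_wpM2r ?(ltW (rho0 x))//.
  by rewrite lerDl addr_ge0// mulr_ge0.
have P2 x : derive1 (fun y => f y * e y) x ^+ 2 * (1 + x ^+ 2) <= K * rho x.
  rewrite (derive1_is_derive dfe).
  apply: (@le_trans _ _ ((2 * k%:R ^+ 2 * D + 2 * C2) * rho x)); last first.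
    by rewrite ler_wpM2r ?(ltW (rho0 x))// lerDr.
  have := be _ _ _ e'1 B3 x; have := be _ _ _ e1 B2 x.
  have := sqr_sum_le (k%:R * (f x * w x * e' x)) (derive1 f x * e x).
  move=> /(ler_wpM2r (q0 x)) H1 H2 H3; apply: le_trans H1 _.
  have kk : 0 <= k%:R ^+ 2 :> R by exact: sqr_ge0.
  have := ler_wpM2l kk H3; rewrite !exprMn.
  move: H2; rewrite !exprMn => H2 H4.
  rewrite mulrDl mulrDl; lra.
have := weak_integration_by_parts rho0 wuv Lu Lv (smoothM sf se) P1 P2.
rewrite (derive1_is_derive dfe).
have -> : (fun x => u x * (k%:R * (f x * w x * e' x) + derive1 f x * e x)) =
    (fun x => k%:R * (u x * (f x * w x) * e' x) + u x * derive1 f x * e x).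
  by apply/funext => x; ring.
rewrite (intRD (integrableRZ _ I3) I2) (intRZ _ I3).
under [X in _ = - intR X -> _]eq_fun do rewrite mulrA.
by move=> E; rewrite opprD -E addrK.
Qed.

(** The reciprocal of the density, in polynomial form. *)
Definition quot_density (x : R) := (x ^+ 2 + c ^+ 2) / (2 * c).

Lemma quot_densityK (y x : R) : quot_density x * y * w x = y.
Proof.
rewrite /quot_density /w /density; field.
by rewrite !gt_eqF//= ?density_den_gt0.
Qed.

Lemma weighted_smooth_quot f : weighted_smooth rho f ->
  weighted_smooth rho (fun x => quot_density x * f x).
Proof.
move=> wf.
have -> : (fun x => quot_density x * f x) = fun x =>
    (2 * c)^-1 * (x * (x * f x)) + (c ^+ 2 / (2 * c)) * f x.
  by apply/funext => x; rewrite /quot_density; field; rewrite gt_eqF.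
apply: weighted_smoothD; apply: weighted_smoothZ; last exact: wf.
apply: weighted_smoothX; first exact: rho0.
by apply: weighted_smoothX; [exact: rho0|exact: wf].
Qed.

(** Integrating sum_t u_t g_t by parts once moves g_t / density to the next weak
    derivative u_(t+1) and differentiates it at u_t. *)
Definition coef_step g (t : nat) (x : R) : R :=
  (if t is s.+1 then quot_density x * g s x else 0) +
  derive1 (fun y => quot_density y * g t y) x.

Definition coef_seq (j : nat) : nat -> R -> R :=
  iter j coef_step (fun t => if t == 0%N then rho else fun=> 0).

Lemma weighted_smooth_coef_seq j t : weighted_smooth rho (coef_seq j t).
Proof.
elim: j t => [|j IH] t /=.
  by case: eqP => _; [exact: weighted_smooth_weight|exact: weighted_smooth0].
apply: weighted_smoothD; last exact/weighted_smooth_derive1/weighted_smooth_quot.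
by case: t => [|t]; [exact: weighted_smooth0|exact: weighted_smooth_quot].
Qed.

Lemma coef_seq0 j t : (j < t)%N -> coef_seq j t = fun=> 0.
Proof.
elim: j t => [|j IH] t jt; first by rewrite /= gtn_eqF.
apply/funext => x; case: t jt => [//|t] jt; rewrite /= /coef_step -/(coef_seq j).
rewrite IH// IH ?(ltnW jt)// mulr0 add0r.
under eq_fun do rewrite mulr0.
by apply: is_derive_derive1; exact: is_derive_const.
Qed.

Definition leibniz_sum U g N (x : R) := \sum_(t < N) U t x * g t x.

Lemma integrableR_leibniz_term u (g e : R -> R) : weighted_L2 rho u -> weighted_smooth rho g ->
  measurable_real e -> (forall x, e x ^+ 2 <= 1) -> integrableR (fun x => u x * g x * e x).
Proof.
move=> Lu [sg bg] me e1; under eq_fun do rewrite mulrC.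
apply: integrableR_bounded => //.
  exists 1 => x; rewrite -(@ler_pXn2r _ 2)// ?nnegrE//.
  by rewrite real_normK ?num_real// expr1n.
have [C C0 HC] := bg 0%N 1%N.
apply: (integrableR_weighted_product rho0 Lu (C := C)).
  by apply: continuous_measurable_real; exact: smooth_continuous.
by move=> x; have := HC x; rewrite expr1.
Qed.

Let mcos k : measurable_real (fun x => cos (k%:R * th x)).
Proof. by apply: continuous_measurable_real; apply: smooth_continuous; exact: (smooth_cos_sin k).1. Qed.

Let msin k : measurable_real (fun x => sin (k%:R * th x)).
Proof. by apply: continuous_measurable_real; apply: smooth_continuous; exact: (smooth_cos_sin k).2. Qed.

Let intR_leibniz U g e N : (forall t, (t < N)%N -> weighted_L2 rho (U t)) ->
  (forall t, weighted_smooth rho (g t)) -> measurable_real e -> (forall x, e x ^+ 2 <= 1) ->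
  intR (fun x => leibniz_sum U g N x * e x) = \sum_(t < N) intR (fun x => U t x * g t x * e x).
Proof.
move=> LU wg me e1.
pose F (t : nat) x := if (t < N)%N then U t x * g t x * e x else 0.
have iF t : integrableR (F t).
  rewrite /F; case: ltnP => tN; last exact: integrableR0.
  by apply: integrableR_leibniz_term => //; exact: LU.
transitivity (intR (fun x => \sum_(t < N) F t x)).
  congr intR; apply/funext => x; rewrite /leibniz_sum mulr_suml.
  by apply: eq_bigr => t _; rewrite /F ltn_ord.
rewrite intR_sum//; apply: eq_bigr => t _; congr intR; apply/funext => x.
by rewrite /F ltn_ord.
Qed.

Let integrableR_leibniz U g e N : (forall t, (t < N)%N -> weighted_L2 rho (U t)) ->
  (forall t, weighted_smooth rho (g t)) -> measurable_real e -> (forall x, e x ^+ 2 <= 1) ->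
  integrableR (fun x => leibniz_sum U g N x * e x).
Proof.
move=> LU wg me e1.
pose F (t : nat) x := if (t < N)%N then U t x * g t x * e x else 0.
have iF t : integrableR (F t).
  rewrite /F; case: ltnP => tN; last exact: integrableR0.
  by apply: integrableR_leibniz_term => //; exact: LU.
rewrite (_ : (fun x => _) = (fun x => \sum_(t < N) F t x)); first exact: integrableR_sum.
apply/funext => x; rewrite /leibniz_sum mulr_suml.
by apply: eq_bigr => t _; rewrite /F ltn_ord.
Qed.

(** Dividing and multiplying by the density turns every summand into an instance
    of the integration by parts; the summand of highest order is absent because
    the sequence g stops before it. *)
Lemma coef_step_rotation U g (j k : nat) e e' :
  (forall t, (t <= j.+1)%N -> weighted_L2 rho (U t)) ->
  (forall t, (t <= j)%N -> weak_derivative_pair (U t) (U t.+1)) ->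
  (forall t, weighted_smooth rho (g t)) -> g j.+1 = (fun=> 0) ->
  smooth e -> (forall x : R, is_derive x 1 e (k%:R * (w x * e' x))) ->
  (forall x, e x ^+ 2 <= 1) -> (forall x, e' x ^+ 2 <= 1) -> measurable_real e' ->
  k%:R * intR (fun x => leibniz_sum U g j.+1 x * e' x) =
  - intR (fun x => leibniz_sum U (coef_step g) j.+2 x * e x).
Proof.
move=> LU wU wg gj se de e1 e'1 me'.
have me : measurable_real e by apply: continuous_measurable_real; exact: smooth_continuous.
have wq t : weighted_smooth rho (fun x => quot_density x * g t x).
  exact: weighted_smooth_quot.
have wq' t := weighted_smooth_derive1 (wq t).
have ws t : weighted_smooth rho (coef_step g t).
  apply: weighted_smoothD; last exact: wq'.
  by case: t => [|t]; [exact: weighted_smooth0|exact: wq].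
rewrite intR_leibniz//; last by move=> t tj; apply: LU; rewrite ltnW.
rewrite intR_leibniz//.
rewrite mulr_sumr.
pose a t := intR (fun x => U t.+1 x * (quot_density x * g t x) * e x).
pose b t := intR (fun x => U t x * derive1 (fun y => quot_density y * g t y) x * e x).
have L (t : 'I_j.+1) : k%:R * intR (fun x => U t x * g t x * e' x) = - (a t + b t).
  have tj : (t <= j)%N by rewrite -ltnS.
  have := @phase_integration_by_parts (U t) (U t.+1) _ e k e' (wU t tj)
    (LU t (leqW tj)) (LU t.+1 tj) (wq t) se de e1 e'1 me'.
  by under eq_fun do rewrite quot_densityK.
rewrite (eq_bigr (fun t : 'I_j.+1 => - (a t + b t))); last by move=> t _; exact: L.
rewrite sumrN; congr (- _); rewrite big_split /=.
have Rt (t : nat) : (t <= j.+1)%N -> intR (fun x => U t x * coef_step g t x * e x) =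
    (if t is s.+1 then a s else 0) + b t.
  move=> tj; rewrite /coef_step; case: t tj => [|t] tj.
    by rewrite add0r; under eq_fun do rewrite add0r.
  under eq_fun do rewrite mulrDr mulrDl.
  by rewrite intRD//; apply: integrableR_leibniz_term => //; exact: LU.
rewrite [RHS](eq_bigr (fun t : 'I_j.+2 => (if t : nat is s.+1 then a s else 0) + b t)); last first.
  by move=> t _; apply: Rt; rewrite -ltnS.
rewrite [RHS]big_split /=; congr (_ + _).
  by rewrite [RHS]big_ord_recl add0r.
rewrite [RHS]big_ord_recr /= [X in _ = _ + X](_ : _ = 0) ?addr0//.
rewrite /b gj -[RHS](@intR0 R); congr intR; apply/funext => x.
under eq_fun do rewrite mulr0.
by rewrite (is_derive_derive1 (is_derive_const 0 x)) mulr0 mul0r.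
Qed.

(** Each step maps the pair (A, B) times k to (- B', A'), up to signs, and the
    sum of squares does not see such a rotation. *)
Lemma coef_rotation U (j k : nat) :
  (forall t, (t <= j)%N -> weighted_L2 rho (U t)) ->
  (forall t, (t < j)%N -> weak_derivative_pair (U t) (U t.+1)) ->
  (k%:R ^+ j) ^+ 2 * (cos_coef (fun x => U 0%N x * rho x) k ^+ 2 +
     sin_coef (fun x => U 0%N x * rho x) k ^+ 2) =
  cos_coef (leibniz_sum U (coef_seq j) j.+1) k ^+ 2 +
  sin_coef (leibniz_sum U (coef_seq j) j.+1) k ^+ 2.
Proof.
elim: j => [|j IH] LU wU.
  rewrite expr0 expr1n mul1r.
  suff -> : leibniz_sum U (coef_seq 0) 1 = fun x => U 0%N x * rho x by [].
  by apply/funext => x; rewrite /leibniz_sum big_ord1.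
rewrite (exprS k%:R j) exprMn -mulrA IH; last 2 first.
- by move=> t tj; apply: LU; rewrite leqW.
- by move=> t tj; apply: wU; rewrite leqW.
have sc := smooth_cos_sin k.
have gj : coef_seq j j.+1 = fun=> 0 by exact: coef_seq0.
have H1 : k%:R * cos_coef (leibniz_sum U (coef_seq j) j.+1) k =
    - sin_coef (leibniz_sum U (coef_seq j.+1) j.+2) k.
  exact: (@coef_step_rotation U (coef_seq j) j k _ _ LU wU
    (weighted_smooth_coef_seq j) gj sc.2 (@dsin k) (fun x => sin_sqr_le1 _)
    (fun x => cos_sqr_le1 _) (mcos k)).
have dc (x : R) : is_derive x 1 (fun y => cos (k%:R * th y))
    (k%:R * (w x * - sin (k%:R * th x))).
  by apply: is_derive_eq (dcos k x) _; ring.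
have sN (x : R) : (- sin (k%:R * th x)) ^+ 2 <= 1 by rewrite sqrrN sin_sqr_le1.
have mN : measurable_real (fun x => - sin (k%:R * th x)).
  under eq_fun do rewrite -mulN1r.
  by apply: measurable_funM; [exact: measurable_cst|exact: msin].
have H2 : k%:R * intR (fun x => leibniz_sum U (coef_seq j) j.+1 x * - sin (k%:R * th x)) =
    - cos_coef (leibniz_sum U (coef_seq j.+1) j.+2) k.
  exact: (@coef_step_rotation U (coef_seq j) j k _ _ LU wU
    (weighted_smooth_coef_seq j) gj sc.1 dc (fun x => cos_sqr_le1 _) sN mN).
have H3 : intR (fun x => leibniz_sum U (coef_seq j) j.+1 x * - sin (k%:R * th x)) =
    - sin_coef (leibniz_sum U (coef_seq j) j.+1) k.
  rewrite -mulN1r -intRZ; last first.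
    exact: (integrableR_leibniz (fun t tj => LU t (ltnW tj)) (weighted_smooth_coef_seq j)
      (msin k) (fun x => sin_sqr_le1 _)).
  by congr intR; apply/funext => x; ring.
rewrite H3 mulrN in H2.
rewrite mulrDr -!exprMn H1 (oppr_inj H2).
by rewrite sqrrN addrC.
Qed.

(** The integral of (H - T density / pi)^2 / density is nonnegative, where T is
    the trigonometric polynomial whose coefficients are those of H. *)
Lemma bessel H N : measurable_real H -> integrableR (fun x => H x ^+ 2 * quot_density x) ->
  \sum_(k < N) (cos_coef H k.+1 ^+ 2 + sin_coef H k.+1 ^+ 2) <=
  pi * intR (fun x => H x ^+ 2 * quot_density x).
Proof.
move=> mH iH.
have w0 x : 0 < w x by exact: density_gt0.
have qw x : quot_density x = (w x)^-1.
  rewrite /quot_density /w /density; field.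
  by rewrite !gt_eqF//= ?density_den_gt0.
have iw : integrableR w by exact: integrableR_density.
have iH1 : integrableR H.
  apply: (@integrableR_le _ _ (fun x => 2^-1 * (H x ^+ 2 * quot_density x) + 2^-1 * w x)) => //.
    by apply: integrableRD; apply: integrableRZ.
  move=> x; rewrite -mulrDr ler_pdivlMl// qw -(ler_pM2r (w0 x)) -subr_ge0.
  have -> : (H x ^+ 2 / w x + w x) * w x - 2 * `|H x| * w x = (`|H x| - w x) ^+ 2.
    rewrite -[H x ^+ 2]real_normK ?num_real//.
    by field; rewrite gt_eqF.
  exact: sqr_ge0.
pose T x := trigsum (cos_coef H) (sin_coef H) N (th x).
set S := \sum_(k < N) _.
have [iT2 IT2] := trigsum_parseval mth iw (intR_density c0)
  (intR_cos_phase c0) (intR_sin_phase c0) (cos_coef H) (sin_coef H) N.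
have iHc k : integrableR (fun x => H x * cos (k%:R * th x)).
  under eq_fun do rewrite mulrC; apply: integrableR_bounded => //.
  by exists 1 => x; rewrite ler_norml cos_geN1 cos_le1.
have iHs k : integrableR (fun x => H x * sin (k%:R * th x)).
  under eq_fun do rewrite mulrC; apply: integrableR_bounded => //.
  by exists 1 => x; rewrite ler_norml sin_geN1 sin_le1.
have HT : (fun x => H x * T x) = fun x => \sum_(k < N)
    (cos_coef H k.+1 * (H x * cos (k.+1%:R * th x)) +
     sin_coef H k.+1 * (H x * sin (k.+1%:R * th x))).
  apply/funext => x; rewrite /T /trigsum mulr_sumr; apply: eq_bigr => k _.
  by rewrite /harmonic_term; ring.
have it (k : nat) : integrableR (fun x => cos_coef H k.+1 * (H x * cos (k.+1%:R * th x)) +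
     sin_coef H k.+1 * (H x * sin (k.+1%:R * th x))).
  by apply: integrableRD; exact: integrableRZ.
have iHT : integrableR (fun x => H x * T x).
  by rewrite HT; exact: (@integrableR_sum _ N (fun k x => cos_coef H k.+1 * (H x * cos (k.+1%:R * th x)) +
     sin_coef H k.+1 * (H x * sin (k.+1%:R * th x)))).
have IHT : intR (fun x => H x * T x) = S.
  rewrite HT (@intR_sum _ N (fun k x => cos_coef H k.+1 * (H x * cos (k.+1%:R * th x)) +
     sin_coef H k.+1 * (H x * sin (k.+1%:R * th x))))//.
  apply: eq_bigr => k _.
  by rewrite intRD ?intRZ//; try exact: integrableRZ.
have pi0 : 0 < pi :> R := pi_gt0 R.
have aux (p a q h : R) : 0 < p -> 0 < q -> h ^+ 2 * q^-1 +
    ((- (2 / p)) * (h * a) + p ^- 2 * (a ^+ 2 * q)) = (h - a * q / p) ^+ 2 / q.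
  by move=> p0 q0; field; rewrite !gt_eqF.
have aux' (p s : R) : 0 < p -> - (2 / p) * s + p ^- 2 * (2 * p / 2 * s) = - (s / p).
  by move=> p0; field; rewrite gt_eqF.
have : 0 <= intR (fun x => H x ^+ 2 * quot_density x +
    ((- (2 / pi)) * (H x * T x) + (pi ^- 2) * (T x ^+ 2 * w x))).
  apply: intR_ge0 => x.
  have -> : H x ^+ 2 * quot_density x +
    ((- (2 / pi)) * (H x * T x) + (pi ^- 2) * (T x ^+ 2 * w x)) =
    (H x - T x * w x / pi) ^+ 2 / w x.
    rewrite qw; exact: aux.
  by rewrite divr_ge0 ?sqr_ge0// ltW.
rewrite intRD//; last by apply: integrableRD; exact: integrableRZ.
rewrite intRD; try exact: integrableRZ.
rewrite intRZ// intRZ// IHT IT2 -/S.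
rewrite (aux' _ _ pi0).
by rewrite subr_ge0 ler_pdivrMr// mulrC.
Qed.

Lemma sqr_sum_le_exp N (x : nat -> R) :
  (\sum_(t < N) x t) ^+ 2 <= 2 ^+ N * \sum_(t < N) x t ^+ 2.
Proof.
elim: N => [|N IH]; first by rewrite !big_ord0 expr0n mulr0.
rewrite !big_ord_recr /=; apply: le_trans (sqr_sum_le _ _) _.
rewrite (exprS 2 N) mulrDr; apply: lerD; first by rewrite -mulrA ler_pM2l.
rewrite -mulrA ler_pM2l// ler_peMl ?sqr_ge0//.
by rewrite exprn_ege1// ler1n.
Qed.

(** After j integrations by parts the coefficients are those of H = sum_t u_t
    g_t, and H^2 / density <= C sum_t u_t^2 rho because each g_t^2 / density is
    bounded by a multiple of rho. *)
Theorem coefficient_decay (j : nat) : exists2 D, 0 <= D &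
  forall U, (forall t, (t <= j)%N -> weighted_L2 rho (U t)) ->
  (forall t, (t < j)%N -> weak_derivative_pair (U t) (U t.+1)) ->
  forall N, \sum_(k < N) (k.+1%:R ^+ j) ^+ 2 *
      (cos_coef (fun x => U 0%N x * rho x) k.+1 ^+ 2 +
       sin_coef (fun x => U 0%N x * rho x) k.+1 ^+ 2) <=
    D * \sum_(t < j.+1) intR (fun x => U t x ^+ 2 * rho x).
Proof.
have bd (t : nat) : exists2 C, 0 <= C & forall x,
    coef_seq j t x ^+ 2 * quot_density x <= C * rho x.
  have [C C0 HC] := (weighted_smooth_coef_seq j t).2 0%N 1%N.
  exists ((1 + c ^+ 2) / (2 * c) * C).
    by rewrite mulr_ge0// divr_ge0// ?addr_ge0 ?sqr_ge0// mulr_ge0// ltW.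
  move=> x; have := HC x; rewrite expr1 /= => Hx.
  have K0 : 0 <= (1 + c ^+ 2) / (2 * c).
    by rewrite divr_ge0// ?addr_ge0 ?sqr_ge0// mulr_ge0// ltW.
  apply: (@le_trans _ _ ((1 + c ^+ 2) / (2 * c) * (coef_seq j t x ^+ 2 * (1 + x ^+ 2)))).
    rewrite [leRHS]mulrCA ler_wpM2l ?sqr_ge0// /quot_density [leRHS]mulrAC ler_wpM2r//.
      by rewrite invr_ge0 mulr_ge0// ltW.
    by have := sqr_ge0 x; have := sqr_ge0 c; nra.
  by rewrite -[leRHS]mulrA ler_wpM2l.
have /choice[C HC] : forall t, exists C, 0 <= C /\ forall x,
    coef_seq j t x ^+ 2 * quot_density x <= C * rho x.
  by move=> t; have [C C0 HC] := bd t; exists C.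
pose B := \sum_(t < j.+1) C t.
have CB (t : 'I_j.+1) : C t <= B.
  by rewrite /B (bigD1 t)//= lerDl sumr_ge0// => i _; case: (HC i).
have B0 : 0 <= B by apply: sumr_ge0 => i _; case: (HC i).
exists (pi * (2 ^+ j.+1 * B)).
  by rewrite !mulr_ge0// ?exprn_ge0// ltW// pi_gt0.
move=> U LU wU N.
rewrite (eq_bigr (fun k : 'I_N =>
  cos_coef (leibniz_sum U (coef_seq j) j.+1) k.+1 ^+ 2 +
  sin_coef (leibniz_sum U (coef_seq j) j.+1) k.+1 ^+ 2)); last first.
  by move=> k _; exact: coef_rotation.
set H := leibniz_sum _ _ _.
pose F (t : nat) x := if (t <= j)%N then U t x ^+ 2 * rho x else 0.
have iF t : integrableR (F t).
  rewrite /F; case: leqP => tj; last exact: integrableR0.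
  by have [] := LU t tj.
have FU (t : 'I_j.+1) : F t = fun x => U t x ^+ 2 * rho x.
  by apply/funext => x; rewrite /F -ltnS ltn_ord.
have mH : measurable_real H.
  pose G (t : nat) x := if (t <= j)%N then U t x * coef_seq j t x else 0.
  have -> : H = fun x => \sum_(t < j.+1) G t x.
    apply/funext => x; apply: eq_bigr => t _.
    by rewrite /G -ltnS ltn_ord.
  apply: measurable_sum => t; rewrite /G; case: leqP => tj //.
  apply: measurable_funM; first by have [] := LU t tj.
  apply: continuous_measurable_real; apply: smooth_continuous.
  by case: (weighted_smooth_coef_seq j t).
have q0 x : 0 <= quot_density x.
  by rewrite divr_ge0 ?addr_ge0 ?sqr_ge0// mulr_ge0// ltW.
have Hle x : H x ^+ 2 * quot_density x <= 2 ^+ j.+1 * B * \sum_(t < j.+1) F t x.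
  have := sqr_sum_le_exp j.+1 (fun t => U t x * coef_seq j t x).
  move=> /(ler_wpM2r (q0 x)) /le_trans; apply.
  rewrite -!mulrA ler_wpM2l ?exprn_ge0// mulr_sumr mulr_suml.
  apply: ler_sum => t _; rewrite exprMn -mulrA FU [leRHS]mulrCA ler_wpM2l ?sqr_ge0//.
  have [_ /(_ x) /le_trans] := HC t; apply.
  by rewrite ler_wpM2r// ltW.
have isF : integrableR (fun x => 2 ^+ j.+1 * B * \sum_(t < j.+1) F t x).
  by apply: integrableRZ; exact: integrableR_sum.
have iHq : integrableR (fun x => H x ^+ 2 * quot_density x).
  apply: integrableR_le isF _.
    apply: measurable_funM; first exact: measurable_funX.
    apply: continuous_measurable_real; apply: smooth_continuous.
    apply: smoothM; last exact: smooth_cst.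
    by apply: smoothD; [exact/smoothX/smooth_id|exact: smooth_cst].
  by move=> x; rewrite ger0_norm// mulr_ge0// sqr_ge0.
apply: le_trans (bessel N mH iHq) _.
rewrite -mulrA ler_wpM2l//; first by rewrite ltW// pi_gt0.
apply: le_trans (intR_le iHq isF Hle) _.
rewrite intRZ ?intR_sum//; last exact: integrableR_sum.
by under eq_bigr => t _ do rewrite FU.
Qed.

End coefficients.

(** * Termwise derivation *)

Section termwise_derivation.
Context {R : realType}.

Lemma derivative_lipschitz_bound (f : R -> R) (x d K : R) : is_derive x 1 f d ->
  (forall h, `|f (x + h) - f x| <= K * `|h|) -> `|d| <= K.
Proof.
move=> df HK.
have cv : h^-1 *: ((f \o shift x) h%:A - f x) @[h --> 0^'] --> d.
  by have := @ex_derive _ _ _ _ _ _ _ df; rewrite -[X in _ --> X](@derive_val _ _ _ _ _ _ _ df).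
have cvn : `|h^-1 *: ((f \o shift x) h%:A - f x)| @[h --> 0^'] --> `|d| by exact: cvg_norm.
apply: (cvgr_to_le cvn); near=> h.
have h0 : h != 0 by near: h; exact: nbhs_dnbhs_neq.
rewrite /= [_%:A]mulr1 (addrC h) normrM normfV mulrC ler_pdivrMr ?normr_gt0//.
Unshelve. all: by end_near. Qed.

(** A bounded series of nonnegative terms converges; e N is its remainder. *)
Lemma bounded_series_tail (m : nat -> R) (B : R) : (forall k, 0 <= m k) ->
  (forall N, \sum_(k < N) m k <= B) ->
  exists2 e : nat -> R, e N @[N --> \oo] --> (0 : R) &
    forall N M, (N <= M)%N -> \sum_(k < M) m k - \sum_(k < N) m k <= e N.
Proof.
move=> m0 HB; pose s N := \sum_(k < N) m k.
have nd : nondecreasing_seq s.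
  by apply/nondecreasing_seqP => n; rewrite /s big_ord_recr /= lerDl.
have ub : has_ubound (range s) by exists B => _ [n _ <-]; exact: HB.
have cs := nondecreasing_cvgn nd ub.
exists (fun N => sup (range s) - s N).
  by rewrite -(subrr (sup (range s))); apply: cvgB => //; exact: cvg_cst.
by move=> N M NM; rewrite lerD2r; apply: ub_le_sup => //; exists M.
Qed.

(** The difference of two partial sums is Lipschitz with constant e N, hence so
    is G - P N, which bounds the difference of the derivatives at x. *)
Lemma termwise_derivation (P dP : nat -> R -> R) (G : R -> R) (e : nat -> R) (x d : R) :
  (forall N (y : R), is_derive y 1 (P N) (dP N y)) ->
  (forall N M y, (N <= M)%N -> `|dP M y - dP N y| <= e N) ->
  e N @[N --> \oo] --> (0 : R) -> (forall y, P N y @[N --> \oo] --> G y) ->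
  is_derive x 1 G d -> dP N x @[N --> \oo] --> d.
Proof.
move=> HP He e0 HG dG.
have K N : `|d - dP N x| <= e N.
  apply: (derivative_lipschitz_bound (is_derive_sub dG (HP N x))) => h.
  have cv : `|P M (x + h) - P N (x + h) - (P M x - P N x)| @[M --> \oo] -->
      `|G (x + h) - P N (x + h) - (G x - P N x)|.
    apply: cvg_norm; apply: cvgB; apply: cvgB; try exact: cvg_cst; exact: HG.
  apply: (cvgr_to_le cv); near=> M.
  have NM : (N <= M)%N by near: M; exact: nbhs_infty_ge.
  pose a := Num.min x (x + h); pose b := Num.max x (x + h).
  have := @mean_value_inequality _ (fun y => P M y - P N y)
    (fun y => dP M y - dP N y) a b (e N).
  move=> /(_ (fun z _ => is_derive_sub (HP M z) (HP N z)) (fun z _ => He N M z NM) x (x + h)).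
  rewrite /a /b !ge_min !le_max !lexx !orbT /= => /(_ isT isT).
  by rewrite (addrC x h) addrK.
apply/cvgrPdist_le => eps eps0.
have /cvgrPdist_le /(_ eps eps0) := e0; apply: filterS => N.
rewrite sub0r normrN => HN; apply: le_trans (K N) _.
by apply: le_trans HN; exact: ler_norm.
Unshelve. all: by end_near. Qed.

End termwise_derivation.

Lemma continuous_trigsum (R : realType) (a b : nat -> R) N : continuous (trigsum a b N).
Proof.
elim: N => [|N IH] t.
  rewrite (_ : trigsum a b 0 = fun=> 0); first exact: cvg_cst.
  by apply/funext => s; rewrite /trigsum big_ord0.
rewrite (_ : trigsum a b N.+1 = fun s => trigsum a b N s + harmonic_term a b N.+1 s).
  by apply: cvgD; [exact: IH|exact: continuous_harmonic_term].
by apply/funext => s; rewrite /trigsum big_ord_recr.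
Qed.

(** * Pointwise convergence of the Fourier series *)

Section fourier_inversion.
Context {R : realType}.
Variables (c : R) (f : R -> R).
Hypothesis c0 : 0 < c.
Hypothesis cf : continuous f.
Hypothesis iff : integrableR (fun x => f x ^+ 2 * quot_density c x).
Local Notation mu := (@lebesgue_measure R).

Let th := phase c.
Let w := density c.
Let q := quot_density c.
Let A := cos_coef c f.
Let B := sin_coef c f.

Let w0 x : 0 < w x. Proof. exact: density_gt0. Qed.
Let qw x : q x = (w x)^-1.
Proof.
rewrite /q /quot_density /w /density; field.
by rewrite !gt_eqF//= ?density_den_gt0.
Qed.
Let mth : measurable_real th. Proof. by apply: continuous_measurable_real; exact: continuous_phase. Qed.
Let mw : measurable_real w. Proof. by apply: continuous_measurable_real; exact: continuous_density. Qed.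
Let mf : measurable_real f. Proof. exact: continuous_measurable_real. Qed.
Let iw : integrableR w. Proof. exact: integrableR_density. Qed.

(** A weighted Cauchy-Schwarz inequality with a free parameter eta, so that r
    tending to 0 in mean square forces the pairing with f to tend to 0. *)
Lemma young_density (r : R -> R) : measurable_real r -> integrableR (fun x => r x ^+ 2 * w x) ->
  integrableR (fun x => r x * f x) /\ forall eta, 0 < eta ->
  `|intR (fun x => r x * f x)| <= eta / 2 * intR (fun x => f x ^+ 2 * q x) +
     (2 * eta)^-1 * intR (fun x => r x ^+ 2 * w x).
Proof.
move=> mr ir.
have pt eta x : 0 < eta -> `|r x * f x| <= eta / 2 * (f x ^+ 2 * q x) +
     (2 * eta)^-1 * (r x ^+ 2 * w x).
  move=> e0; rewrite qw -subr_ge0.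
  have -> : eta / 2 * (f x ^+ 2 * (w x)^-1) + (2 * eta)^-1 * (r x ^+ 2 * w x) - `|r x * f x|
     = (eta * `|f x| - `|r x| * w x) ^+ 2 / (2 * eta * w x).
    rewrite normrM -[f x ^+ 2]real_normK ?num_real// -[r x ^+ 2]real_normK ?num_real//.
    by field; rewrite !gt_eqF.
  by apply: divr_ge0; [exact: sqr_ge0|apply: mulr_ge0; [apply: mulr_ge0 => //|]; exact: ltW].
have i2 eta : integrableR (fun x => eta / 2 * (f x ^+ 2 * q x) +
     (2 * eta)^-1 * (r x ^+ 2 * w x)) by apply: integrableRD; exact: integrableRZ.
have irf : integrableR (fun x => r x * f x).
  apply: integrableR_le (i2 1) _; first exact: measurable_funM.
  by move=> x; exact: pt.
split=> // eta e0.
apply: le_trans (intR_normr irf) _.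
rewrite -(intRZ _ iff) -(intRZ _ ir) -intRD; try exact: integrableRZ.
by apply: intR_le => //; [exact: integrableR_norm|move=> x; exact: pt].
Qed.

Lemma integrableR_signal : integrableR f.
Proof.
have [|H _] := @young_density (fun=> 1) (measurable_cst _).
  by under eq_fun do rewrite expr1n mul1r.
by move: H; under eq_fun do rewrite mul1r.
Qed.

Let Phi y := intR (fun x => \1_`]-oo, y] x * f x).

Let dPhi (y : R) : is_derive y 1 Phi (f y).
Proof.
have E : Phi = fun x => \int[mu]_(t in `]-oo, x]) f t.
  apply/funext => x; rewrite Rintegral_mkcond; congr Rintegral; apply/funext => z.
  by rewrite patchE indicE; case: ifP; rewrite ?mul1r ?mul0r.
have H := @continuous_FTC1 R f -oo%O y (y + 1) _ _ _ (@cf y).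
have [|||d <-] := H.
- by rewrite ltrDl.
- exact: integrableS integrableR_signal.
- by rewrite ltNyr.
rewrite E; exact: derivable_is_derive.
Qed.

Let mcos k : measurable_real (fun x => cos (k%:R * th x)).
Proof.
apply: continuous_measurable_real => x.
have h := @is_derive_compr _ cos (fun y => k%:R * th y) _ _ _ (is_derive_cos _)
  (is_derive_scale k%:R (is_derive_phase c0 x)).
exact: is_derive_continuous h.
Qed.

Let msin k : measurable_real (fun x => sin (k%:R * th x)).
Proof.
apply: continuous_measurable_real => x.
have h := @is_derive_compr _ sin (fun y => k%:R * th y) _ _ _ (is_derive_sin _)
  (is_derive_scale k%:R (is_derive_phase c0 x)).
exact: is_derive_continuous h.
Qed.

Let icos k g : integrableR g -> integrableR (fun x => cos (k%:R * th x) * g x).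
Proof.
move=> ig; apply: integrableR_bounded ig => //.
by exists 1 => x; rewrite ler_norml cos_geN1 cos_le1.
Qed.

Let isin k g : integrableR g -> integrableR (fun x => sin (k%:R * th x) * g x).
Proof.
move=> ig; apply: integrableR_bounded ig => //.
by exists 1 => x; rewrite ler_norml sin_geN1 sin_le1.
Qed.

Let ichi y (g : R -> R) : integrableR g -> integrableR (fun x => \1_`]-oo, y] x * g x).
Proof.
move=> ig; apply: integrableR_bounded ig; first exact: measurable_real_indic.
by exists 1 => x; exact: indic_le1.
Qed.

Let intR_trigsum (g : R -> R) (a b : nat -> R) N : integrableR g ->
  integrableR (fun x => trigsum a b N (th x) * g x) /\
  intR (fun x => trigsum a b N (th x) * g x) = \sum_(k < N)
    (a k.+1 * intR (fun x => cos (k.+1%:R * th x) * g x) +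
     b k.+1 * intR (fun x => sin (k.+1%:R * th x) * g x)).
Proof.
move=> ig.
pose F (k : nat) x := a k.+1 * (cos (k.+1%:R * th x) * g x) +
  b k.+1 * (sin (k.+1%:R * th x) * g x).
have iF k : integrableR (F k).
  by apply: integrableRD; apply: integrableRZ; [exact: icos|exact: isin].
have -> : (fun x => trigsum a b N (th x) * g x) = fun x => \sum_(k < N) F k x.
  apply/funext => x; rewrite /trigsum mulr_suml; apply: eq_bigr => k _.
  by rewrite /F /harmonic_term; ring.
split; first exact: integrableR_sum.
rewrite intR_sum//; apply: eq_bigr => k _.
have i1 := icos k.+1 ig; have i2 := isin k.+1 ig.
by rewrite /F (intRD (integrableRZ _ i1) (integrableRZ _ i2)) (intRZ _ i1) (intRZ _ i2).
Qed.

(** The partial sums of the Fourier series without its constant term, integrated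
    from -oo to y. *)
Definition primitive_sum N (y : R) : R := \sum_(k < N)
  (A k.+1 * (sin (k.+1%:R * th y) / k.+1%:R) +
   B k.+1 * ((1 - cos (k.+1%:R * th y)) / k.+1%:R)) / pi.

(** Let r_N be the indicator of ]-oo, y] minus the N-th partial sum of its own
    Fourier series. The mean square of r_N is t - t^2 / (2 pi) - (2 / pi) sum_(k
    <= N) (1 - cos k t) / k^2 with t the angle of y, which tends to 0 by the
    closed form of the series. Pairing r_N with f gives the claim. *)
Lemma ray_fourier_cvg y : primitive_sum N y @[N --> \oo] -->
  Phi y - intR f / (2 * pi) * th y.
Proof.
have pi0 : 0 < pi :> R := pi_gt0 R.
move: (pi0); rewrite /primitive_sum.
have Edens := intR_density c0.
have cvs := cosine_series_cvg (phase_gt0 c y) (phase_lt2pi c y).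
move: cvs Edens; move: (pi : R) => p cvs Edens p0.
set t := th y.
pose a k : R := sin (k%:R * t) / k%:R / p.
pose b k : R := (1 - cos (k%:R * t)) / k%:R / p.
pose chi : R -> R := \1_`]-oo, y].
have mchi : measurable_real chi by exact: measurable_real_indic.
have chi2 x : chi x * chi x = chi x.
  by rewrite /chi indicE; case: (_ \in _); rewrite ?mul1r ?mul0r.
pose T N x := trigsum a b N (th x).
(* z is the constant term of the Fourier series of the indicator. *)
pose z := t / (2 * p).
pose r N x := chi x - (z + T N x).
pose S N := \sum_(k < N) (a k.+1 ^+ 2 + b k.+1 ^+ 2).
have P N := trigsum_parseval mth iw Edens (intR_cos_phase c0) (intR_sin_phase c0) a b N.
have iT2 N : integrableR (fun x => T N x ^+ 2 * w x) := (P N).1.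
have IT2 N : intR (fun x => T N x ^+ 2 * w x) = p * S N.
  by rewrite (P N).2; congr (_ * _); field.
have [iTw ITw] : (forall N, integrableR (fun x => T N x * w x)) /\
    forall N, intR (fun x => T N x * w x) = 0.
  split=> N; have [i1 i2] := intR_trigsum a b N iw; first exact: i1.
  rewrite i2 big1// => k _.
  by rewrite (intR_cos_phase c0) (intR_sin_phase c0) !mulr0 addr0.
have icw : integrableR (fun x => chi x * w x) by exact: ichi.
have Icw : intR (fun x => chi x * w x) = t by exact: intR_density_ray.
have [icT IcT] : (forall N, integrableR (fun x => T N x * (chi x * w x))) /\
    forall N, intR (fun x => T N x * (chi x * w x)) = p * S N.
  split=> N; have [i1 i2] := intR_trigsum a b N icw; first exact: i1.
  rewrite i2 mulr_sumr; apply: eq_bigr => k _.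
  under eq_fun do rewrite mulrCA.
  rewrite (intR_cos_phase_ray c0).
  under eq_fun do rewrite mulrCA.
  rewrite (intR_sin_phase_ray c0) -/(th y) -/t /a /b.
  by field; rewrite gt_eqF//= pnatr_eq0.
have Er2 N : (fun x => r N x ^+ 2 * w x) = fun x =>
    (1 - 2 * z) * (chi x * w x) + ((- 2) * (T N x * (chi x * w x)) +
    (z ^+ 2 * w x + (2 * z * (T N x * w x) + T N x ^+ 2 * w x))).
  apply/funext => x; rewrite /r.
  have -> : (chi x - (z + T N x)) ^+ 2 * w x = chi x * chi x * w x -
     2 * chi x * (z + T N x) * w x + (z + T N x) ^+ 2 * w x by ring.
  by rewrite chi2; ring.
have ir5 N : integrableR (fun x => 2 * z * (T N x * w x) + T N x ^+ 2 * w x).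
  by apply: integrableRD => //; exact: integrableRZ.
have ir4 N : integrableR (fun x => z ^+ 2 * w x + (2 * z * (T N x * w x) + T N x ^+ 2 * w x)).
  by apply: integrableRD => //; exact: integrableRZ.
have ir3 N : integrableR (fun x => (- 2) * (T N x * (chi x * w x)) +
    (z ^+ 2 * w x + (2 * z * (T N x * w x) + T N x ^+ 2 * w x))).
  by apply: integrableRD => //; exact: integrableRZ.
have ir2 N : integrableR (fun x => r N x ^+ 2 * w x).
  by rewrite Er2; apply: integrableRD => //; exact: integrableRZ.
have Ir2 N : intR (fun x => r N x ^+ 2 * w x) = t - t ^+ 2 / (2 * p) - p * S N.
  rewrite Er2 intRD//; last exact: integrableRZ.
  rewrite intRD//; last exact: integrableRZ.
  rewrite intRD//; last exact: integrableRZ.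
  rewrite intRD//; last exact: integrableRZ.
  rewrite (intRZ _ icw) (intRZ _ (icT N)) (intRZ _ iw) (intRZ _ (iTw N)).
  rewrite Icw IcT Edens ITw IT2 /z.
  by field; rewrite gt_eqF.
have SE N : p * S N = 2 / p * cosine_series N t.
  rewrite /S /cosine_series !mulr_sumr; apply: eq_bigr => k _; rewrite /a /b.
  have := cos2Dsin2 (k.+1%:R * t).
  move: (cos _) (sin _) => C D CD.
  have k0 : k.+1%:R != 0 :> R by rewrite pnatr_eq0.
  move: (k.+1%:R : R) k0 => K k0.
  have -> : p * ((D / K / p) ^+ 2 + ((1 - C) / K / p) ^+ 2) =
    (D ^+ 2 + (1 - C) ^+ 2) / p / K ^+ 2.
    by field; rewrite k0 gt_eqF.
  have -> : D ^+ 2 = 1 - C ^+ 2 by rewrite -CD addrAC subrr add0r.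
  by field; rewrite k0 gt_eqF.
have e0 : intR (fun x => r N x ^+ 2 * w x) @[N --> \oo] --> (0 : R).
  under eq_fun do rewrite Ir2 SE.
  have -> : 0 = t - t ^+ 2 / (2 * p) - 2 / p * (p * t / 2 - t ^+ 2 / 4).
    by field; rewrite gt_eqF.
  apply: cvgB; first exact: cvg_cst.
  by apply: cvgM; [exact: cvg_cst|exact: cvs].
have mr N : measurable_real (r N).
  apply: measurable_funB => //; apply: measurable_funD => //.
  exact: (measurableT_comp (continuous_measurable_real (@continuous_trigsum _ a b N)) mth).
have [iTf ITf] : (forall N, integrableR (fun x => T N x * f x)) /\
    forall N, intR (fun x => T N x * f x) = \sum_(k < N)
      (A k.+1 * (sin (k.+1%:R * t) / k.+1%:R) +
       B k.+1 * ((1 - cos (k.+1%:R * t)) / k.+1%:R)) / p.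
  split=> N; have [i1 i2] := intR_trigsum a b N integrableR_signal; first exact: i1.
  rewrite i2; apply: eq_bigr => k _; rewrite /A /B /cos_coef /sin_coef -/th.
  under eq_fun do rewrite mulrC.
  under [X in _ + _ * intR X]eq_fun do rewrite mulrC.
  by rewrite /a /b; ring.
have ifchi : integrableR (fun x => chi x * f x) by apply: ichi; exact: integrableR_signal.
have Irf N : intR (fun x => r N x * f x) = Phi y - z * intR f - intR (fun x => T N x * f x).
  have -> : (fun x => r N x * f x) = fun x => chi x * f x - (z * f x + T N x * f x).
    by apply/funext => x; rewrite /r; ring.
  have izf := integrableRZ z integrableR_signal.
  rewrite (intRB ifchi (integrableRD izf (iTf N))) (intRD izf (iTf N)) (intRZ _ integrableR_signal).
  by rewrite opprD addrA.
under eq_fun do rewrite -ITf.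
apply/cvgrPdist_le => eps eps0.
set X := intR (fun x => f x ^+ 2 * q x).
have X0 : 0 <= X.
  by apply: intR_ge0 => x; rewrite mulr_ge0 ?sqr_ge0// qw invr_ge0 ltW.
(* This makes the first term of the Young inequality smaller than eps / 2; N
   then makes the second one small. *)
pose eta := eps / (X + 1).
have X1 : 0 < X + 1 by rewrite ltr_wpDl.
have eta0 : 0 < eta by rewrite divr_gt0.
have /cvgrPdist_le /(_ (eta * eps) (mulr_gt0 eta0 eps0)) := e0.
apply: filterS => N; rewrite sub0r normrN => HN.
have -> : Phi y - intR f / (2 * p) * t - intR (fun x => T N x * f x) = intR (fun x => r N x * f x).
  by rewrite Irf /z; ring.
have [_ /(_ eta eta0)] := young_density (mr N) (ir2 N).
move=> /le_trans; apply.
have h1 : eta / 2 * X <= eps / 2.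
  have : eta * (X + 1) = eps by rewrite /eta divfK// gt_eqF.
  by have := eta0; nra.
have h2 : (2 * eta)^-1 * intR (fun x => r N x ^+ 2 * w x) <= eps / 2.
  have e2 : 0 < 2 * eta by rewrite mulr_gt0.
  rewrite ler_pdivrMl//; apply: le_trans (le_trans (ler_norm _) HN) _.
  rewrite (_ : 2 * eta * (eps / 2) = eta * eps)//.
  by move: (eta) (eps) => a' b'; field.
by rewrite -/X; apply: le_trans (lerD h1 h2) _; rewrite -splitr.
Qed.

(** By Cauchy-Schwarz the hypothesis makes the coefficients absolutely summable,
    so the derivatives of the partial sums of the primitive are uniformly
    Cauchy, and termwise derivation applies. *)
Theorem fourier_inversion (S : R) y :
  (forall N, \sum_(k < N) k.+1%:R ^+ 2 * (A k.+1 ^+ 2 + B k.+1 ^+ 2) <= S) ->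
  trigsum A B N (th y) @[N --> \oo] --> pi * (f y * q y) - intR f / 2.
Proof.
have pi0 : 0 < pi :> R := pi_gt0 R.
move=> HS.
pose m k := `|A k.+1| + `|B k.+1|.
have m0 k : 0 <= m k by rewrite addr_ge0.
have mB N : \sum_(k < N) m k <= 2 + S.
  apply: (@le_trans _ _ (\sum_(k < N) ((k.+1%:R ^+ 2)^-1 +
     k.+1%:R ^+ 2 * (A k.+1 ^+ 2 + B k.+1 ^+ 2)))).
    apply: ler_sum => k _; rewrite /m.
    have k0 : 0 < k.+1%:R :> R by rewrite ltr0n.
    have amgm (x : R) : `|x| <= 2^-1 * (k.+1%:R ^+ 2)^-1 + 2^-1 * (k.+1%:R ^+ 2 * x ^+ 2).
      rewrite -subr_ge0.
      have -> : 2^-1 * k.+1%:R ^- 2 + 2^-1 * (k.+1%:R ^+ 2 * x ^+ 2) - `|x| =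
        2^-1 * (k.+1%:R^-1 - k.+1%:R * `|x|) ^+ 2.
        by rewrite -[x ^+ 2]real_normK ?num_real//; field; rewrite gt_eqF.
      by rewrite mulr_ge0// sqr_ge0.
    apply: le_trans (lerD (amgm _) (amgm _)) _.
    have : 0 <= k.+1%:R ^+ 2 * A k.+1 ^+ 2 by rewrite mulr_ge0 ?sqr_ge0.
    have : 0 <= k.+1%:R ^+ 2 * B k.+1 ^+ 2 by rewrite mulr_ge0 ?sqr_ge0.
    rewrite mulrDr; move: (k.+1%:R ^- 2) (_ * _) (_ * _) => a b d; lra.
  by rewrite big_split /=; apply: lerD; [exact: sum_inv_sqr_le|exact: HS].
have [e e0 He] := bounded_series_tail m0 mB.
pose G y' := Phi y' - intR f / (2 * pi) * th y'.
pose dP N y' := trigsum A B N (th y') * w y' / pi.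
have HP N (z : R) : is_derive z 1 (primitive_sum N) (dP N z).
  rewrite /dP /trigsum !mulr_suml.
  apply: (@is_derive_sumr _ N (fun k y' => (A k.+1 * (sin (k.+1%:R * th y') / k.+1%:R) +
    B k.+1 * ((1 - cos (k.+1%:R * th y')) / k.+1%:R)) / pi)
    (fun k => harmonic_term A B k.+1 (th z) * w z / pi)) => k.
  have hth := is_derive_scale k.+1%:R (is_derive_phase c0 z).
  have h1 := @is_derive_compr _ sin (fun y => k.+1%:R * th y) _ _ _ (is_derive_sin _) hth.
  have h2 := @is_derive_compr _ cos (fun y => k.+1%:R * th y) _ _ _ (is_derive_cos _) hth.
  have h3 := is_derive_scale (A k.+1) (is_derive_mul h1 (is_derive_const k.+1%:R^-1 z)).
  have h4 := is_derive_scale (B k.+1) (is_derive_mul (is_derive_sub (is_derive_const 1 z) h2) (is_derive_const k.+1%:R^-1 z)).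
  apply: is_derive_eq (is_derive_mul (is_derive_add h3 h4) (is_derive_const pi^-1 z)) _.
  have k0 : k.+1%:R != 0 :> R by rewrite pnatr_eq0.
  rewrite /harmonic_term -/(w z); move: (pi : R) pi0 => p p0.
  move: (k.+1%:R : R) k0 => K k0.
  by field; rewrite k0 gt_eqF.
(* The density is at most 2 / c. *)
pose K := 2 / c / pi.
have K0 : 0 <= K by rewrite /K !divr_ge0// ltW.
have Hdiff N M z : (N <= M)%N -> `|dP M z - dP N z| <= K * e N.
  move=> NM; rewrite /dP -mulrBl -mulrBl.
  rewrite normrM normrM (ger0_norm (ltW (w0 z))) normfV (gtr0_norm pi0).
  have -> : K * e N = e N * (2 / c) / pi by rewrite /K; ring.
  rewrite ler_wpM2r ?invr_ge0 ?(ltW pi0)//.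
  apply: ler_pM => //; [exact: ltW|  |exact: density_le].
  apply: le_trans (He N M NM).
  elim: M NM => [|M IH]; first by rewrite leqn0 => /eqP ->; rewrite !subrr normr0.
  rewrite leq_eqVlt => /orP[/eqP ->|]; first by rewrite !subrr normr0.
  rewrite ltnS => NM; rewrite /trigsum !big_ord_recr /= -!/(trigsum _ _ _ _).
  rewrite addrAC [leRHS]addrAC; apply: le_trans (ler_normD _ _) _.
  by rewrite lerD ?IH// harmonic_term_bound.
have := @termwise_derivation _ primitive_sum dP G (fun N => K * e N) y
  (f y - intR f / (2 * pi) * w y) HP Hdiff.
move=> /(_ _ ray_fourier_cvg _) H.
have {}H : dP N y @[N --> \oo] --> f y - intR f / (2 * pi) * w y.
  apply: H.
    by rewrite -(mulr0 K); apply: cvgM => //; exact: cvg_cst.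
  by apply: is_derive_sub; [exact: dPhi|exact: (is_derive_scale _ (is_derive_phase c0 y))].
have E : (fun N => trigsum A B N (th y)) = fun N => dP N y * (pi / w y).
  apply/funext => N; rewrite /dP; move: (pi : R) pi0 => p p0.
  by field; rewrite !gt_eqF.
rewrite E.
have -> : pi * (f y * q y) - intR f / 2 = (f y - intR f / (2 * pi) * w y) * (pi / w y).
  rewrite qw; move: (pi : R) pi0 => p p0.
  by field; rewrite !gt_eqF.
by apply: cvgM => //; exact: cvg_cst.
Qed.

End fourier_inversion.

(** * Aliasing at equispaced nodes *)

Section aliasing.
Context {R : realType}.
Implicit Types (m j k l L : nat) (A B : nat -> R).

(** Multiplication by 2 sin (h / 2) telescopes the sum, and m h is a multiple of
    the period. *)
Lemma equispaced_trig_sum m k (x : R) : (0 < k)%N -> (k < m)%N ->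
  \sum_(j < m) cos (x + j%:R * (k%:R * (2 * pi) / m%:R)) = 0 /\
  \sum_(j < m) sin (x + j%:R * (k%:R * (2 * pi) / m%:R)) = 0.
Proof.
move=> k0 km.
have m0 : 0 < m%:R :> R by rewrite ltr0n (leq_ltn_trans _ km).
set h := k%:R * (2 * pi) / m%:R.
have hm : m%:R * h = k%:R * (2 * pi) by rewrite /h mulrC divfK// gt_eqF.
have sh : sin (h / 2) != 0.
  rewrite gt_eqF// sin_gt0_pi//; have pi0 := pi_gt0 R.
  have -> : h / 2 = k%:R * pi / m%:R by rewrite /h; move: (pi : R) => p; field; rewrite gt_eqF.
  apply/andP; split; first by rewrite divr_gt0// mulr_gt0// ltr0n.
  by rewrite ltr_pdivrMr// mulrC ltr_pM2l// ltr_nat.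
have C n : 2 * sin (h / 2) * (\sum_(j < n) cos (x + j%:R * h)) =
    sin (x + n%:R * h - h / 2) - sin (x - h / 2).
  elim: n => [|n IH]; first by rewrite big_ord0 mulr0 mul0r addr0 subrr.
  rewrite big_ord_recr /= mulrDr IH.
  have -> : x + n.+1%:R * h - h / 2 = x + n%:R * h + h / 2 by rewrite -natr1; field.
  by rewrite !sinD sinN cosN; ring.
have S n : 2 * sin (h / 2) * (\sum_(j < n) sin (x + j%:R * h)) =
    cos (x - h / 2) - cos (x + n%:R * h - h / 2).
  elim: n => [|n IH]; first by rewrite big_ord0 mulr0 mul0r addr0 subrr.
  rewrite big_ord_recr /= mulrDr IH.
  have -> : x + n.+1%:R * h - h / 2 = x + n%:R * h + h / 2 by rewrite -natr1; field.
  by rewrite !cosD sinN cosN; ring.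
have s2 : 2 * sin (h / 2) != 0 by rewrite mulf_neq0.
have E : x + m%:R * h - h / 2 = (x - h / 2) + k%:R * (2 * pi) by rewrite hm; ring.
split; apply: (mulfI s2); rewrite mulr0.
- by rewrite C E sin_add_2npi subrr.
- by rewrite S E cos_add_2npi subrr.
Qed.

(** A frequency lm + k differs at the nodes from the frequency k only by a phase
    shift, modulo full turns. *)
Lemma node_phase m (delta : R) j l k : (0 < m)%N ->
  (l * m + k)%:R * trapezoidal_node m delta j =
  (l%:R * (2 * pi * delta) + k%:R * (2 * pi) / m%:R * delta +
    j%:R * (k%:R * (2 * pi) / m%:R)) + (l * j)%:R * (2 * pi).
Proof.
move=> m0; have m0' : m%:R != 0 :> R by rewrite pnatr_eq0 -lt0n.
by rewrite /trapezoidal_node natrD !natrM; move: (pi : R) => p; field.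
Qed.

Lemma harmonic_node_sum A B m (delta : R) l k : (0 < k)%N -> (k < m)%N ->
  \sum_(j < m) harmonic_term A B (l * m + k) (trapezoidal_node m delta j) = 0.
Proof.
move=> k0 km; have m0 : (0 < m)%N by exact: leq_ltn_trans km.
have [C S] := equispaced_trig_sum
  (l%:R * (2 * pi * delta) + k%:R * (2 * pi) / m%:R * delta) k0 km.
rewrite /harmonic_term big_split /= -!mulr_sumr.
under eq_bigr => j _ do rewrite node_phase// cos_add_2npi.
rewrite C [X in _ * 0 + _ * X](_ : _ = 0) ?S ?mulr0 ?addr0// -[RHS]S.
apply: eq_bigr => j _.
by rewrite node_phase// sin_add_2npi.
Qed.

Lemma harmonic_node_aliased A B m (delta : R) l j : (0 < m)%N ->
  harmonic_term A B (l * m) (trapezoidal_node m delta j) =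
  harmonic_term (fun i => A (i * m)%N) (fun i => B (i * m)%N) l (2 * pi * delta).
Proof.
move=> m0; rewrite /harmonic_term.
have -> : (l * m)%:R * trapezoidal_node m delta j =
    l%:R * (2 * pi * delta) + (l * j)%:R * (2 * pi).
  have := node_phase delta j l 0 m0; rewrite addn0 => ->.
  by rewrite !mul0r mulr0 !addr0.
by rewrite cos_add_2npi sin_add_2npi.
Qed.

(** Frequencies that are not multiples of m cancel over the m nodes; a multiple
    lm takes the same value at all of them. *)
Lemma trigsum_aliasing A B m (delta : R) L : (0 < m)%N ->
  \sum_(j < m) trigsum A B (L * m) (trapezoidal_node m delta j) =
  m%:R * trigsum (fun i => A (i * m)%N) (fun i => B (i * m)%N) L (2 * pi * delta).
Proof.
move=> m0; elim: L => [|L IH].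
  rewrite mul0n /trigsum big_ord0 mulr0 big1// => j _.
  by rewrite big_ord0.
(* Between L m and L m + m - 1 only frequencies that cancel are added. *)
have step r : (r <= m.-1)%N ->
    \sum_(j < m) trigsum A B (L * m + r) (trapezoidal_node m delta j) =
    \sum_(j < m) trigsum A B (L * m) (trapezoidal_node m delta j).
  elim: r => [|r IHr] rm; first by rewrite addn0.
  rewrite -IHr ?(ltnW rm)// addnS /trigsum.
  under eq_bigr => j _ do rewrite big_ord_recr /=.
  rewrite big_split /= -addnS harmonic_node_sum ?addr0//.
  by rewrite (leq_ltn_trans rm)// prednK.
have -> : (L.+1 * m = (L * m + m.-1).+1)%N by rewrite -addnS prednK// mulSn addnC.
rewrite /trigsum big_ord_recr /= mulrDr -IH -(step m.-1)//.
under eq_bigr => j _ do rewrite big_ord_recr /=.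
rewrite big_split /= -addnS prednK//; congr (_ + _).
have -> : (L * m + m = L.+1 * m)%N by rewrite mulSn addnC.
under eq_bigr => j _ do rewrite harmonic_node_aliased//.
rewrite big_const_ord iter_addr_0.
exact: esym (mulr_natl _ _).
Qed.

End aliasing.

(** * The error of the Moebius-transformed rule as a series *)

Section moebius_rule.
Context {R : realType}.
Variable c : R.
Hypothesis c0 : 0 < c.

Lemma is_derive_moebius (t : R) : sin (t / 2) != 0 ->
  is_derive t 1 (moebius c) (c / (2 * sin (t / 2) ^+ 2)).
Proof.
move=> s0.
have dh : is_derive t 1 (fun y : R => y / 2) 2^-1.
  by have := is_derive_mul (is_derive_idr t) (is_derive_const 2^-1 t); rewrite mulr0 add0r mulr1.
have h1 := @is_derive_compr _ cos (fun y => y / 2) _ _ _ (is_derive_cos _) dh.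
have h2 := @is_derive_compr _ sin (fun y => y / 2) _ _ _ (is_derive_sin _) dh.
have h3 := @is_derive_invr _ (fun y => sin (y / 2)) t _ s0 h2.
apply: is_derive_eq (is_derive_scale (- c) (is_derive_mul h1 h3)) _.
have := cos2Dsin2 (t / 2); move: (cos _) (sin _) s0 => C S s0 CS.
have -> : c / (2 * S ^+ 2) = c * (C ^+ 2 + S ^+ 2) / (2 * S ^+ 2) by rewrite CS mulr1.
by field.
Qed.

Lemma quot_density_moebius (t : R) : sin (t / 2) != 0 ->
  quot_density c (moebius c t) = c / (2 * sin (t / 2) ^+ 2).
Proof.
move=> s0; rewrite /quot_density /moebius /cot.
have := cos2Dsin2 (t / 2); move: (cos _) (sin _) s0 => C S s0 CS.
have -> : c / (2 * S ^+ 2) = c * (C ^+ 2 + S ^+ 2) / (2 * S ^+ 2) by rewrite CS mulr1.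
by field; rewrite s0 gt_eqF.
Qed.

Lemma phase_moebius (t : R) : 0 < t -> t < 2 * pi -> phase c (moebius c t) = t.
Proof.
move=> t0 t2; have s0 : 0 < sin (t / 2) by exact: sin_half_gt0.
have E : moebius c t / c = tan (t / 2 - pi / 2).
  rewrite /moebius /cot /tan sinB cosB sin_pihalf cos_pihalf.
  by field; rewrite !gt_eqF.
rewrite /phase E tanK; first by field.
by rewrite in_itv/=; apply/andP; split; lra.
Qed.

Lemma trapezoidal_node_itv m (delta : R) j : (j < m)%N -> 0 < delta -> delta < 1 ->
  0 < trapezoidal_node m delta j /\ trapezoidal_node m delta j < 2 * pi.
Proof.
move=> jm d0 d1; have pi0 := pi_gt0 R.
have m0 : 0 < m%:R :> R by rewrite ltr0n (leq_ltn_trans _ jm).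
rewrite /trapezoidal_node; split.
  by rewrite divr_gt0// mulr_gt0// ?mulr_gt0// ltr_wpDl.
rewrite ltr_pdivrMr// ltr_pM2l ?mulr_gt0//.
apply: (@lt_le_trans _ _ (j%:R + 1)); first by rewrite ltrD2l.
by rewrite natr1 ler_nat.
Qed.

(** The rule for a real integrand that already contains the weight; for 0 <
    delta < 1 every node is interior, so no summand has to be discarded. *)
Definition real_moebius_trapezoidal (f : R -> R) m (delta : R) : R :=
  2 * pi / m%:R * \sum_(j < m)
    let t := trapezoidal_node m delta j in
    f (moebius c t) * derive1 (moebius c) t.

(** Fourier inversion is applied at each node along the partial sums of length L
    m, for which the aliasing identity is exact. *)
Theorem trapezoidal_error_series (f : R -> R) (S : R) m (delta : R) :
  continuous f -> integrableR (fun x => f x ^+ 2 * quot_density c x) ->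
  (forall N, \sum_(k < N) k.+1%:R ^+ 2 *
     (cos_coef c f k.+1 ^+ 2 + sin_coef c f k.+1 ^+ 2) <= S) ->
  (0 < m)%N -> 0 < delta -> delta < 1 ->
  2 * trigsum (fun i => cos_coef c f (i * m)) (fun i => sin_coef c f (i * m)) L
    (2 * pi * delta) @[L --> \oo] -->
  real_moebius_trapezoidal f m delta - intR f.
Proof.
move=> cf iff HS m0 d0 d1.
have m0' : m%:R != 0 :> R by rewrite pnatr_eq0 -lt0n.
pose t j := trapezoidal_node m delta j.
have cv (j : 'I_m) : trigsum (cos_coef c f) (sin_coef c f) (L * m) (t j) @[L --> \oo] -->
    pi * (f (moebius c (t j)) * derive1 (moebius c) (t j)) - intR f / 2.
  have [t0 t2] := trapezoidal_node_itv (ltn_ord j) d0 d1.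
  have s0 : sin (t j / 2) != 0 by rewrite gt_eqF// sin_half_gt0.
  have := @fourier_inversion _ c f c0 cf iff S (moebius c (t j)) HS.
  rewrite phase_moebius// quot_density_moebius// -(is_derive_derive1 (is_derive_moebius s0)).
  move=> H; apply: (cvg_comp (fun L => (L * m)%N) _ _ H).
  move=> X [n0 _ Hn]; exists n0 => // n /= n0n; apply: Hn => /=.
  by rewrite (leq_trans n0n)// leq_pmulr.
have H : 2 / m%:R * \sum_(j < m) trigsum (cos_coef c f) (sin_coef c f) (L * m) (t j)
    @[L --> \oo] --> 2 / m%:R * \sum_(j < m)
      (pi * (f (moebius c (t j)) * derive1 (moebius c) (t j)) - intR f / 2).
  apply: cvgM; first exact: cvg_cst.
  by apply: cvg_big => [|j _]; [exact: add_continuous|exact: cv].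
move: H; under eq_fun do rewrite trigsum_aliasing// mulrA divfK//.
rewrite sumrB big_const_ord iter_addr_0 -mulr_sumr.
have -> : 2 / m%:R * (pi * \sum_(j < m) (f (moebius c (t j)) * derive1 (moebius c) (t j))
     - (intR f / 2) *+ m) = real_moebius_trapezoidal f m delta - intR f.
  rewrite /real_moebius_trapezoidal -(mulr_natr (intR f / 2) m).
  set Q := \sum_(j < m) _.
  by move: (pi : R) (intR f) Q => p q Q; field.
by [].
Qed.

End moebius_rule.

(** * Integration of possibly non-measurable or restricted quantities *)

Section measure_tools.
Context {R : realType} d (T : measurableType d) (P : {measure set T -> \bar R}).

(** The integral of a nonnegative function is a supremum over the simple
    functions below it, so it is monotone without any measurability; this spares
    a discussion of the measurability of the squared error. *)
Lemma integral_le_nonmeasurable (f g : T -> \bar R) :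
  (forall x, (0 <= f x)%E) -> (forall x, (f x <= g x)%E) ->
  (\int[P]_x f x <= \int[P]_x g x)%E.
Proof.
move=> f0 fg; have g0 x : (0 <= g x)%E by exact: le_trans (fg x).
rewrite !ge0_integralE//; apply: ereal_sup_le => _ [h /= hf <-].
exists h => //= x; move: (hf x); rewrite !patch_setT => hx.
exact: le_trans (fg x).
Qed.

Lemma integral_mrestr (D : set T) (mD : measurable D) (f : T -> \bar R) :
  measurable_fun setT f -> (forall x, (0 <= f x)%E) ->
  (\int[mrestr P mD]_x f x = \int[P]_(x in D) f x)%E.
Proof.
move=> mf f0; rewrite -(setUCr D) integral_setU//; last 3 first.
- exact: measurableC.
- exact: measurable_funS mf.
- by rewrite disj_set2E; apply/eqP; rewrite setICr.
rewrite (eq_measure_integral P); last first.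
  by move=> A mA AD; exact: (congr1 P (setIidl AD)).
rewrite [X in (_ + X)%E](_ : _ = 0%E) ?adde0//.
apply: null_set_integral => //; first exact: measurableC.
  exact: measurable_funS mf.
by rewrite /= /mrestr setICl measure0.
Qed.

End measure_tools.

(** * Expectation over the random node number and shift *)

Section expectation.
Context {R : realType} d (Omega : measurableType d) (P : probability Omega R).
Variables (a n : nat) (M : {RV P >-> nat}) (delta : {RV P >-> R}).
Hypothesis an : (a <= n)%N.
Hypothesis hM : uniform_on_range a n M.
Hypothesis hd : uniform01 delta.
Hypothesis hind : independent_RV M delta.

Let mMm m : measurable (M @^-1` [set m]).
Proof. by rewrite -[X in measurable X]setTI; exact: measurable_funPT. Qed.

Let mdB (B : set R) : measurable B -> measurable (delta @^-1` B).
Proof. by move=> mB; rewrite -[X in measurable X]setTI; exact: measurable_funPT. Qed.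

Let p : R := (n - a).+1%:R^-1.
Let p0 : 0 <= p. Proof. by rewrite invr_ge0. Qed.

(** On the event M = m the law of delta is, by independence, the uniform law
    scaled by the probability of that event. *)
Lemma integral_on_fiber m (g : R -> R) : (a <= m <= n)%N ->
  continuous g -> (forall x, 0 <= g x) -> integrableR (fun x => g x * \1_`[0, 1] x) ->
  (\int[P]_(w in M @^-1` [set m]) (g (delta w))%:E =
   (p * intR (fun x => g x * \1_`[0%R, 1%R] x))%:E)%E.
Proof.
move=> man cg g0 ig.
have mg : measurable_fun [set: R] (EFin \o g).
  by apply/measurable_EFinP; exact: continuous_measurable_fun.
have md : measurable_fun [set: Omega] (delta : Omega -> measurableTypeR R).
  by move=> _ B mB; rewrite setTI; exact: mdB.
rewrite -(integral_mrestr P (mMm m)); last 2 first.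
- exact: (measurableT_comp mg).
- by move=> w; rewrite lee_fin.
have mg' : measurable_fun [set: measurableTypeR R] (EFin \o g) by [].
have := @ge0_integral_pushforward _ _ _ _ _ _ md (mrestr P (mMm m)) setT (EFin \o g)
  measurableT mg'.
rewrite preimage_setT => <-; last by move=> y _; rewrite /= lee_fin.
transitivity (\int[mscale (NngNum p0) (uniform_prob (@ltr01 R))]_y (EFin \o g) y)%E.
  pose nu : measure (measurableTypeR R) R :=
    pushforward (mrestr P (mMm m)) (delta : Omega -> measurableTypeR R).
  apply: (@eq_measure_integral _ _ _ setT
    (mscale (NngNum p0) (uniform_prob (@ltr01 R))) (nu md) (EFin \o g)) => A mA _; rewrite /= /pushforward /mscale /mrestr /= setIC hind// hM man.
  by rewrite -hd.
rewrite ge0_integral_mscale//; last by move=> x _; rewrite /= lee_fin.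
rewrite integral_uniform//.
rewrite subr0 invr1 mul1e EFinM; congr (_ * _)%E.
rewrite integral_mkcond /intR /Rintegral fineK; last exact: (integrable_fin_num measurableT ig).
by apply: eq_integral => x _; rewrite /= patchE indicE; case: ifP => _; rewrite ?mulr1 ?mulr0.
Qed.

Let Omega0 : set Omega := [set w | (a <= M w <= n)%N /\ 0 < delta w /\ delta w < 1].

(** The outcomes with M outside its range or delta outside ]0, 1[ form a
    countable union of null sets. *)
Lemma typical_outcomes : measurable (~` Omega0) /\ P (~` Omega0) = 0%E.
Proof.
have E : ~` Omega0 = delta @^-1` (~` `]0, 1[) `|`
    \bigcup_m (if (a <= m <= n)%N then set0 else M @^-1` [set m]).
  rewrite predeqE => w; split => /=.
    case: (boolP (a <= M w <= n)%N) => Mw H.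
      left => /=; rewrite in_itv/= => /andP[d0 d1]; exact: H.
    by right; exists (M w) => //=; rewrite (negbTE Mw).
  case=> [+ [_ [d0 d1]]|[m _]]; first by apply; rewrite /= in_itv/= d0 d1.
  by case: ifP => // + /= Mw [+ _]; rewrite -Mw => ->.
have mE : measurable (~` Omega0).
  rewrite E; apply: measurableU; first by apply: mdB; exact: measurableC.
  by apply: bigcup_measurable => m _; case: ifP.
split=> //; apply: measure_negligible => //; rewrite E; apply: negligibleU.
  apply/negligibleP; first by apply: mdB; exact: measurableC.
  rewrite /= -[LHS]/(distribution P delta (~` `]0, 1[)) hd; last exact: measurableC.
  rewrite probability_setC//.
  rewrite [X in (_ - X)%E](_ : _ = 1%E) ?subee//.
  rewrite -[`]0%R, 1%R[%classic]setIT -integral_indic//.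
  rewrite integral_uniform//; last first.
    by apply/measurable_EFinP; exact: measurable_indic.
  rewrite integral_indic// setIidl; last by apply: subset_itv; rewrite bnd_simp.
  rewrite [X in (_ * X)%E](lebesgue_measure_itv (`]0, 1[ : interval R))/= lte_fin ltr01 subr0 invr1 mul1e.
  by rewrite oppr0 adde0.
apply: negligible_bigcup => m; case: ifP => man; first exact: negligible_set0.
by apply/negligibleP => //; have := hM m; rewrite man.
Qed.

(** Fatou's lemma, applied to F_L = sum_m 1_(M = m) G m L (delta) + L 1_N with N
    the null set of exceptional outcomes: the second term has integral 0 and
    makes the lower limit infinite on N, so that the lower limit dominates X
    everywhere. *)
Theorem expectation_bound (X : Omega -> R) (G : nat -> nat -> R -> R) (K : R) :
  (forall w, 0 <= X w) ->
  (forall m L, continuous (G m L)) -> (forall m L x, 0 <= G m L x) ->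
  (forall m L, integrableR (fun x => G m L x * \1_`[0, 1] x)) ->
  (forall w, (a <= M w <= n)%N -> 0 < delta w -> delta w < 1 ->
     G (M w) L (delta w) @[L --> \oo] --> X w) ->
  (forall L, \sum_(a <= m < n.+1) intR (fun x => G m L x * \1_`[0, 1] x) <= K) ->
  (\int[P]_w (X w)%:E <= (K / (n - a).+1%:R)%:E)%E.
Proof.
move=> X0 cG G0 iG cvX bK.
have [mN PN] := typical_outcomes.
pose h L m w : \bar R := (\1_(M @^-1` [set m]) w * G m L (delta w))%:E.
pose F L w : \bar R := (\sum_(a <= m < n.+1) h L m w + (L%:R * \1_(~` Omega0) w)%:E)%E.
have mh L m : measurable_fun setT (h L m).
  apply/measurable_EFinP; apply: measurable_funM; first exact: measurable_indic.
  by apply: measurableT_comp => //; exact: continuous_measurable_fun.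
have h0 L m w : (0 <= h L m w)%E by rewrite lee_fin mulr_ge0.
have mI L : measurable_fun setT (fun w => (L%:R * \1_(~` Omega0) w)%:E : \bar R).
  by apply/measurable_EFinP; apply: measurable_funM => //; exact: measurable_indic.
have mF L : measurable_fun setT (F L).
  by apply: emeasurable_funD => //; exact: emeasurable_sum.
have F0 L w : (0 <= F L w)%E.
  by rewrite adde_ge0 ?sume_ge0// lee_fin mulr_ge0.
have XF w : ((X w)%:E <= limn_einf (F ^~ w))%E.
  have [wO|wN] := pselect (Omega0 w).
    have [man [d0 d1]] := wO.
    have FE : F ^~ w = fun L => (G (M w) L (delta w))%:E.
      apply/funext => L; rewrite /F indicE memNset ?mulr0 ?adde0; last by move=> /(_ wO).
      rewrite (bigD1_seq (M w)) ?iota_uniq//=; last by rewrite mem_index_iota ltnS.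
      rewrite big1 ?adde0; first by rewrite /h indicE mem_set// mul1r.
      by move=> m mM; rewrite /h indicE memNset ?mul0r//= => mE; rewrite mE eqxx in mM.
    rewrite FE (cvg_limn_einf_sup (l := (X w)%:E))//.
    by apply/cvg_EFin; [exact: nearW|exact: cvX].
  have cvF : F L w @[L --> \oo] --> +oo%E.
    (* On the exceptional set F_L is at least L. *)
    apply/cvgeyPge => A; near=> L.
    apply: (@le_trans _ _ (L%:R)%:E); first by rewrite lee_fin; near: L; exact: nbhs_infty_ger.
    by rewrite /F indicE mem_set// mulr1 leeDr// sume_ge0.
  by rewrite (cvg_limn_einf_sup cvF) leey.
have IF L : (\int[P]_w F L w <= (K / (n - a).+1%:R)%:E)%E.
  rewrite ge0_integralD//; last 2 first.
  - by move=> w _; rewrite sume_ge0.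
  - exact: emeasurable_sum.
  under [X in (_ + X)%E]eq_integral do rewrite EFinM.
  rewrite ge0_integralZl_EFin//; last by apply/measurable_EFinP; exact: measurable_indic.
  rewrite [X in (_ + _ * X)%E](_ : _ = 0%E); last first.
    by rewrite integral_indic// setIT; exact: PN.
  rewrite mule0 adde0 ge0_integral_sum//.
  rewrite (eq_big_nat _ _ (F2 := fun m => (p * intR (fun x => G m L x * \1_`[0, 1] x))%:E)).
    by rewrite sumEFin lee_fin -mulr_sumr mulrC ler_wpM2r.
  move=> m man; rewrite -(@integral_on_fiber m (G m L))//.
  rewrite [RHS]integral_mkcond; apply: eq_integral => w _.
  by rewrite patchE /h indicE; case: ifP => _; rewrite ?mul1r ?mul0r.
have XL : (\int[P]_w (X w)%:E <= \int[P]_w limn_einf (F ^~ w))%E.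
  by apply: integral_le_nonmeasurable => // w; rewrite lee_fin.
apply: le_trans XL _.
apply: le_trans (fatou _ measurableT mF (fun L w _ => F0 L w)) _.
rewrite limn_einf_lim; apply: lime_le; first exact: is_cvg_einfs.
near=> L; apply: le_trans (IF L).
by apply: ereal_inf_lbound; exists L => /=.
Unshelve. all: by end_near.
Qed.

End expectation.

(** * The mean square error *)

Section mean_square.
Context {R : realType}.

(** With the uniform shift delta the harmonics of 2 pi delta are orthogonal on
    [0, 1]. *)
Lemma unit_interval_parseval (A B : nat -> R) L :
  integrableR (fun t => (2 * trigsum A B L (2 * pi * t)) ^+ 2 * \1_`[0, 1] t) /\
  intR (fun t => (2 * trigsum A B L (2 * pi * t)) ^+ 2 * \1_`[0, 1] t) =
    2 * \sum_(l < L) (A l.+1 ^+ 2 + B l.+1 ^+ 2).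
Proof.
have one : integrableR (\1_`[0, 1] : R -> R) /\ intR (\1_`[0, 1] : R -> R) = 1.
  split.
    apply/integrableP; split; first by apply/measurable_EFinP; exact: measurable_real_indic.
    under eq_integral do rewrite /= ger0_norm//.
    rewrite integral_indic// setIT [X in (X < _)%E](lebesgue_measure_itv (`[0, 1] : interval R)).
    by rewrite /= lte_fin ltr01 -EFinB ltry.
  have c1 : continuous (fun _ : R => 1 : R) by move=> x; exact: cvg_cst.
  have := @intR_FTC _ (fun=> 1) id 0 1 ltr01 c1 (fun x => is_derive_idr x).
  by rewrite subr0; under eq_fun do rewrite mulr1.
have dlin k (x : R) : is_derive x 1 (fun t : R => k.+1%:R * (2 * pi * t)) (k.+1%:R * (2 * pi)).
  by have := is_derive_scale k.+1%:R (is_derive_scale (2 * pi) (is_derive_idr x)); rewrite mulr1.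
have knz k : k.+1%:R * (2 * pi) != 0 :> R.
  by rewrite gt_eqF// mulr_gt0// mulr_gt0// pi_gt0.
have hc k : intR (fun x : R => cos (k.+1%:R * (2 * pi * x)) * \1_`[0, 1] x) = 0.
  under eq_fun do rewrite mulrC.
  have cf : continuous (fun x : R => cos (k.+1%:R * (2 * pi * x))).
    by move=> x; exact: is_derive_continuous (@is_derive_compr _ cos _ _ _ _ (is_derive_cos _) (dlin k x)).
  have dF (x : R) : is_derive x 1 (fun t : R => (k.+1%:R * (2 * pi))^-1 * sin (k.+1%:R * (2 * pi * t)))
      (cos (k.+1%:R * (2 * pi * x))).
    apply: is_derive_eq
      (is_derive_scale ((k.+1%:R * (2 * pi))^-1) (@is_derive_compr _ sin _ _ _ _ (is_derive_sin _) (dlin k x))) _.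
    by rewrite mulrCA mulVf// mulr1.
  rewrite (intR_FTC ltr01 cf dF).
  have := @sin_add_2npi R 0 k.+1.
  by rewrite mulr1 mulr0 mulr0 add0r => ->; rewrite sin0 subrr.
have hs k : intR (fun x : R => sin (k.+1%:R * (2 * pi * x)) * \1_`[0, 1] x) = 0.
  under eq_fun do rewrite mulrC.
  have cf : continuous (fun x : R => sin (k.+1%:R * (2 * pi * x))).
    by move=> x; exact: is_derive_continuous (@is_derive_compr _ sin _ _ _ _ (is_derive_sin _) (dlin k x)).
  have dF (x : R) : is_derive x 1 (fun t : R => - (k.+1%:R * (2 * pi))^-1 * cos (k.+1%:R * (2 * pi * t)))
      (sin (k.+1%:R * (2 * pi * x))).
    apply: is_derive_eq
      (is_derive_scale (- (k.+1%:R * (2 * pi))^-1) (@is_derive_compr _ cos _ _ _ _ (is_derive_cos _) (dlin k x))) _.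
    by rewrite mulNr mulNr mulrN opprK mulrCA mulVf// mulr1.
  rewrite (intR_FTC ltr01 cf dF).
  have := @cos_add_2npi R 0 k.+1.
  by rewrite mulr1 mulr0 mulr0 add0r => ->; rewrite cos0 subrr.
have mth : measurable_real (fun t : R => 2 * pi * t) by exact: measurable_funM.
have [i1 e1] := trigsum_parseval mth one.1 one.2 hc hs A B L.
have E t : (2 * trigsum A B L (2 * pi * t)) ^+ 2 * \1_`[0, 1] t =
    4 * (trigsum A B L (2 * pi * t) ^+ 2 * \1_`[0, 1] t) by ring.
split; first by under eq_fun do rewrite E; exact: integrableRZ.
by under eq_fun do rewrite E; rewrite intRZ// e1; field.
Qed.

(** The multiples of l are distinct indices. *)
Lemma multiples_sum_le (g : nat -> R) l n : (forall k, 0 <= g k) -> (0 < l)%N ->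
  \sum_(m < n) g (l * m.+1)%N <= \sum_(k < l * n) g k.+1.
Proof.
move=> g0 l0; elim: n => [|n IH]; first by rewrite big_ord0 sumr_ge0.
rewrite big_ord_recr /=.
have -> : (l * n.+1 = (l * n + l.-1).+1)%N by rewrite -addnS prednK// mulnS addnC.
rewrite (big_ord_recr (l * n + l.-1)) /= lerD//.
rewrite (le_trans IH)// big_split_ord /= lerDl sumr_ge0//.
Qed.

(** For each l the sum over m runs over distinct frequencies l m, whose energy
    with the factor (l m)^(2 alpha) is at most S; the factors left over are
    l^(-2 alpha) <= l^(-2) and a^(-2 alpha). *)
Lemma aliased_energy_le (e : nat -> R) (S : R) alpha a n L :
  (forall k, 0 <= e k) -> (1 <= alpha)%N -> (0 < a)%N ->
  (forall N, \sum_(k < N) (k.+1%:R ^+ alpha) ^+ 2 * e k.+1 <= S) ->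
  \sum_(a <= m < n.+1) \sum_(l < L) e (l.+1 * m)%N <= 2 * S / (a%:R ^+ alpha) ^+ 2.
Proof.
move=> e0 al a0 HS; have aR : 0 < (a%:R ^+ alpha) ^+ 2 :> R by rewrite !exprn_gt0// ltr0n.
pose g k := (k%:R ^+ alpha) ^+ 2 * e k.
have g0 k : 0 <= g k by rewrite mulr_ge0// sqr_ge0.
have S0 : 0 <= S by have := HS 0%N; rewrite big_ord0.
rewrite exchange_big /=.
apply: (@le_trans _ _ (\sum_(l < L) (l.+1%:R ^+ 2)^-1 * (S / (a%:R ^+ alpha) ^+ 2))).
  apply: ler_sum => l _.
  apply: (@le_trans _ _ (\sum_(a <= m < n.+1)
      (l.+1%:R ^+ 2)^-1 * ((a%:R ^+ alpha) ^+ 2)^-1 * g (l.+1 * m)%N)).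
    rewrite big_nat [leRHS]big_nat; apply: ler_sum => m /andP[am _].
    rewrite -invfM /g natrM exprMn exprMn mulrA ler_peMl//.
    rewrite mulrC ler_pdivlMr ?mul1r; last by rewrite mulr_gt0// exprn_gt0.
    apply: ler_pM; rewrite ?sqr_ge0//.
      by rewrite lerXn2r ?nnegrE ?exprn_ge0// ler_eXnr// ler1n.
    by rewrite lerXn2r ?nnegrE ?exprn_ge0// lerXn2r ?nnegrE// ler_nat.
  rewrite -mulr_sumr -mulrA ler_wpM2l ?invr_ge0 ?exprn_ge0// mulrC.
  rewrite ler_wpM2r ?invr_ge0 ?(ltW aR)//.
  apply: le_trans (HS (l.+1 * n)%N).
  apply: le_trans (multiples_sum_le n g0 (ltn0Sn l)).
  rewrite -(big_mkord xpredT (fun m => g (l.+1 * m.+1)%N)).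
  rewrite -(big_add1 _ _ 0 n.+1 xpredT (fun m => g (l.+1 * m)%N)).
  have [an|na] := leqP a n.+1; last by rewrite (big_geq (ltnW na)) sumr_ge0.
  by rewrite (big_cat_nat a0 an)/= lerDr sumr_ge0.
rewrite -mulr_suml mulrA ler_wpM2r ?invr_ge0 ?(ltW aR)// mulrC [leRHS]mulrC.
by rewrite ler_wpM2l// sum_inv_sqr_le.
Qed.

(** Up to a constant factor, a bound on the squared periodic Sobolev seminorm of
    order alpha of the transplanted integrand. *)
Definition spectral_bound c (f : R -> R) alpha S := forall N,
  \sum_(k < N) (k.+1%:R ^+ alpha) ^+ 2 *
     (cos_coef c f k.+1 ^+ 2 + sin_coef c f k.+1 ^+ 2) <= S.

(** Real and imaginary parts are treated together, since the squared modulus of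
    the error is the sum of the squares of their errors. *)
Theorem mean_square_bound c (f1 f2 : R -> R) alpha (S1 S2 : R)
    d (Omega : measurableType d) (P : probability Omega R)
    (M : {RV P >-> nat}) (delta : {RV P >-> R}) a n (X : Omega -> R) :
  0 < c -> (1 <= alpha)%N -> (0 < a)%N -> (a <= n)%N ->
  uniform_on_range a n M -> uniform01 delta -> independent_RV M delta ->
  continuous f1 -> integrableR (fun x => f1 x ^+ 2 * quot_density c x) ->
  spectral_bound c f1 alpha S1 ->
  continuous f2 -> integrableR (fun x => f2 x ^+ 2 * quot_density c x) ->
  spectral_bound c f2 alpha S2 ->
  (forall w, 0 <= X w) ->
  (forall w, (a <= M w <= n)%N -> 0 < delta w -> delta w < 1 ->
    X w = (real_moebius_trapezoidal c f1 (M w) (delta w) - intR f1) ^+ 2 +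
          (real_moebius_trapezoidal c f2 (M w) (delta w) - intR f2) ^+ 2) ->
  (\int[P]_w (X w)%:E <=
    (4 * (S1 + S2) / (a%:R ^+ alpha) ^+ 2 / (n - a).+1%:R)%:E)%E.
Proof.
move=> c0 al a0 an hM hd hind cf1 if1 HS1 cf2 if2 HS2 X0 XE.
have weak f S : spectral_bound c f alpha S -> forall N, \sum_(k < N) k.+1%:R ^+ 2 *
     (cos_coef c f k.+1 ^+ 2 + sin_coef c f k.+1 ^+ 2) <= S.
  move=> HS N; apply: le_trans (HS N); apply: ler_sum => k _.
  rewrite ler_wpM2r ?addr_ge0 ?sqr_ge0//.
  by rewrite lerXn2r ?nnegrE ?exprn_ge0// ler_eXnr// ler1n.
pose T f m L t := 2 * trigsum (fun i => cos_coef c f (i * m))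
  (fun i => sin_coef c f (i * m)) L (2 * pi * t).
pose e f k := cos_coef c f k ^+ 2 + sin_coef c f k ^+ 2.
have e0 f k : 0 <= e f k by rewrite addr_ge0 ?sqr_ge0.
have IT f m L : integrableR (fun t => T f m L t ^+ 2 * \1_`[0, 1] t) /\
    intR (fun t => T f m L t ^+ 2 * \1_`[0, 1] t) = 2 * \sum_(l < L) e f (l.+1 * m)%N.
  exact: unit_interval_parseval.
have cT f m L : continuous (T f m L).
  move=> t; apply: cvgM; first exact: cvg_cst.
  apply: (@continuous_comp _ _ _ (fun t => 2 * pi * t)); last exact: continuous_trigsum.
  by apply: cvgM; [exact: cvg_cst|exact: cvg_id].
have GE m L t : (T f1 m L t ^+ 2 + T f2 m L t ^+ 2) * \1_`[0, 1] t =
    T f1 m L t ^+ 2 * \1_`[0, 1] t + T f2 m L t ^+ 2 * \1_`[0, 1] t by exact: mulrDl.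
apply: (@expectation_bound _ _ _ P a n M delta hM hd hind X
  (fun m L t => T f1 m L t ^+ 2 + T f2 m L t ^+ 2)) => //.
- by move=> m L t; apply: cvgD; apply: cvgM; exact: cT.
- by move=> m L t; rewrite addr_ge0 ?sqr_ge0.
- move=> m L; under eq_fun do rewrite GE.
  by apply: integrableRD; [exact: (IT f1 m L).1|exact: (IT f2 m L).1].
- move=> w Mw d0 d1; rewrite XE//.
  have m0 : (0 < M w)%N by case/andP: Mw => + _; exact: leq_trans.
  have h1 := trapezoidal_error_series c0 cf1 if1 (weak _ _ HS1) m0 d0 d1.
  have h2 := trapezoidal_error_series c0 cf2 if2 (weak _ _ HS2) m0 d0 d1.
  by apply: cvgD; apply: cvgM.
move=> L; under eq_bigr => m _.
  under eq_fun do rewrite GE.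
  rewrite (intRD (IT f1 m L).1 (IT f2 m L).1) (IT f1 m L).2 (IT f2 m L).2.
  over.
rewrite big_split /= -!mulr_sumr.
have := aliased_energy_le n L (e0 f1) al a0 HS1.
have := aliased_energy_le n L (e0 f2) al a0 HS2.
move: (\sum_(_ <= _ < _) _) (\sum_(_ <= _ < _) _) => s2 s1 h2 h1.
have -> : 4 * (S1 + S2) / (a%:R ^+ alpha) ^+ 2 =
  2 * (2 * S1 / (a%:R ^+ alpha) ^+ 2) + 2 * (2 * S2 / (a%:R ^+ alpha) ^+ 2) by ring.
by rewrite lerD// ler_wpM2l.
Qed.

End mean_square.

(** * Real and imaginary parts *)

Section components.
Local Open Scope complex_scope.
Context {R : realType}.
Local Notation Re := complex.Re.
Local Notation Im := complex.Im.
Implicit Types (z : R[i]) (f : R -> R[i]).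

Lemma ReMr z (r : R) : Re (z * r%:C) = Re z * r.
Proof. by case: z => a b /=; rewrite mulr0 subr0. Qed.

Lemma ImMr z (r : R) : Im (z * r%:C) = Im z * r.
Proof. by case: z => a b /=; rewrite mulr0 add0r. Qed.

Lemma ReB z1 z2 : Re (z1 - z2) = Re z1 - Re z2.
Proof. by case: z1; case: z2. Qed.

Lemma ImB z1 z2 : Im (z1 - z2) = Im z1 - Im z2.
Proof. by case: z1; case: z2. Qed.

Lemma Re_sum m (F : 'I_m -> R[i]) : Re (\sum_(j < m) F j) = \sum_(j < m) Re (F j).
Proof.
elim: m F => [|m IH] F; first by rewrite !big_ord0.
by rewrite !big_ord_recr /= -IH; case: (\sum_(j < m) _) => a b; case: (F _).
Qed.

Lemma Im_sum m (F : 'I_m -> R[i]) : Im (\sum_(j < m) F j) = \sum_(j < m) Im (F j).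
Proof.
elim: m F => [|m IH] F; first by rewrite !big_ord0.
by rewrite !big_ord_recr /= -IH; case: (\sum_(j < m) _) => a b; case: (F _).
Qed.

Lemma normc_sqr z : ComplexField.Normc.normc z ^+ 2 = Re z ^+ 2 + Im z ^+ 2.
Proof. by case: z => a b /=; rewrite sqr_sqrtr// addr_ge0 ?sqr_ge0. Qed.

Lemma normc_ge0 z : 0 <= ComplexField.Normc.normc z.
Proof. by case: z => a b /=; exact: sqrtr_ge0. Qed.

Lemma signM_complex tau z : (-1) ^+ tau * z = z * ((-1) ^+ tau)%:C.
Proof. by rewrite mulrC rmorphXn rmorphN1. Qed.

Lemma Re_Cintegral f (g : R -> R) :
  Re (Cintegral (fun x => f x * (g x)%:C)) = intR (fun x => Re (f x) * g x).
Proof. by rewrite /Cintegral /= /intR; congr Rintegral; apply/funext => x; rewrite ReMr. Qed.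

Lemma Im_Cintegral f (g : R -> R) :
  Im (Cintegral (fun x => f x * (g x)%:C)) = intR (fun x => Im (f x) * g x).
Proof. by rewrite /Cintegral /= /intR; congr Rintegral; apply/funext => x; rewrite ImMr. Qed.

Lemma moebius_trapezoidal_components c rho m delta f :
  0 < c -> 0 < delta -> delta < 1 ->
  Re (moebius_trapezoidal c rho m delta f) =
    real_moebius_trapezoidal c (fun x => Re (f x) * rho x) m delta /\
  Im (moebius_trapezoidal c rho m delta f) =
    real_moebius_trapezoidal c (fun x => Im (f x) * rho x) m delta.
Proof.
move=> c0 d0 d1; rewrite /moebius_trapezoidal mulrC ReMr ImMr Re_sum Im_sum.
rewrite /real_moebius_trapezoidal.
split; rewrite mulrC; congr (_ * _); apply: eq_bigr => j _ /=.
all: have [t0 t2] := trapezoidal_node_itv (ltn_ord j) d0 d1.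
all: by rewrite gt_eqF// lt_eqF//= ?ReMr ?ImMr mulrA.
Qed.

End components.

(** * The weighted Sobolev norm in components *)

Section sobolev_components.
Local Open Scope complex_scope.
Context {R : realType}.
Variables (rho : R -> R) (alpha : nat) (f : R -> R[i]).
Hypothesis hrho : schwartz_mon_pos rho.
Hypothesis hf : sobolev rho alpha 2 f.
Local Notation Re := complex.Re.
Local Notation Im := complex.Im.

Let rho0 x : 0 < rho x. Proof. by have [_ + _] := hrho; apply. Qed.

Let crho : continuous rho.
Proof. by apply: smooth_continuous; have [[+ _] _ _] := hrho. Qed.

Lemma weak_derivativeP tau : (tau <= alpha)%N ->
  Clocally_integrable (weak_derivative tau f) \/ tau = 0%N.
Proof.
move=> ta; rewrite /weak_derivative; case: eqP => [->|_]; first by right.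
left; have [_ /(_ _ ta) ex _] := hf.
exact: (xgetPex (fun=> 0) ex).1.
Qed.

Lemma measurable_weak_derivative tau : (tau <= alpha)%N ->
  measurable_real (fun x => Re (weak_derivative tau f x)) /\
  measurable_real (fun x => Im (weak_derivative tau f x)).
Proof.
move=> ta; have [[[mr _ _] [mi _ _]]|->] := weak_derivativeP ta; first by split.
by have [[cr ci] _ _] := hf; split; exact: continuous_measurable_real.
Qed.

Lemma weak_derivative_spec tau psi : (tau <= alpha)%N -> test_function psi ->
  intR (fun x => Re (f x) * derive1n tau psi x) =
    (-1) ^+ tau * intR (fun x => Re (weak_derivative tau f x) * psi x) /\
  intR (fun x => Im (f x) * derive1n tau psi x) =
    (-1) ^+ tau * intR (fun x => Im (weak_derivative tau f x) * psi x).
Proof.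
move=> ta tpsi; have E : Cintegral (fun x => f x * (derive1n tau psi x)%:C) =
    (-1) ^+ tau * Cintegral (fun x => weak_derivative tau f x * (psi x)%:C).
  rewrite /weak_derivative; case: eqP => [->|_]; first by rewrite expr0 mul1r.
  have [_ /(_ _ ta) ex _] := hf.
  exact: (xgetPex (fun=> 0) ex).2.
by rewrite -!Re_Cintegral -!Im_Cintegral E signM_complex ReMr ImMr; split; rewrite mulrC.
Qed.

(** The derivative of a test function is again a test function, so the defining
    identities of orders tau and tau + 1 can be compared on it. *)
Lemma weak_derivative_pair_components tau : (tau < alpha)%N ->
  weak_derivative_pair (fun x => Re (weak_derivative tau f x))
                       (fun x => Re (weak_derivative tau.+1 f x)) /\
  weak_derivative_pair (fun x => Im (weak_derivative tau f x))
                       (fun x => Im (weak_derivative tau.+1 f x)).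
Proof.
move=> ta.
have H psi : test_function psi -> _ := fun h =>
  (weak_derivative_spec (ltnW ta) (test_function_derive1 h), weak_derivative_spec ta h).
have s0 : (-1) ^+ tau != 0 :> R by rewrite signr_eq0.
split=> psi /H [[r1 i1] [r2 i2]]; apply: (mulfI s0).
- by rewrite -r1 -derive1Sn r2 exprS mulN1r mulNr mulrN.
- by rewrite -i1 -derive1Sn i2 exprS mulN1r mulNr mulrN.
Qed.

(** The square of the Sobolev norm, as a real number. *)
Definition energy : R := \sum_(tau < alpha.+1)
  (intR (fun x => Re (weak_derivative tau f x) ^+ 2 * rho x) +
   intR (fun x => Im (weak_derivative tau f x) ^+ 2 * rho x)).

Let sqnorm tau x := Re (weak_derivative tau f x) ^+ 2 * rho x +
                    Im (weak_derivative tau f x) ^+ 2 * rho x.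

Let norm_integrand tau x :
  (ComplexField.Normc.normc (weak_derivative tau f x) `^ 2 * rho x) = sqnorm tau x.
Proof. by rewrite (powR_mulrn 2) ?normc_ge0// normc_sqr mulrDl. Qed.

Let sqnorm_ge0 tau x : 0 <= sqnorm tau x.
Proof. by rewrite addr_ge0// mulr_ge0 ?sqr_ge0// ltW. Qed.

Let weighted_parts tau : (tau <= alpha)%N -> measurable_real (sqnorm tau) /\ integrableR (sqnorm tau).
Proof.
move=> ta; have [mr mi] := measurable_weak_derivative ta.
have mrho : measurable_real rho by exact: continuous_measurable_real.
have ms : measurable_real (sqnorm tau).
  apply: measurable_funD; apply: measurable_funM => //; exact: measurable_funX.
split=> //; apply/integrableP; split; first exact/measurable_EFinP.
have [_ _ +] := hf; rewrite /sobolev_norm => /lty_poweRy.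
rewrite invr_eq0 pnatr_eq0 => /(_ isT).
have t0 (i : 'I_alpha.+1) : (0 <= \int[lebesgue_measure]_x
    (ComplexField.Normc.normc (weak_derivative i f x) `^ 2 * rho x)%:E)%E.
  by apply: integral_ge0 => x _; rewrite lee_fin norm_integrand.
rewrite (bigD1 (Ordinal (ta : (tau < alpha.+1)%N)))//=.
move=> H; apply: le_lt_trans H.
apply: le_trans (_ : (\int[lebesgue_measure]_x
    (ComplexField.Normc.normc (weak_derivative tau f x) `^ 2 * rho x)%:E <= _)%E); last first.
  by rewrite leeDl// sume_ge0.
by under eq_integral do rewrite /= ger0_norm// -norm_integrand.
Qed.

Lemma weighted_L2_weak_derivative tau : (tau <= alpha)%N ->
  weighted_L2 rho (fun x => Re (weak_derivative tau f x)) /\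
  weighted_L2 rho (fun x => Im (weak_derivative tau f x)).
Proof.
move=> ta; have [mr mi] := measurable_weak_derivative ta.
have [_ isq] := weighted_parts ta.
have mrho : measurable_real rho by exact: continuous_measurable_real.
split; split=> //; apply: integrableR_le isq _ => //.
- by apply: measurable_funM => //; exact: measurable_funX.
- move=> x; rewrite ger0_norm; last by rewrite mulr_ge0 ?sqr_ge0// ltW.
  by rewrite lerDl mulr_ge0 ?sqr_ge0// ltW.
- by apply: measurable_funM => //; exact: measurable_funX.
- move=> x; rewrite ger0_norm; last by rewrite mulr_ge0 ?sqr_ge0// ltW.
  by rewrite lerDr mulr_ge0 ?sqr_ge0// ltW.
Qed.

(** Finiteness of the norm makes every component square integrable against the
    weight, so all extended-real integrals are finite. *)
Lemma sobolev_normE : sobolev_norm rho alpha 2 f = (Num.sqrt energy)%:E.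
Proof.
have e0 : 0 <= energy.
  by apply: sumr_ge0 => i _; rewrite addr_ge0// intR_ge0// => x; rewrite mulr_ge0 ?sqr_ge0// ltW.
rewrite /sobolev_norm -powR12_sqrt// -poweR_EFin; congr (_ `^ _)%E.
rewrite -sumEFin; apply: eq_bigr => tau _.
have [[_ ir] [_ ii]] := weighted_L2_weak_derivative (ltn_ord tau).
rewrite -intRD//; have [_ isq] := weighted_parts (ltn_ord tau).
rewrite /intR /Rintegral fineK; last exact: (integrable_fin_num measurableT isq).
by apply: eq_integral => x _; rewrite norm_integrand.
Qed.

End sobolev_components.

(** * The convergence rate *)

Section rate.
Context {R : realType}.

Lemma quot_density_weight_bound (c : R) (rho : R -> R) : 0 < c -> schwartz_mon_pos rho ->
  exists2 C, 0 <= C & forall x, rho x * quot_density c x <= C.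
Proof.
move=> c0 [srho rho0 _].
have [C0 C00 H0] := schwartz_bound 0 0 srho.
have [C2 C20 H2] := schwartz_bound 0 2 srho.
exists ((C2 + c ^+ 2 * C0) / (2 * c)).
  by rewrite divr_ge0// ?addr_ge0 ?mulr_ge0 ?sqr_ge0// ltW.
move=> x; rewrite /quot_density mulrA ler_wpM2r ?invr_ge0 ?mulr_ge0 ?(ltW c0)//.
have := H0 x; have := H2 x; rewrite /= (ger0_norm (ltW (rho0 x))) expr0 mul1r.
rewrite real_normK ?num_real// => h2 h0.
have -> : rho x * (x ^+ 2 + c ^+ 2) = x ^+ 2 * rho x + c ^+ 2 * rho x by ring.
by rewrite lerD// ler_wpM2l// sqr_ge0.
Qed.

(** One factor rho of (u rho)^2 / density absorbs the quadratic growth of 1 /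
    density. *)
Lemma weighted_part_admissible (c : R) (rho u : R -> R) : 0 < c -> schwartz_mon_pos rho ->
  continuous u -> weighted_L2 rho u ->
  continuous (fun x => u x * rho x) /\
  integrableR (fun x => (u x * rho x) ^+ 2 * quot_density c x).
Proof.
move=> c0 hrho cu [mu iu]; have [srho rho0 _] := hrho.
have cr : continuous rho by apply: smooth_continuous; exact: srho.1.
have cq : continuous (quot_density c).
  move=> x; apply: cvgM; last exact: cvg_cst.
  by apply: cvgD; [apply: cvgM; exact: cvg_id|exact: cvg_cst].
have q0 x : 0 <= quot_density c x.
  by rewrite divr_ge0 ?addr_ge0 ?sqr_ge0// mulr_ge0// ltW.
split; first by move=> x; apply: cvgM; [exact: cu|exact: cr].
have [C C0 HC] := quot_density_weight_bound c0 hrho.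
apply: (integrableR_le _ (integrableRZ C iu)).
  apply: measurable_funM; last exact: continuous_measurable_real.
  by apply: measurable_funX; apply: measurable_funM => //; exact: continuous_measurable_real.
move=> x; rewrite ger0_norm; last by apply: mulr_ge0; [exact: sqr_ge0|exact: q0].
have -> : (u x * rho x) ^+ 2 * quot_density c x =
  (rho x * quot_density c x) * (u x ^+ 2 * rho x) by ring.
by rewrite ler_wpM2r// mulr_ge0 ?sqr_ge0// ltW.
Qed.

(** For n >= 2 the integer part of n / 2 is at least n / 3, and the range of M
    has at least n / 2 elements. *)
Lemma half_range_rate (D : R) alpha n : 0 <= D -> (2 <= n)%N ->
  4 * D / (n./2%:R ^+ alpha) ^+ 2 / (n - n./2).+1%:R <=
  8 * 9 ^+ alpha * D * (n%:R `^ (- alpha%:R - 2^-1)) ^+ 2 :> R.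
Proof.
move=> D0 n2; have n0 : 0 < n%:R :> R by rewrite ltr0n; exact: leq_trans n2.
have powE : (n%:R `^ (- alpha%:R - 2^-1)) ^+ 2 = ((n%:R ^+ alpha) ^+ 2)^-1 / n%:R :> R.
  rewrite -(powR_mulrn 2) ?powR_ge0// -powRrM.
  have -> : (- alpha%:R - 2^-1) * 2%:R = - (alpha%:R * 2 + 1) :> R by field.
  have -> : alpha%:R * 2 + 1 = (alpha * 2).+1%:R :> R by rewrite -(@natr1 R (alpha * 2)%N) natrM.
  by rewrite powRN powR_mulrn ?(ltW n0)// exprS invfM mulrC exprM.
rewrite powE.
have a3 : n%:R <= 3 * n./2%:R :> R.
  rewrite -natrM ler_nat -{1}(odd_double_half n).
  have : (0 < n./2)%N by rewrite half_gt0.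
  rewrite -muln2 mulSn [(2 * _)%N]mulnC leq_add2r => a1.
  exact: leq_trans (leq_b1 _) a1.
have h2 : n%:R <= 2 * (n - n./2).+1%:R :> R.
  rewrite -natrM ler_nat -{1 2}(odd_double_half n) -addnn.
  rewrite addnA addnK mul2n -addnn leq_add//.
  by rewrite (leq_trans (leq_addl (odd n) _)).
have a0 : 0 < n./2%:R :> R by rewrite ltr0n half_gt0.
have E9 : (n%:R ^+ alpha) ^+ 2 <= 9 ^+ alpha * (n./2%:R ^+ alpha) ^+ 2 :> R.
  have -> : 9 = 3 ^+ 2 :> R by rewrite expr2 -natrM.
  rewrite [3 ^+ 2 ^+ alpha]exprAC -!exprMn.
  by rewrite !lerXn2r ?nnegrE ?exprn_ge0 ?mulr_ge0.
move: E9 h2; have := exprn_gt0 2 (exprn_gt0 alpha a0); have := exprn_gt0 2 (exprn_gt0 alpha n0).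
have : 0 < (n - n./2).+1%:R :> R by rewrite ltr0n.
have : 0 <= 9 ^+ alpha :> R by exact: exprn_ge0.
move: ((n - n./2).+1%:R : R) (n%:R : R) n0 => Q N N0.
move: ((N ^+ alpha) ^+ 2) ((n./2%:R ^+ alpha) ^+ 2 : R) (9 ^+ alpha : R) => X Y Z Z0 Q0 X0 Y0 XY NQ.
have -> : 8 * Z * D * (X^-1 / N) = 8 * Z * D / (X * N) by rewrite invfM mulrA.
rewrite -mulrA -invfM ler_pdivlMr ?mulr_gt0// mulrAC ler_pdivrMr ?mulr_gt0//.
have H : X * N <= (Z * Y) * (2 * Q) by rewrite ler_pM// ltW.
have := ler_wpM2l D0 H; lra.
Qed.

End rate.

Theorem theorem4p2 (R : realType) (c : R) (hc : 0 < c)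
    (rho : R -> R) (hrho : schwartz_mon_pos rho)
    (alpha : nat) (halpha : (1 <= alpha)%N) :
  exists C : R, 0 < C /\
    forall (n : nat) (hn : (2 <= n)%N)
      (d : measure_display) (Omega : measurableType d) (P : probability Omega R)
      (M : {RV P >-> nat}) (delta : {RV P >-> R}),
      uniform_on_range n./2 n M ->
      uniform01 delta ->
      independent_RV M delta ->
      (rmse P rho alpha
         (fun w => moebius_trapezoidal c rho (M w) (delta w))
       <= (C * n%:R `^ (- alpha%:R - 2^-1))%:E)%E.
Proof.
have [D D0 HD] := coefficient_decay hc hrho alpha.
pose K : R := 8 * 9 ^+ alpha * D.
have K0 : 0 <= K by rewrite /K !mulr_ge0// exprn_ge0.
exists (Num.sqrt K + 1); split; first by rewrite ltr_wpDl// sqrtr_ge0.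
move=> n n2 d Omega P M delta hM hd hind.
apply: ge_ereal_sup => _ [f [hf _ ->]].
have rho0 x : 0 < rho x by have [_ + _] := hrho; apply.
pose re t x := complex.Re (weak_derivative t f x).
pose im t x := complex.Im (weak_derivative t f x).
pose S1 := \sum_(t < alpha.+1) intR (fun x => re t x ^+ 2 * rho x).
pose S2 := \sum_(t < alpha.+1) intR (fun x => im t x ^+ 2 * rho x).
have ES : energy rho alpha f = S1 + S2 by rewrite /energy big_split.
have E0 : 0 <= S1 + S2.
  by rewrite addr_ge0// sumr_ge0// => t _; rewrite intR_ge0// => x; rewrite mulr_ge0 ?sqr_ge0 ?ltW.
have [cre cim] : Ccontinuous f by have [+ _ _] := hf.
have [cr ir] := weighted_part_admissible hc hrho cre
  (weighted_L2_weak_derivative hrho hf (leq0n alpha)).1.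
have [ci ii] := weighted_part_admissible hc hrho cim
  (weighted_L2_weak_derivative hrho hf (leq0n alpha)).2.
have B1 : spectral_bound c (fun x => complex.Re (f x) * rho x) alpha (D * S1).
  apply: (HD re) => [t ta|t ta]; first exact: (weighted_L2_weak_derivative hrho hf ta).1.
  exact: (weak_derivative_pair_components hf ta).1.
have B2 : spectral_bound c (fun x => complex.Im (f x) * rho x) alpha (D * S2).
  apply: (HD im) => [t ta|t ta]; first exact: (weighted_L2_weak_derivative hrho hf ta).2.
  exact: (weak_derivative_pair_components hf ta).2.
pose r : R := n%:R `^ (- alpha%:R - 2^-1).
have r0 : 0 <= r by exact: powR_ge0.
have main : (\int[P]_w (ComplexField.Normc.normc (weighted_integral rho f -
    moebius_trapezoidal c rho (M w) (delta w) f) ^+ 2)%:E <=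
    ((Num.sqrt K * r * Num.sqrt (S1 + S2)) ^+ 2)%:E)%E.
  have a0 : (0 < n./2)%N by rewrite half_gt0.
  have an : (n./2 <= n)%N by rewrite -{2}(odd_double_half n) -addnn addnA leq_addl.
  apply: le_trans (@mean_square_bound _ c _ _ alpha _ _ _ _ P M delta n./2 n _
    hc halpha a0 an hM hd hind cr ir B1 ci ii B2 _ _) _.
  - by move=> w; exact: sqr_ge0.
  - move=> w _ d0 d1; have [eR eI] := moebius_trapezoidal_components rho (M w) f hc d0 d1.
    rewrite normc_sqr ReB ImB eR eI /weighted_integral Re_Cintegral Im_Cintegral.
    by congr (_ + _); rewrite -sqrrN opprB.
  rewrite lee_fin -mulrDr !exprMn !sqr_sqrtr//.
  apply: le_trans (half_range_rate alpha (mulr_ge0 D0 E0) n2) _.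
  by rewrite -/r /K; rewrite le_eqVlt; apply/orP; left; apply/eqP; ring.
rewrite (sobolev_normE hrho hf) ES.
set I := (\int[P]_w _)%E in main *.
have I0 : (0 <= I)%E by apply: integral_ge0 => w _; rewrite lee_fin sqr_ge0.
have main2 : (I `^ 2^-1 <= (Num.sqrt K * r * Num.sqrt (S1 + S2))%:E)%E.
  have b0 : 0 <= Num.sqrt K * r * Num.sqrt (S1 + S2) by rewrite !mulr_ge0// sqrtr_ge0.
  have h0 : 0 <= 2^-1 :> R by rewrite invr_ge0.
  have := gt0_ler_poweR h0 _ _ main; rewrite !in_itv/= !leey !andbT lee_fin sqr_ge0.
  move=> /(_ I0 isT) H; apply: le_trans H _.
  by rewrite lee_fin powR12_sqrt ?sqr_ge0// sqrtr_sqr ger0_norm.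
(* If the norm of f vanishes then so does the mean square error, and 0 / 0 = 0
   for extended reals. *)
have [S0|Spos] := eqVneq (Num.sqrt (S1 + S2)) 0.
  have -> : (I `^ 2^-1 = 0)%E.
    by apply/eqP; rewrite eq_le poweR_ge0 andbT; move: main2; rewrite S0 mulr0.
  by rewrite mul0e lee_fin mulr_ge0// addr_ge0// sqrtr_ge0.
have Sp : 0 < Num.sqrt (S1 + S2) by rewrite lt_neqAle eq_sym Spos sqrtr_ge0.
rewrite inver (negbTE Spos) lee_pdivrMr// -EFinM (le_trans main2)// lee_fin.
by rewrite ler_wpM2r ?(ltW Sp)// ler_wpM2r// lerDl.
Qed.
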